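(* Let $\beta>0$ and let $m,n\to\infty$ with $mn^{-1}\to\beta$. Consider the inhomogeneous random intersection graph $G=G(n,m,\mathrm{P}_X,\mathrm{P}_Y)$ and suppose that $\mathbf{E} X_1^2<\infty$, $\mathbf{E} X_1^3=\infty$, $\mathbf{E} Y_1<\infty$, $\mathbf{E} Y_1^2=\infty$. Let $a_2=\mathbf{E} X_1^2$, $b_1=\mathbf{E} Y_1$, $\kappa=\beta^{3/2}a_2^2b_1^{-1}$, $S_X=\sum_{i=1}^m X_i^3$ and $S_Y=\sum_{j=1}^n Y_j^2$. Then the global clustering coefficient satisfies $$C_G=\bigl(1+\kappa S_Y/S_X\bigr)^{-1}+o_P(1).$$
   Context: Inhomogeneous random intersection graph $G(n,m,\mathrm{P}_X,\mathrm{P}_Y)$: vertex set $V=\{v_1,\dots,v_n\}$, attribute set $W=\{w_1,\dots,w_m\}$. Attributes $w_i$ and vertices $v_j$ are assigned independent non-negative random weights $X_i$ and $Y_j$, where $X_1,\dots,X_m$ are iid with distribution $\mathrm{P}_X$ and $Y_1,\dots,Y_n$ are iid with distribution $\mathrm{P}_Y$ (these distributions do not depend on $m,n$). Conditionally on the weights, every pair $(w_i,v_j)$ is linked in a bipartite graph $H$ independently with probability $p_{ij}=\min\{1,X_iY_j/\sqrt{mn}\}$. Two distinct vertices of $V$ are adjacent in $G$ iff they have a common neighbour in $H$. The global clustering coefficient is $C_G=3\Delta/\Lambda$, where $\Delta$ is the number of triangles and $\Lambda$ the number of paths of length $2$ in $G$. $o_P(1)$ denotes a quantity converging to $0$ in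 probability. *)

(* Defs.v *)
From HB Require Import structures.
From mathcomp Require Import all_boot all_order all_algebra.
From mathcomp Require Import all_classical all_reals all_analysis.
Set Implicit Arguments.
Unset Strict Implicit.
Unset Printing Implicit Defensive.
Import Order.TTheory GRing.Theory Num.Theory.
Local Open Scope classical_set_scope.
Local Open Scope ring_scope.

Section IntersectionGraph.
Variables m n : nat.
(* h i j = true iff attribute w_i is linked to vertex v_j in H *)
Variable h : 'I_m -> 'I_n -> bool.

Definition rig_adj (u v : 'I_n) : bool :=
  (u != v) && [exists i : 'I_m, h i u && h i v].

Definition rig_triangles : nat :=
  #|[set S : {set 'I_n} | (#|S| == 3)%N &&
      [forall u in S, forall v in S, (u != v) ==> rig_adj u v]]|.

Definition rig_deg (v : 'I_n) : nat := #|[set u | rig_adj v u]|.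

(* number of paths of length 2 of G: sum over centres of C(deg,2) *)
Definition rig_paths2 : nat := (\sum_(v : 'I_n) 'C(rig_deg v, 2))%N.

Definition rig_clustering (R : realType) : R :=
  if rig_paths2 == 0%N then 0 else 3 * (rig_triangles%:R) / (rig_paths2%:R).
End IntersectionGraph.

Definition rig_prob (R : realType) (m n : nat) (x : 'I_m -> R) (y : 'I_n -> R)
  (i : 'I_m) (j : 'I_n) : R :=
  Num.min 1 (x i * y j / Num.sqrt (m%:R * n%:R)).

(* The random weights X (attributes), Y (vertices) and the random bipartite
   graph H on the probability space (T,P) follow the model G(n,m,P_X,P_Y):
   - X_1..X_m, Y_1..Y_n independent, X_i ~ PX, Y_j ~ PY;
   - conditionally on the weights, the links (w_i,v_j) are independent with
     probabilities p_ij, i.e. for every event E of the weights and every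
     bipartite configuration hh,  P(E /\ H = hh) = E[1_E prod q_ij(hh)]. *)
Definition rig_model (R : realType) (d : measure_display) (T : measurableType d)
  (m n : nat) (PX PY : probability R R) (P : probability T R)
  (X : 'I_m -> T -> R) (Y : 'I_n -> T -> R) (H : 'I_m -> 'I_n -> T -> bool) : Prop :=
  [/\ (forall i, measurable_fun setT (X i)),
      (forall j, measurable_fun setT (Y j)),
      (forall i j, measurable [set t | H i j t]),
      (forall (A : 'I_m -> set R) (B : 'I_n -> set R),
         (forall i, measurable (A i)) -> (forall j, measurable (B j)) ->
         P [set t | (forall i, A i (X i t)) /\ (forall j, B j (Y j t))] =
         ((\prod_(i < m) fine (PX (A i))) * (\prod_(j < n) fine (PY (B j))))%:E) &
      (forall (A : 'I_m -> set R) (B : 'I_n -> set R),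
         (forall i, measurable (A i)) -> (forall j, measurable (B j)) ->
         forall hh : 'I_m -> 'I_n -> bool,
         P [set t | (forall i, A i (X i t)) /\ (forall j, B j (Y j t)) /\
                    (forall i j, H i j t = hh i j)] =
         (\int[P]_(t in [set t | (forall i, A i (X i t)) /\ (forall j, B j (Y j t))])
            (\prod_(i < m) \prod_(j < n)
               (if hh i j then rig_prob (X ^~ t) (Y ^~ t) i j
                else 1 - rig_prob (X ^~ t) (Y ^~ t) i j))%:E)%E)].

(* Main.v *)
Require Import Defs.
From HB Require Import structures.
From mathcomp Require Import all_boot all_order all_algebra.
From mathcomp Require Import finmap.
From mathcomp Require Import all_classical all_reals all_analysis.
From mathcomp Require Import measurable_realfun ring lra.
Import Order.TTheory GRing.Theory Num.Theory numFieldNormedType.Exports.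
Set Implicit Arguments.
Unset Strict Implicit.
Unset Printing Implicit Defensive.

(* Let ND and NP be the numbers of ordered triangles and of ordered 2-paths, so
   that the clustering coefficient is ND / NP, and condition on the weights x, y.
   Put SX = \sum x_i^3, SY = \sum y_j^2, A = (b1 / sqrt beta)^3 SX and
   B = (a2 b1)^2 SY. Most triangles come from a single attribute, and there are
   about A of them; the 2-paths whose two edges use different attributes are
   mostly open, and there are about B of them. Only one-sided bounds are needed:
   - ND >= A - o(A + B): with D_i the number of vertices of weight <= M linked
     to w_i and t_i = E D_i, convexity gives D_i^3 >= 3 t_i^2 D_i - 2 t_i^3,
     which is linear in the links and concentrates by Chebyshev;
   - NP - ND >= B - o(A + B): likewise deg(v)^2 >= 2 tau_v deg(v) - tau_v^2 for
     the vertices v of weight > M, with tau_v = a2 b1 y_v;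
   - E NP <= (1 + o(1)) (A + B) by the first moment method; together with
     NP = ND + (NP - ND) >= (1 - o(1)) (A + B) this forces NP to be close to
     A + B.
   All error terms are o(SX + SY) because SX / n and SY / n tend to infinity;
   the laws of large numbers provide the weights for which this holds, and the
   model is extended from rectangles to all events of the weights by the
   pi-lambda theorem. *)

(** The obstacle is that SX and SY have infinite mean: a few heavy weights may carry them, and they
    stay random in the limit. Each lower bound therefore keeps only configurations in which no link
    joins two heavy ends: triangles made by one attribute of any weight on light vertices, and
    2-paths from a heavy centre through light attributes to light ends, where light means at most M.
    For typical weights the truncation at 1 in the link probability is never active on such links,
    so their means are exact products; links between two heavy ends occur only in upper bounds,
    where the truncation is dropped. Light attributes are forced in the second count because the
    2-paths closed by a single attribute number about A in all, which is no error term; with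
    attributes of weight at most M there are only O(n) of them. The split is harmless: light weights
    carry almost all of sum x_i^2 and sum y_j, but only O(n) of SX and SY. With q = 1 / sqrt (m n),
    the sums q sum x_i^2 and q sum y_j are close to f = a2 sqrt beta and g = b1 / sqrt beta. Then A
    = g^3 SX and B = f^2 g^2 SY, so B / A = kappa SY / SX with kappa = f^2 / g. *)

Local Open Scope ring_scope.

(** * Products of Bernoulli measures *)

Section Bernoulli.
Variables (R : realFieldType) (E : finType) (p : E -> R).
Implicit Types (b : {ffun E -> bool}) (F G : {ffun E -> bool} -> R).

Definition bern_weight b : R := \prod_e (if b e then p e else 1 - p e).

Definition bern_exp F : R := \sum_b bern_weight b * F b.

Definition bern_prob (A : pred {ffun E -> bool}) : R :=
  bern_exp (fun b => (A b)%:R).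

(** A monomial in the bits. Repetitions in [s] are allowed, so that a product of two sums of
    monomials is again one, by concatenation. *)
Definition all_bits (s : seq E) b : R := \prod_(e <- s) (b e)%:R.

Lemma eq_bern_exp F G : F =1 G -> bern_exp F = bern_exp G.
Proof. by move=> FG; apply: eq_bigr => b _; rewrite FG. Qed.

Lemma bern_expD F G :
  bern_exp (fun b => F b + G b) = bern_exp F + bern_exp G.
Proof. by rewrite -big_split; apply: eq_bigr => b _; rewrite mulrDr. Qed.

Lemma bern_expZ c F : bern_exp (fun b => c * F b) = c * bern_exp F.
Proof. by rewrite mulr_sumr; apply: eq_bigr => b _; rewrite mulrCA. Qed.

Lemma bern_exp_sum (I : finType) (P : pred I) (F : I -> {ffun E -> bool} -> R) :
  bern_exp (fun b => \sum_(i | P i) F i b) = \sum_(i | P i) bern_exp (F i).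
Proof. by rewrite exchange_big; apply: eq_bigr => b _; rewrite mulr_sumr. Qed.

Lemma bern_exp_prod (g : E -> bool -> R) :
  bern_exp (fun b => \prod_e g e (b e)) =
  \prod_e (p e * g e true + (1 - p e) * g e false).
Proof.
under [RHS]eq_bigr => e _.
  rewrite (_ : _ + _ =
    \sum_(x : bool) (if x then p e else 1 - p e) * g e x); last first.
    by rewrite big_bool.
  over.
rewrite bigA_distr_bigA; apply: eq_bigr => b _.
by rewrite -big_split.
Qed.

Lemma bern_exp_cst c : bern_exp (fun=> c) = c.
Proof.
(* The constant 1 is written as a product over [e], so that its expectation factors into the sums
   [p e + (1 - p e)]. *)
rewrite -[c in LHS]mulr1 bern_expZ -[1 in LHS](@big1_eq R 1 *%R E (index_enum E) xpredT).
rewrite (bern_exp_prod (fun _ _ => 1)) big1 ?mulr1// => e _.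
by rewrite !mulr1 addrC subrK.
Qed.

Lemma all_bitsE s b : all_bits s b = (all b s)%:R.
Proof.
rewrite /all_bits; elim: s => [|e s IH] /=; first by rewrite big_nil.
by rewrite big_cons IH; case: (b e); rewrite ?mul1r ?mul0r.
Qed.

(** Bits are idempotent, hence each member of [s] contributes once, however often it is listed. *)
Lemma bern_exp_all_bits s : bern_exp (all_bits s) = \prod_(e in s) p e.
Proof.
rewrite [RHS]big_mkcond.
rewrite (eq_bern_exp (G := fun b => \prod_e (if e \in s then (b e)%:R else 1))).
  rewrite (bern_exp_prod (fun e x => if e \in s then x%:R else 1)).
  apply: eq_bigr => e _; case: (e \in s); first by rewrite mulr1 mulr0 addr0.
  by rewrite !mulr1 addrC subrK.
move=> b; rewrite all_bitsE -big_mkcond /=; case: allP => [bs|nbs].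
  by rewrite big1// => e /bs ->.
have [e es be] : exists2 e, e \in s & ~~ b e.
  by apply/allPn/negP => /allP.
by rewrite (bigD1 e)//= (negbTE be) mul0r.
Qed.

Lemma bern_exp_all_bits_uniq s :
  uniq s -> bern_exp (all_bits s) = \prod_(e <- s) p e.
Proof. by move=> us; rewrite bern_exp_all_bits (big_uniq _ us). Qed.

Hypothesis p01 : forall e, 0 <= p e <= 1.

Lemma bern_weight_ge0 b : 0 <= bern_weight b.
Proof.
by apply: prodr_ge0 => e _; have /andP[? ?] := p01 e; case: ifP; rewrite ?subr_ge0.
Qed.

Lemma ler_bern_exp F G : (forall b, F b <= G b) -> bern_exp F <= bern_exp G.
Proof.
by move=> FG; apply: ler_sum => b _; rewrite ler_wpM2l// bern_weight_ge0.
Qed.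

Lemma bern_exp_ge0 F : (forall b, 0 <= F b) -> 0 <= bern_exp F.
Proof. by move=> F0; rewrite -(bern_exp_cst 0) ler_bern_exp. Qed.

Lemma bern_prob_le (A B : pred {ffun E -> bool}) :
  (forall b, A b -> B b) -> bern_prob A <= bern_prob B.
Proof.
move=> AB; apply: ler_bern_exp => b.
by case: (boolP (A b)) => [/AB ->|_] //; case: (B b).
Qed.

Lemma bern_probU (A B : pred {ffun E -> bool}) :
  bern_prob (fun b => A b || B b) <= bern_prob A + bern_prob B.
Proof.
rewrite -bern_expD; apply: ler_bern_exp => b.
by case: (A b); case: (B b); rewrite /= ?addr0 ?add0r// -natrD ler_nat.
Qed.

Lemma bern_markov F a : 0 < a -> (forall b, 0 <= F b) ->
  bern_prob (fun b => a <= F b) <= bern_exp F / a.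
Proof.
move=> a0 F0; rewrite mulrC -bern_expZ; apply: ler_bern_exp => b.
case: (leP a (F b)) => h /=; last by rewrite mulr_ge0 ?F0// invr_ge0 ltW.
by rewrite mulrC ler_pdivlMr// mul1r.
Qed.

Lemma bern_chebyshev F mu a : 0 < a ->
  bern_prob (fun b => F b <= mu - a) <= bern_exp (fun b => (F b - mu) ^+ 2) / a ^+ 2.
Proof.
move=> a0; apply: le_trans (bern_markov _ _); last 2 first.
- by rewrite exprn_gt0.
- by move=> b; rewrite sqr_ge0.
apply: bern_prob_le => b Fb; rewrite -(sqrrN (F b - mu)) ler_pXn2r// ?nnegrE; lra.
Qed.

Lemma bern_exp_sqr_dev F :
  bern_exp (fun b => (F b - bern_exp F) ^+ 2) =
  bern_exp (fun b => F b ^+ 2) - bern_exp F ^+ 2.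
Proof.
rewrite (eq_bern_exp (G := fun b =>
  F b ^+ 2 + ((- 2 * bern_exp F) * F b + bern_exp F ^+ 2))).
  by rewrite !bern_expD bern_expZ bern_exp_cst; ring.
by move=> b; ring.
Qed.

Lemma bern_exp_all_bits_cat s t : ~~ has [in s] t ->
  bern_exp (all_bits (s ++ t)) = bern_exp (all_bits s) * bern_exp (all_bits t).
Proof.
move=> st; rewrite !bern_exp_all_bits.
rewrite (eq_bigl (predU [in s] [in t])); last by move=> e; rewrite mem_cat.
rewrite bigU//=; apply/pred0P => e /=; apply/negP => /andP[es et].
by move/hasP: st; apply; exists e.
Qed.

(** Independence in the only form used later: two linear combinations of monomials whose supports
    share no bit. *)
Lemma bern_exp_mul_disjoint (I K : finType) (P : pred I) (Q : pred K)
    (c : I -> R) (d : K -> R) (s : I -> seq E) (t : K -> seq E) :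
  (forall i k, P i -> Q k -> ~~ has [in s i] (t k)) ->
  bern_exp (fun b => (\sum_(i | P i) c i * all_bits (s i) b) *
                     (\sum_(k | Q k) d k * all_bits (t k) b)) =
  bern_exp (fun b => \sum_(i | P i) c i * all_bits (s i) b) *
  bern_exp (fun b => \sum_(k | Q k) d k * all_bits (t k) b).
Proof.
move=> st; rewrite (eq_bern_exp (G := fun b => \sum_(i | P i) \sum_(k | Q k)
    c i * d k * all_bits (s i ++ t k) b)); last first.
  move=> b; rewrite big_distrlr; apply: eq_bigr => i _; apply: eq_bigr => k _.
  by rewrite /all_bits big_cat mulrACA.
rewrite !bern_exp_sum big_distrlr; apply: eq_bigr => i Pi.
rewrite bern_exp_sum; apply: eq_bigr => k Qk.
by rewrite !bern_expZ bern_exp_all_bits_cat ?st// mulrACA.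
Qed.

(** Off the diagonal the double sum cancels against the square of the mean; on the diagonal that
    square is dropped, which leaves second moments. *)
Lemma bern_var_sum (I : finType) (P : pred I) (F : I -> {ffun E -> bool} -> R) :
  (forall i k, P i -> P k -> i != k ->
     bern_exp (fun b => F i b * F k b) = bern_exp (F i) * bern_exp (F k)) ->
  bern_exp (fun b => (\sum_(i | P i) F i b
                      - bern_exp (fun b => \sum_(i | P i) F i b)) ^+ 2) <=
  \sum_(i | P i) bern_exp (fun b => F i b ^+ 2).
Proof.
move=> indep; rewrite (bern_exp_sqr_dev (fun b => \sum_(i | P i) F i b)) lerBlDr.
rewrite bern_exp_sum expr2 big_distrlr.
rewrite (eq_bern_exp (G := fun b => \sum_(i | P i) \sum_(k | P k) F i b * F k b)); last first.
  by move=> b; rewrite expr2 big_distrlr.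
rewrite bern_exp_sum -big_split; apply: ler_sum => i Pi /=.
rewrite bern_exp_sum (bigD1 i)//= [in leRHS](bigD1 i)//= addrA.
apply: lerD; first by rewrite lerDl -expr2 sqr_ge0.
by apply: ler_sum => k /andP[Pk ki]; rewrite indep// eq_sym.
Qed.

Lemma bern_exp_bit e : bern_exp (fun b => (b e)%:R) = p e.
Proof.
rewrite (eq_bern_exp (G := all_bits [:: e])); last first.
  by move=> b; rewrite all_bitsE /= andbT.
by rewrite bern_exp_all_bits_uniq// big_seq1.
Qed.

Lemma bern_exp_lin (I : finType) (P : pred I) (c : I -> R) (e : I -> E) :
  bern_exp (fun b => \sum_(i | P i) c i * (b (e i))%:R) = \sum_(i | P i) c i * p (e i).
Proof.
by rewrite bern_exp_sum; apply: eq_bigr => i _; rewrite bern_expZ bern_exp_bit.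
Qed.

Lemma bern_var_lin (I : finType) (P : pred I) (c : I -> R) (e : I -> E) :
  injective e ->
  bern_exp (fun b => (\sum_(i | P i) c i * (b (e i))%:R
    - \sum_(i | P i) c i * p (e i)) ^+ 2) <= \sum_(i | P i) c i ^+ 2 * p (e i).
Proof.
move=> einj; rewrite -bern_exp_lin.
apply: le_trans (bern_var_sum _) _ => [i k Pi Pk ik|].
  rewrite !bern_expZ !bern_exp_bit.
  rewrite (eq_bern_exp (G := fun b => c i * c k * all_bits [:: e i; e k] b)); last first.
    by move=> b; rewrite /all_bits !big_cons big_nil mulr1 mulrACA.
  rewrite bern_expZ bern_exp_all_bits_uniq.
    by rewrite !big_cons big_nil mulr1 mulrACA.
  by rewrite /= inE andbT (inj_eq einj).
apply: ler_sum => i _; rewrite -bern_exp_bit -bern_expZ; apply: ler_bern_exp => b.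
by rewrite exprMn; case: (b (e i)); rewrite ?expr1n ?expr0n.
Qed.

Lemma bern_exp_sqr_lin (I : finType) (P : pred I) (c : I -> R) (e : I -> E) :
  injective e ->
  bern_exp (fun b => (\sum_(i | P i) c i * (b (e i))%:R) ^+ 2) <=
  \sum_(i | P i) c i ^+ 2 * p (e i) + (\sum_(i | P i) c i * p (e i)) ^+ 2.
Proof.
move=> einj; rewrite -lerBlDr.
have := bern_var_lin P c einj; rewrite -bern_exp_lin.
by rewrite (bern_exp_sqr_dev (fun b => \sum_(i | P i) c i * (b (e i))%:R)).
Qed.

(** Common frame of the two lower tails: [F] is a linearized count handled by Chebyshev, [Err] a
    nonnegative correction handled by Markov, and each is allowed a deviation [a]. *)
Lemma bern_lower_tail (F Err N : {ffun E -> bool} -> R) (mu a V W : R) : 0 < a ->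
  (forall b, F b - Err b <= N b) -> (forall b, 0 <= Err b) -> mu <= bern_exp F ->
  bern_exp (fun b => (F b - bern_exp F) ^+ 2) <= V -> bern_exp Err <= W ->
  bern_prob (fun b => N b <= mu - a - a) <= V / a ^+ 2 + W / a.
Proof.
move=> a0 FN Err0 muF VF WE.
apply: (@le_trans _ _ (bern_prob (fun b => F b <= bern_exp F - a) +
                       bern_prob (fun b => a <= Err b))).
  apply: le_trans (bern_probU _ _); apply: bern_prob_le => b Nb.
  by case: (leP (F b)) => //= Fb; have := FN b; lra.
apply: lerD.
  apply: le_trans (bern_chebyshev _ _ a0) _.
  by rewrite ler_pM2r ?invr_gt0 ?exprn_gt0.
apply: le_trans (bern_markov a0 Err0) _.
by rewrite ler_pM2r ?invr_gt0.
Qed.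

(* Integrates [lo * 1(lo < N) + (hi - lo) * 1(hi < N) <= N]: a lower tail bound
   and a bound on the mean give an upper tail bound. *)
Lemma bern_upper_tail (N : {ffun E -> bool} -> R) (lo hi mean eta : R) :
  (forall b, 0 <= N b) -> 0 <= lo -> lo < hi ->
  bern_exp N <= mean -> bern_prob (fun b => N b <= lo) <= eta ->
  bern_prob (fun b => hi < N b) <= (mean - lo + lo * eta) / (hi - lo).
Proof.
move=> N0 lo0 lohi Nmean Nlo.
rewrite ler_pdivlMr ?subr_gt0// [leLHS]mulrC /bern_prob -bern_expZ.
have step : bern_exp (fun b => (hi - lo) * (hi < N b)%R%:R) <=
    bern_exp (fun b => N b + (- lo + lo * (N b <= lo)%R%:R)).
  apply: ler_bern_exp => b.
  have := N0 b; case: (leP (N b) lo) => Nlob; case: (ltP hi (N b)) => Nhib /=; lra.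
apply: (le_trans step); rewrite !bern_expD bern_expZ bern_exp_cst.
have := ler_wpM2l lo0 Nlo; rewrite /bern_prob; lra.
Qed.

End Bernoulli.

(** * Ordered triangles and 2-paths *)

Section Counting.
Variables (R : realType) (m n : nat) (h : 'I_m -> 'I_n -> bool).
Local Notation adj := (rig_adj h).

Lemma rig_adjC u v : adj u v = adj v u.
Proof.
by rewrite /rig_adj eq_sym; congr (_ && _); apply: eq_existsb => i; rewrite andbC.
Qed.

Lemma rig_adj_neq u v : adj u v -> u != v.
Proof. by case/andP. Qed.

Lemma rig_adj_ge u v i : u != v -> h i u -> h i v -> adj u v.
Proof. by move=> uv hu hv; rewrite /rig_adj uv; apply/existsP; exists i; rewrite hu. Qed.

Definition ordered_triangles : R :=
  \sum_v \sum_u \sum_w [&& adj v u, adj v w & adj u w]%:R.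

Definition ordered_paths2 : R :=
  \sum_v \sum_u \sum_w [&& u != w, adj v u & adj v w]%:R.

Lemma card3_ordered (S : {set 'I_n}) : #|S| = 3%N ->
  (\sum_v \sum_u \sum_w [&& v \in S, u \in S :\ v & w \in S :\ v :\ u] = 6)%N.
Proof.
move=> S3.
transitivity (\sum_(v in S) \sum_(u in S :\ v) \sum_(w in S :\ v :\ u) 1)%N.
  rewrite [RHS]big_mkcond; apply: eq_bigr => v _.
  case: (v \in S) => /=; last by rewrite big1// => u _; rewrite big1.
  rewrite [RHS]big_mkcond; apply: eq_bigr => u _.
  case: (u \in S :\ v) => /=; last by rewrite big1.
  by rewrite [RHS]big_mkcond; apply: eq_bigr => w _; case: (w \in _).
have -> : 6%N = (\sum_(v in S) 2)%N by rewrite sum_nat_const S3.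
apply: eq_bigr => v vS.
have S2 : #|S :\ v| = 2%N by move: S3; rewrite (cardsD1 v) vS => -[].
have -> : 2%N = (\sum_(u in S :\ v) 1)%N by rewrite sum_nat_const S2.
apply: eq_bigr => u uS; rewrite sum1_card.
by move: S2; rewrite (cardsD1 u) uS => -[].
Qed.

(** Only the set made of [v], [u] and [w] can contribute. Exchanging the sums then counts each
    triangle once for each of its 6 orderings. *)
Lemma triangles_containing v u w :
  (\sum_(S : {set 'I_n} | (#|S| == 3)%N &&
      [forall a in S, forall b in S, (a != b) ==> adj a b])
    [&& v \in S, u \in S :\ v & w \in S :\ v :\ u] =
  [&& adj v u, adj v w & adj u w])%N.
Proof.
case: (boolP [&& adj v u, adj v w & adj u w]) => [/and3P[vu vw uw]|nadj].
  have nvu := rig_adj_neq vu; have nvw := rig_adj_neq vw; have nuw := rig_adj_neq uw.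
  have wvu : w \notin [set v; u]%SET.
    by rewrite !inE negb_or ![w == _]eq_sym nvw.
  have c3 : #|w |: [set v; u]%SET| = 3%N by rewrite cardsU1 wvu cards2 nvu.
  rewrite (bigD1 (w |: [set v; u])%SET) /=; last first.
    rewrite c3 eqxx /=; apply/forall_inP => a; rewrite !inE => /or3P aS.
    apply/forall_inP => b; rewrite !inE => /or3P bS; apply/implyP.
    by case: aS => /eqP ->; case: bS => /eqP ->; rewrite ?eqxx// => _;
      rewrite // rig_adjC.
  rewrite !inE !eqxx ?orbT /= [u == v]eq_sym nvu ![w == _]eq_sym nvw nuw /= ?orbT.
  rewrite big1 ?addn0// => S /andP[/andP[/eqP S3 _] nS].
  case: (boolP [&& _, _ & _]) => // /and3P[vS uS wS]; case/eqP: nS.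
  apply/esym/eqP; rewrite eqEcard S3 c3 leqnn andbT.
  apply/fintype.subsetP => a; rewrite !inE => /or3P aS.
  move: uS wS; rewrite !inE => /andP[_ uS] /and3P[_ _ wS].
  by case: aS => /eqP ->.
rewrite big1// => S /andP[/eqP S3 /forall_inP aS].
case: (boolP [&& v \in S, _ & _]) => // /and3P[vS]; rewrite !inE.
move=> /andP[uv uS] /and3P[wu wv wS]; case/negP: nadj.
have adjS a b : a \in S -> b \in S -> b != a -> adj a b.
  move=> aS' bS ab; have /forall_inP/(_ _ bS) := aS _ aS'.
  by rewrite eq_sym ab.
by rewrite !adjS.
Qed.

Lemma ordered_trianglesE : ordered_triangles = 6 * (rig_triangles h)%:R.
Proof.
have -> : rig_triangles h = #|[pred S : {set 'I_n} | (#|S| == 3)%N &&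
      [forall u in S, forall v in S, (u != v) ==> adj u v]]|.
  by apply: eq_card => S; apply/idP/idP => [/set_mem|] // SP; exact/mem_set.
rewrite -sum1_card -natrM big_distrr /=.
have -> : ordered_triangles = (\sum_v \sum_u \sum_w
    [&& adj v u, adj v w & adj u w])%N%:R.
  rewrite natr_sum; apply: eq_bigr => v _; rewrite natr_sum; apply: eq_bigr => u _.
  by rewrite natr_sum.
congr (_%:R).
under eq_bigr do under eq_bigr do under eq_bigr do rewrite -triangles_containing.
under eq_bigr do under eq_bigr do rewrite exchange_big.
under eq_bigr do rewrite exchange_big.
rewrite exchange_big; apply: eq_bigr => S /andP[/eqP S3 _].
by rewrite muln1 card3_ordered.
Qed.

Lemma ordered_paths2E : ordered_paths2 = 2 * (rig_paths2 h)%:R.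
Proof.
rewrite /rig_paths2 -natrM big_distrr /= natr_sum; apply: eq_bigr => v _.
have dE : rig_deg h v = (\sum_u adj v u)%N.
  have -> : rig_deg h v = #|[pred u | adj v u]|.
    by apply: eq_card => u; apply/idP/idP => [/set_mem|] // uP; exact/mem_set.
  by rewrite -sum1_card big_mkcond; apply: eq_bigr => u _; rewrite inE; case: (adj v u).
have bin2d k : (2 * 'C(k, 2) + k = k * k)%N.
  case: k => [|k]; first by [].
  by rewrite -{1}mul_bin_diag bin1 succnK -mulnSr.
(* Adding the degree restores the diagonal [u = w] on the left and completes [2 'C(k, 2)] to [k * k]
   on the right. *)
rewrite -[LHS](addrK ((rig_deg h v)%:R)) -[RHS](addrK ((rig_deg h v)%:R)).
congr (_ - _); rewrite -natrD bin2d natrM {2}dE dE natr_sum -{1}big_split /=.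
rewrite big_distrlr /=; apply: eq_bigr => u _.
rewrite (bigD1 u)//= [in RHS](bigD1 u)//= eqxx /= add0r addrC; congr (_ + _).
  by case: (adj v u); rewrite ?mulr0 ?mulr1.
apply: eq_bigr => w wu; rewrite eq_sym wu /=.
by case: (adj v u); rewrite ?mul0r ?mul1r.
Qed.
End Counting.

(** The factors 6 and 2 account for the 3 in the coefficient. Without 2-paths, division by zero
    returns 0, which is also the default value of [rig_clustering]. *)
Lemma rig_clusteringE (R : realType) (m n : nat) (h : 'I_m -> 'I_n -> bool) :
  rig_clustering h R = ordered_triangles R h / ordered_paths2 R h.
Proof.
rewrite ordered_trianglesE ordered_paths2E /rig_clustering.
case: eqP => [->|/eqP nz]; first by rewrite !mulr0 invr0 mulr0.
have : (rig_paths2 h)%:R != 0 :> R by rewrite pnatr_eq0.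
by move=> ?; field.
Qed.

(** If [c] of the [t i] hold, there are [c ^ 2 - c] ordered pairs, and the claim for [c > 0] is
    [2 c - c ^ 2 <= 1], a square. *)
Lemma bonferroni (R : realDomainType) (I : finType) (P t : pred I) :
  \sum_(i | P i) (t i)%:R - \sum_(i | P i) \sum_(k | P k && (k != i)) (t i && t k)%:R
  <= [exists i, P i && t i]%:R :> R.
Proof.
have -> : \sum_(i | P i) \sum_(k | P k && (k != i)) (t i && t k)%:R =
    (\sum_(i | P i) (t i)%:R) ^+ 2 - \sum_(i | P i) (t i)%:R :> R.
  apply/eqP; rewrite eq_sym subr_eq -big_split expr2 big_distrlr /=; apply/eqP.
  apply: eq_bigr => i Pi; rewrite (bigD1 i)//= addrC; congr (_ + _).
    by apply: eq_bigr => k _; rewrite -natrM mulnb.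
  by rewrite -natrM mulnb andbb.
case: existsP => [[i /andP[Pi ti]]|nex] /=.
  set c := \sum_(i | _) _; have := sqr_ge0 (c - 1); lra.
rewrite big1 ?expr0n ?subrr// => i Pi; case: (boolP (t i)) => // ti.
by case: nex; exists i; rewrite Pi.
Qed.

(** * Inequalities for the counts, valid for every bipartite graph *)

Section CountingBounds.
Variables (R : realType) (m n : nat) (h : 'I_m -> 'I_n -> bool).
Local Notation adj := (rig_adj h).
Local Notation NT := (ordered_triangles R h).
Local Notation NP := (ordered_paths2 R h).
Variables (I : pred 'I_m) (J : pred 'I_n).

Definition attr_deg i : R := \sum_(v | J v) (h i v)%:R.
Local Notation D := attr_deg.

(** Three vertices with a common attribute form a triangle, and Bonferroni pays for those with two
    common attributes. The polynomial in [D i] is a lower bound for the number D (D - 1) (D - 2) of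
    ordered triples at attribute [i]. *)
Lemma ordered_triangles_ge :
  \sum_i (D i ^+ 3 - 3 * D i ^+ 2)
  - \sum_(v | J v) \sum_(u | J u) \sum_(w | J w && uniq [:: v; u; w])
      \sum_i \sum_(k | k != i)
        [&& h i v, h i u, h i w, h k v, h k u & h k w]%:R <= NT.
Proof.
apply: (@le_trans _ _ (\sum_(v | J v) \sum_(u | J u) \sum_(w | J w && uniq [:: v; u; w])
    [&& adj v u, adj v w & adj u w]%:R)); last first.
  rewrite /ordered_triangles [leLHS]big_mkcond; apply: ler_sum => v _.
  case: ifP => _; last by rewrite sumr_ge0// => u _; rewrite sumr_ge0.
  rewrite [leLHS]big_mkcond; apply: ler_sum => u _.
  case: ifP => _; last by rewrite sumr_ge0.
  by rewrite [leLHS]big_mkcond; apply: ler_sum => w _; case: ifP.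
rewrite lerBlDr -big_split /=.
under [leRHS]eq_bigr do rewrite -big_split /=.
under [leRHS]eq_bigr do under eq_bigr do rewrite -big_split /=.
apply: (@le_trans _ _ (\sum_(v | J v) \sum_(u | J u) \sum_(w | J w && uniq [:: v; u; w])
    \sum_i [&& h i v, h i u & h i w]%:R)); last first.
  apply: ler_sum => v _; apply: ler_sum => u _; apply: ler_sum => w /andP[_].
  rewrite /= !inE negb_or !andbT => /andP[/andP[vu vw] uw].
  rewrite -lerBlDr.
  apply: (@le_trans _ _ [exists i, true && [&& h i v, h i u & h i w]]%:R).
    apply: le_trans (bonferroni _ _ _); rewrite lerB//.
    by apply: ler_sum => i _; apply: ler_sum => k _; rewrite -!andbA.
  case: existsP => [[i /= /and3P[hv hu hw]]|//].
  by rewrite !(rig_adj_ge (i := i)).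
rewrite [leRHS](_ : _ = \sum_i \sum_(v | J v) \sum_(u | J u)
    \sum_(w | J w && uniq [:: v; u; w]) [&& h i v, h i u & h i w]%:R); last first.
  under eq_bigr do under eq_bigr do rewrite exchange_big.
  by under eq_bigr do rewrite exchange_big; rewrite exchange_big.
apply: ler_sum => i _.
pose f v : R := (h i v)%:R.
have ff v : f v * f v = f v by rewrite /f; case: (h i v); rewrite ?mulr1 ?mulr0.
have sum1J v : J v -> \sum_(u | J u) (u == v)%:R * f u = f v.
  move=> Jv; rewrite (bigD1 v)//= eqxx mul1r big1 ?addr0// => u /andP[_ /negbTE ->].
  by rewrite mul0r.
(* The indicator that [v], [u], [w] are distinct is at least 1 minus the indicators of the three
   coincidences; summing this minorant gives the polynomial exactly. *)
have -> : D i ^+ 3 - 3 * D i ^+ 2 = \sum_(v | J v) f v * \sum_(u | J u) f u *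
    \sum_(w | J w) (1 - (u == v)%:R - (w == v)%:R - (w == u)%:R) * f w.
  have inner v u : J v -> J u ->
      \sum_(w | J w) (1 - (u == v)%:R - (w == v)%:R - (w == u)%:R) * f w =
      (1 - (u == v)%:R) * D i - f v - f u.
    move=> Jv Ju; rewrite -(sum1J v Jv) -(sum1J u Ju) mulr_sumr -!sumrB.
    by apply: eq_bigr => w _; rewrite !mulrBl.
  have mid v : J v -> \sum_(u | J u) f u * ((1 - (u == v)%:R) * D i - f v - f u) =
      D i ^+ 2 - 2 * (f v * D i) - D i.
    move=> Jv; transitivity (\sum_(u | J u) (f u * (D i - f v) - D i * ((u == v)%:R * f u) - f u)).
      by apply: eq_bigr => u _; rewrite !mulrBr ff; ring.
    rewrite !sumrB -mulr_suml -mulr_sumr (sum1J _ Jv) -/(D i); ring.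
  transitivity (\sum_(v | J v) f v * (D i ^+ 2 - 2 * (f v * D i) - D i)).
    transitivity (\sum_(v | J v) f v * (D i ^+ 2 - 3 * D i)).
      by rewrite -mulr_suml -/(D i); ring.
    by apply: eq_bigr => v _; rewrite !mulrBr [f v * (2 * _)]mulrCA [f v * (f v * _)]mulrA ff; ring.
  apply: eq_bigr => v Jv; congr (_ * _); rewrite -mid//.
  by apply: eq_bigr => u Ju; rewrite inner.
apply: ler_sum => v _; rewrite mulr_sumr; apply: ler_sum => u _.
rewrite !mulr_sumr [leRHS]big_mkcondr; apply: ler_sum => w _.
rewrite /f [u == v]eq_sym ![w == _]eq_sym /= !inE negb_or andbT.
case: (v == u); case: (v == w); case: (u == w);
  case: (h i v); case: (h i u); case: (h i w) => //=; lra.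
Qed.

(** Union bound over the attributes behind the two edges. The case of one attribute yields the main
    term A of the mean, the case of two yields B. *)
Lemma ordered_paths2_le :
  NP <= \sum_v \sum_u \sum_(w | uniq [:: v; u; w])
    (\sum_i [&& h i v, h i u & h i w]%:R +
     \sum_i \sum_(k | k != i) [&& h i v, h i u, h k v & h k w]%:R).
Proof.
apply: ler_sum => v _; apply: ler_sum => u _.
rewrite [leRHS]big_mkcond; apply: ler_sum => w _.
rewrite /= !inE negb_or !andbT.
have sum0 : 0 <= \sum_i \sum_(k | k != i) [&& h i v, h i u, h k v & h k w]%:R :> R.
  by rewrite sumr_ge0// => i _; rewrite sumr_ge0.
have sum0' : 0 <= \sum_i [&& h i v, h i u & h i w]%:R :> R by rewrite sumr_ge0.
case: (boolP [&& _, _ & _]) => [/and3P[uw vu vw]|_]; last by case: ifP => _ //; exact: addr_ge0.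
rewrite uw (rig_adj_neq vu) (rig_adj_neq vw) /=.
move: vu vw => /andP[_ /existsP[i /andP[iv iu]]] /andP[_ /existsP[k /andP[kv kw]]].
have [ki|ki] := eqVneq k i.
  rewrite ki in kw; apply: ler_wpDr => //; rewrite (bigD1 i)//= iv iu kw.
  by rewrite lerDl sumr_ge0.
apply: ler_wpDl => //; rewrite (bigD1 i)//= (bigD1 k)//= iv iu kv kw.
by rewrite -addrA lerDl addr_ge0 ?sumr_ge0// => *; rewrite sumr_ge0.
Qed.

(* Ways to close the 2-path u - v - w whose edges use attributes i, k of [I]: the
   four sums are the possible coincidences between i, k and an attribute l
   linking u to w (i = k, l = i, l = k, all distinct). *)
Definition closed_reps v u w : R :=
  \sum_(i | I i) [&& h i v, h i u & h i w]%:R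
  + \sum_(i | I i) \sum_(k | I k && (k != i)) [&& h i v, h k v, h i u, h i w & h k w]%:R
  + \sum_(i | I i) \sum_(k | I k && (k != i)) [&& h i v, h k v, h i u, h k u & h k w]%:R
  + \sum_(i | I i) \sum_(k | I k && (k != i)) \sum_(l | uniq [:: i; k; l])
      [&& h i v, h k v, h i u, h l u, h k w & h l w]%:R.

Let linked v u := [exists i, I i && (h i v && h i u)].

Lemma closed_reps_ge v u w :
  [&& linked v u, linked v w & adj u w]%:R <= closed_reps v u w.
Proof.
have s1 : 0 <= \sum_(i | I i) [&& h i v, h i u & h i w]%:R :> R by rewrite sumr_ge0.
have s2 : 0 <= \sum_(i | I i) \sum_(k | I k && (k != i))
    [&& h i v, h k v, h i u, h i w & h k w]%:R :> R.
  by rewrite sumr_ge0// => i _; rewrite sumr_ge0.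
have s3 : 0 <= \sum_(i | I i) \sum_(k | I k && (k != i))
    [&& h i v, h k v, h i u, h k u & h k w]%:R :> R.
  by rewrite sumr_ge0// => i _; rewrite sumr_ge0.
have s4 : 0 <= \sum_(i | I i) \sum_(k | I k && (k != i)) \sum_(l | uniq [:: i; k; l])
      [&& h i v, h k v, h i u, h l u, h k w & h l w]%:R :> R.
  by rewrite sumr_ge0// => i _; rewrite sumr_ge0// => k _; rewrite sumr_ge0.
rewrite /closed_reps.
case: (boolP [&& _, _ & _]) => [/and3P[]|_]; last by rewrite !addr_ge0.
move=> /existsP[i /and3P[Ii iv iu]] /existsP[k /and3P[Ik kv kw]] /andP[_ /existsP[l /andP[lu lw]]].
have [ki|ki] := eqVneq k i.
  rewrite ki in kw; rewrite -!addrA; apply: ler_wpDr; first by rewrite !addr_ge0.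
  by rewrite (bigD1 i)//= iv iu kw lerDl sumr_ge0.
have [li|li] := eqVneq l i.
  rewrite li in lw; rewrite -addrA; apply: ler_wpDr; first by rewrite !addr_ge0.
  apply: ler_wpDl => //; rewrite (bigD1 i)//= (bigD1 k) ?Ik//= iv iu kv kw lw.
  by rewrite -addrA lerDl addr_ge0 ?sumr_ge0// => *; rewrite sumr_ge0.
have [lk|lk] := eqVneq l k.
  rewrite lk in lu; apply: ler_wpDr; first by [].
  apply: ler_wpDl; first by rewrite addr_ge0.
  rewrite (bigD1 i)//= (bigD1 k) ?Ik//= iv iu kv kw lu.
  by rewrite -addrA lerDl addr_ge0 ?sumr_ge0// => *; rewrite sumr_ge0.
apply: ler_wpDl; first by rewrite !addr_ge0.
rewrite (bigD1 i)//= (bigD1 k) ?Ik//= (bigD1 l)/=; last first.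
  by rewrite !inE negb_or ![i == _]eq_sym ki li [k == _]eq_sym lk.
rewrite iv iu kv kw lu lw.
by rewrite -!addrA lerDl !addr_ge0 ?sumr_ge0// => *; rewrite sumr_ge0// => *; rewrite sumr_ge0.
Qed.

(** Fix [v]. Let S count the light neighbours reached through [I], A the same with multiplicity, and
    O the ordered pairs of attributes responsible for the excess, so that [A - O <= S <= A]. The
    ordered pairs of distinct such neighbours number [S ^ 2 - S], which is bounded below through
    [S ^ 2 >= 2 tau S - tau ^ 2] and [S <= A]; [closed_reps] removes the closed pairs. *)
Lemma open_paths2_ge (tau : 'I_n -> R) : (forall v, 0 <= tau v) ->
  2 * \sum_(v | ~~ J v) \sum_(u | J u) \sum_(i | I i) tau v * (h i v && h i u)%:R
  - \sum_(v | ~~ J v) tau v ^+ 2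
  - (2 * \sum_(v | ~~ J v) \sum_(u | J u) \sum_(i | I i) \sum_(k | I k && (k != i))
      tau v * [&& h i v, h i u, h k v & h k u]%:R
     + \sum_(v | ~~ J v) \sum_(u | J u) \sum_(i | I i) (h i v && h i u)%:R
     + \sum_(v | ~~ J v) \sum_(u | J u) \sum_(w | J w && (w != u)) closed_reps v u w)
  <= NP - NT.
Proof.
move=> tau0.
have NPT : NP - NT = \sum_v \sum_u \sum_w [&& u != w, adj v u, adj v w & ~~ adj u w]%:R.
  rewrite -sumrB; apply: eq_bigr => v _; rewrite -sumrB; apply: eq_bigr => u _.
  rewrite -sumrB; apply: eq_bigr => w _.
  case: (boolP (adj u w)) => [/rig_adj_neq ->|_];
    by rewrite ?andbT ?andbF /= ?subrr ?subr0.
rewrite NPT !mulr_sumr -!big_split /= -!sumrB.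
rewrite [leLHS]big_mkcond; apply: ler_sum => v _.
case: ifP => Jv; last by rewrite sumr_ge0// => u _; rewrite sumr_ge0.
pose b u : R := (linked v u)%:R.
have adjb u : J u -> linked v u -> adj v u.
  move=> Ju /existsP[i /and3P[_ hv hu]]; apply: rig_adj_ge hv hu.
  by apply: contraNneq Jv => ->.
apply: (@le_trans _ _ (\sum_(u | J u) \sum_(w | J w && (w != u)) (b u * b w - closed_reps v u w))); last first.
  rewrite [leLHS]big_mkcond; apply: ler_sum => u _.
  case: ifP => Ju; last by rewrite sumr_ge0.
  rewrite [leLHS]big_mkcond; apply: ler_sum => w _.
  case: ifP => // /andP[Jw wu]; rewrite lerBlDr.
  apply: (@le_trans _ _ ([&& u != w, adj v u, adj v w & ~~ adj u w]%:R +
     [&& linked v u, linked v w & adj u w]%:R)); last by rewrite lerD2l closed_reps_ge.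
  rewrite /b eq_sym wu.
  case: (boolP (linked v u)) => [/(adjb _ Ju) ->|_]; last by rewrite mul0r addr_ge0.
  case: (boolP (linked v w)) => [/(adjb _ Jw) ->|_]; last by rewrite mulr0 addr_ge0.
  by case: (adj u w); rewrite mulr1 ?addr0 ?add0r.
under [leRHS]eq_bigr do rewrite sumrB.
rewrite sumrB.
pose A : R := \sum_(u | J u) \sum_(i | I i) (h i v && h i u)%:R.
pose O : R := \sum_(u | J u) \sum_(i | I i) \sum_(k | I k && (k != i))
  [&& h i v, h i u, h k v & h k u]%:R.
pose S := \sum_(u | J u) b u.
have -> : \sum_(u | J u) \sum_(w | J w && (w != u)) b u * b w = S ^+ 2 - S.
  apply/eqP; rewrite eq_sym subr_eq /S expr2 big_distrlr -big_split /=; apply/eqP.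
  apply: eq_bigr => u Ju; rewrite (bigD1 u)//= addrC; congr (_ + _).
  by rewrite /b; case: linked; rewrite ?mulr1 ?mulr0.
have SA : S <= A.
  apply: ler_sum => u Ju; rewrite /b /linked; case: existsP => [[i /andP[Ii iuv]]|_].
    by rewrite (bigD1 i)//= iuv lerDl sumr_ge0.
  by rewrite sumr_ge0.
have SAO : A - O <= S.
  rewrite -sumrB; apply: ler_sum => u Ju.
  apply: le_trans (bonferroni _ _ _); rewrite lerB//.
  by apply: ler_sum => i _; apply: ler_sum => k _; rewrite -!andbA.
rewrite -/A.
have -> : \sum_(u | J u) \sum_(i | I i) tau v * (h i v && h i u)%:R = tau v * A.
  by rewrite mulr_sumr; apply: eq_bigr => u _; rewrite mulr_sumr.
have -> : \sum_(u | J u) \sum_(i | I i) \sum_(k | I k && (k != i))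
  tau v * [&& h i v, h i u, h k v & h k u]%:R = tau v * O.
  rewrite mulr_sumr; apply: eq_bigr => u _; rewrite mulr_sumr.
  by apply: eq_bigr => i _; rewrite mulr_sumr.
set CL := \sum_(u | J u) \sum_(w | _) closed_reps v u w.
have := ler_wpM2l (tau0 v) SAO; have := sqr_ge0 (S - tau v); lra.
Qed.

End CountingBounds.

(** * Moments of the counts, conditionally on the weights *)

Ltac nonneg := repeat first
  [ done | apply: addr_ge0 | apply: mulr_ge0 | apply: exprn_ge0
  | apply: sumr_ge0 => ? _ ].

Section Sums.
Variable R : realDomainType.

Lemma eq_ler (a b : R) : a = b -> a <= b.
Proof. by move->. Qed.

Lemma ler_sum_sub (I : finType) (P Q : pred I) (F G : I -> R) :
  (forall i, P i -> Q i -> F i <= G i) -> (forall i, P i -> 0 <= G i) ->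
  \sum_(i | P i && Q i) F i <= \sum_(i | P i) G i.
Proof.
move=> FG G0; rewrite big_mkcondr; apply: ler_sum => i Pi.
by case: ifP => Qi; [exact: FG|exact: G0].
Qed.

Lemma sum_prod2 (I J : finType) (P : pred I) (Q : pred J) (f : I -> R) (g : J -> R) :
  \sum_(i | P i) \sum_(j | Q j) f i * g j = (\sum_(i | P i) f i) * (\sum_(j | Q j) g j).
Proof. by rewrite big_distrlr. Qed.

Lemma sum_prod3 (I J K : finType) (P : pred I) (Q : pred J) (S : pred K)
    (f : I -> R) (g : J -> R) (k : K -> R) :
  \sum_(i | P i) \sum_(j | Q j) \sum_(l | S l) f i * g j * k l =
  (\sum_(i | P i) f i) * (\sum_(j | Q j) g j) * (\sum_(l | S l) k l).
Proof.
rewrite -sum_prod2 mulr_suml; apply: eq_bigr => i _; rewrite mulr_suml.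
by apply: eq_bigr => j _; rewrite mulr_sumr.
Qed.

End Sums.

Section Expectations.
Variables (R : realType) (m n : nat) (x : 'I_m -> R) (y : 'I_n -> R) (q : R).
Hypotheses (x0 : forall i, 0 <= x i) (y0 : forall j, 0 <= y j) (q0 : 0 <= q).

Definition link_prob (e : 'I_m * 'I_n) : R := Num.min 1 (x e.1 * y e.2 * q).
Local Notation p := link_prob.
Local Notation E := (bern_exp link_prob).
Local Notation cfg := {ffun 'I_m * 'I_n -> bool}.
Local Notation h b := (fun i j => b (i, j)).

Lemma link_prob01 e : 0 <= p e <= 1.
Proof. by rewrite ge_min lexx le_min ler01 !mulr_ge0. Qed.

Lemma link_prob_ge0 e : 0 <= p e.
Proof. by case/andP: (link_prob01 e). Qed.

Lemma link_prob_le e : p e <= x e.1 * y e.2 * q.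
Proof. by rewrite ge_min lexx orbT. Qed.

(** Source of the first moment bounds below: distinct links are independent, and dropping the
    truncation at 1 only increases a link probability, whatever the weights. *)
Lemma exp_bits_le (f : cfg -> bool) (s : seq ('I_m * 'I_n)) :
  uniq s -> (forall b, f b = all b s) ->
  E (fun b => (f b)%:R) <= \prod_(e <- s) (x e.1 * y e.2 * q).
Proof.
move=> us fs; rewrite (eq_bern_exp _ (G := all_bits R s)); last first.
  by move=> b; rewrite all_bitsE fs.
rewrite bern_exp_all_bits_uniq//; apply: ler_prod => e _.
by rewrite link_prob_ge0 link_prob_le.
Qed.

Lemma exp_paths2_le :
  E (fun b => ordered_paths2 R (h b)) <=
  (\sum_i x i ^+ 3) * ((\sum_j y j) * q) ^+ 3 +
  (\sum_j y j ^+ 2) * ((\sum_i x i ^+ 2) * (\sum_j y j) * q ^+ 2) ^+ 2.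
Proof.
apply: le_trans (ler_bern_exp link_prob01 (fun b => ordered_paths2_le R (h b))) _.
set sy := \sum_j y j; set sx2 := \sum_i x i ^+ 2.
rewrite bern_exp_sum.
apply: (@le_trans _ _ (\sum_v \sum_u \sum_w
   (y v * y u * (y w * ((\sum_i x i ^+ 3) * q ^+ 3)) +
    y v ^+ 2 * y u * (y w * (sx2 ^+ 2 * q ^+ 4))))); last first.
  under eq_bigr do under eq_bigr do rewrite big_split /=.
  under eq_bigr do rewrite big_split /=.
  rewrite big_split /= !sum_prod3 -!mulr_suml -/sy.
  by apply: eq_ler; ring.
apply: ler_sum => v _; rewrite bern_exp_sum; apply: ler_sum => u _.
rewrite bern_exp_sum.
have X30 : 0 <= \sum_i x i ^+ 3 by rewrite sumr_ge0// => i _; rewrite exprn_ge0.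
apply: (@ler_sum_sub _ _ xpredT) => w _ /=; last first.
  by nonneg.
rewrite !inE negb_or !andbT => /andP[/andP[vu vw] uw].
rewrite bern_expD !bern_exp_sum; apply: lerD.
  rewrite mulr_suml !mulr_sumr; apply: ler_sum => i _.
  apply: le_trans (exp_bits_le (s := [:: (i, v); (i, u); (i, w)]) _ _) _.
  - by rewrite /= !inE !xpair_eqE !eqxx /= negb_or vu vw uw.
  - by move=> b /=; rewrite andbT.
  - by rewrite !big_cons big_nil /=; apply: eq_ler; ring.
have -> : y v ^+ 2 * y u * (y w * (sx2 ^+ 2 * q ^+ 4)) =
    \sum_i \sum_k (x i ^+ 2 * (y v ^+ 2 * y u * y w * q ^+ 4)) * x k ^+ 2.
  by rewrite sum_prod2 -mulr_suml -/sx2; ring.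
apply: ler_sum => i _; rewrite bern_exp_sum.
apply: (@ler_sum_sub _ _ xpredT) => k _; last first.
  by nonneg.
move=> ki; apply: le_trans (exp_bits_le (s := [:: (i, v); (i, u); (k, v); (k, w)]) _ _) _.
- by rewrite /= !inE !xpair_eqE !eqxx /= ![i == k]eq_sym (negbTE ki) /= (negbTE vu) (negbTE vw).
- by move=> b /=; rewrite andbT.
- by rewrite !big_cons big_nil /=; apply: eq_ler; ring.
Qed.

Variable M : R.
Let I : pred 'I_m := [pred i | x i <= M].
Let J : pred 'I_n := [pred j | y j <= M].
Local Notation SY := (\sum_j y j ^+ 2).
Local Notation sx2 := (\sum_i x i ^+ 2).
Local Notation sy := (\sum_j y j).
Local Notation Y2 := (\sum_(j | J j) y j ^+ 2).
Local Notation X3 := (\sum_(i | I i) x i ^+ 3).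

(** Every exponent is the degree of that attribute or vertex in the pattern of links. An attribute
    with three links always lies in [I], so third powers occur only in the truncated sum [X3]. *)
Lemma exp_closed_reps_le v u w : v != u -> v != w -> w != u ->
  E (fun b => closed_reps R (h b) I v u w) <=
  y v * y u * (y w * (X3 * q ^+ 3)) + y v ^+ 2 * y u * (y w ^+ 2 * (X3 * sx2 * q ^+ 5))
  + y v ^+ 2 * y u ^+ 2 * (y w * (X3 * sx2 * q ^+ 5))
  + y v ^+ 2 * y u ^+ 2 * (y w ^+ 2 * (sx2 ^+ 3 * q ^+ 6)).
Proof.
move=> vu vw wu; have uw : u != w by rewrite eq_sym.
have [vu' [vw' uw']] : (v == u) = false /\ (v == w) = false /\ (u == w) = false.
  by rewrite !(negbTE vu, negbTE vw, negbTE uw).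
have IT (F : 'I_m -> R) : (forall i, 0 <= F i) -> \sum_(i | I i) F i <= \sum_i F i.
  by move=> F0; rewrite big_mkcond; apply: ler_sum => i _; case: ifP.
rewrite /closed_reps !bern_expD !bern_exp_sum.
apply: lerD; [apply: lerD; [apply: lerD|]|].
- rewrite mulr_suml !mulr_sumr; apply: ler_sum => i _.
  apply: le_trans (exp_bits_le (s := [:: (i, v); (i, u); (i, w)]) _ _) _.
  + by rewrite /= !inE !xpair_eqE !eqxx /= negb_or vu vw uw.
  + by move=> b /=; rewrite andbT.
  + by rewrite !big_cons big_nil /=; apply: eq_ler; ring.
- have -> : y v ^+ 2 * y u * (y w ^+ 2 * (X3 * sx2 * q ^+ 5)) =
    \sum_(i | I i) \sum_k (x i ^+ 3 * (y v ^+ 2 * y u * y w ^+ 2 * q ^+ 5)) * x k ^+ 2.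
    by rewrite sum_prod2 -mulr_suml; ring.
  apply: ler_sum => i _; rewrite bern_exp_sum; under eq_bigl do rewrite -[_ && _]andTb.
  apply: (@ler_sum_sub _ _ xpredT) => k _; last by nonneg.
  move=> /andP[_ ki].
  apply: le_trans (exp_bits_le (s := [:: (i, v); (k, v); (i, u); (i, w); (k, w)]) _ _) _.
  + by rewrite /= !inE !xpair_eqE !eqxx /= ![i == k]eq_sym (negbTE ki) /= vu' vw' uw'.
  + by move=> b /=; rewrite andbT.
  + by rewrite !big_cons big_nil /=; apply: eq_ler; ring.
- have -> : y v ^+ 2 * y u ^+ 2 * (y w * (X3 * sx2 * q ^+ 5)) =
    \sum_i \sum_(k | I k) (x i ^+ 2 * (y v ^+ 2 * y u ^+ 2 * y w * q ^+ 5)) * x k ^+ 3.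
    by rewrite sum_prod2 -mulr_suml; ring.
  apply: le_trans (IT _ _); last first.
    by move=> i; rewrite sumr_ge0// => k _; rewrite !mulr_ge0 ?exprn_ge0.
  apply: ler_sum => i _; rewrite bern_exp_sum.
  apply: ler_sum_sub => k _; last by nonneg.
  move=> ki.
  apply: le_trans (exp_bits_le (s := [:: (i, v); (k, v); (i, u); (k, u); (k, w)]) _ _) _.
  + by rewrite /= !inE !xpair_eqE !eqxx /= ![i == k]eq_sym (negbTE ki) /= ?andbF vu' vw' uw'.
  + by move=> b /=; rewrite andbT.
  + by rewrite !big_cons big_nil /=; apply: eq_ler; ring.
- have -> : y v ^+ 2 * y u ^+ 2 * (y w ^+ 2 * (sx2 ^+ 3 * q ^+ 6)) =
    \sum_i \sum_k \sum_l
    (x i ^+ 2 * (y v ^+ 2 * y u ^+ 2 * y w ^+ 2 * q ^+ 6)) * x k ^+ 2 * x l ^+ 2.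
    by rewrite sum_prod3 -mulr_suml; ring.
  apply: le_trans (IT _ _); last first.
    move=> i; rewrite sumr_ge0// => k _; rewrite sumr_ge0// => l _.
    by nonneg.
  apply: ler_sum => i _; rewrite bern_exp_sum; under eq_bigl do rewrite -[_ && _]andTb.
  apply: (@ler_sum_sub _ _ xpredT) => k _; last first.
    by nonneg.
  move=> /andP[_ ki]; rewrite bern_exp_sum.
  apply: (@ler_sum_sub _ _ xpredT) => l _; last by nonneg.
  rewrite /= !inE negb_or !andbT => /andP[/andP[_ il] kl].
  apply: le_trans (exp_bits_le (s := [:: (i, v); (k, v); (i, u); (l, u); (k, w); (l, w)]) _ _) _.
  + by rewrite /= !inE !xpair_eqE !eqxx /= ![i == k]eq_sym (negbTE ki) (negbTE il) (negbTE kl) /=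
      ?andbF ?vu' ?vw' ?uw' /= ?andbF.
  + by move=> b /=; rewrite andbT.
  + by rewrite !big_cons big_nil /=; apply: eq_ler; ring.
Qed.

Lemma exp_double_triples_le :
  E (fun b => \sum_(v | J v) \sum_(u | J u) \sum_(w | J w && uniq [:: v; u; w])
      \sum_i \sum_(k | k != i)
        [&& b (i, v), b (i, u), b (i, w), b (k, v), b (k, u) & b (k, w)]%:R) <=
  (\sum_i x i ^+ 3) ^+ 2 * (Y2 * q ^+ 2) ^+ 3.
Proof.
have -> : (\sum_i x i ^+ 3) ^+ 2 * (Y2 * q ^+ 2) ^+ 3 =
    \sum_(v | J v) \sum_(u | J u) \sum_(w | J w) y v ^+ 2 * y u ^+ 2 *
     (y w ^+ 2 * ((\sum_i x i ^+ 3) ^+ 2 * q ^+ 6)).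
  by rewrite sum_prod3 -mulr_suml; ring.
rewrite bern_exp_sum; apply: ler_sum => v _; rewrite bern_exp_sum.
apply: ler_sum => u _; rewrite bern_exp_sum.
apply: ler_sum_sub => w _; last by nonneg.
rewrite /= !inE negb_or !andbT => /andP[/andP[vu vw] uw].
have -> : y v ^+ 2 * y u ^+ 2 * (y w ^+ 2 * ((\sum_i x i ^+ 3) ^+ 2 * q ^+ 6)) =
    \sum_i \sum_k (x i ^+ 3 * (y v ^+ 2 * y u ^+ 2 * y w ^+ 2 * q ^+ 6)) * x k ^+ 3.
  by rewrite sum_prod2 -mulr_suml; ring.
rewrite bern_exp_sum; apply: ler_sum => i _; rewrite bern_exp_sum.
apply: (@ler_sum_sub _ _ xpredT) => k _; last by nonneg.
move=> ki.
apply: le_trans (exp_bits_le (s := [:: (i, v); (i, u); (i, w); (k, v); (k, u); (k, w)]) _ _) _.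
- by rewrite /= !inE !xpair_eqE !eqxx /= ![i == k]eq_sym (negbTE ki)
    (negbTE vu) (negbTE vw) (negbTE uw).
- by move=> b /=; rewrite andbT.
- by rewrite !big_cons big_nil /=; apply: eq_ler; ring.
Qed.

Lemma exp_double_pairs_le (tau : 'I_n -> R) : (forall v, 0 <= tau v) ->
  E (fun b => \sum_(v | ~~ J v) \sum_(u | J u) \sum_(i | I i) \sum_(k | I k && (k != i))
      tau v * [&& b (i, v), b (i, u), b (k, v) & b (k, u)]%:R) <=
  (\sum_v tau v * y v ^+ 2) * Y2 * (sx2 * q ^+ 2) ^+ 2.
Proof.
move=> tau0.
have -> : (\sum_v tau v * y v ^+ 2) * Y2 * (sx2 * q ^+ 2) ^+ 2 =
    \sum_v \sum_(u | J u) (tau v * y v ^+ 2) * (y u ^+ 2 * (sx2 * q ^+ 2) ^+ 2).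
  by rewrite sum_prod2 -mulr_suml; ring.
rewrite bern_exp_sum; under eq_bigl do rewrite -[~~ _]andTb.
apply: (@ler_sum_sub _ _ xpredT) => v _; last first.
  by nonneg.
move=> Jv; rewrite bern_exp_sum; apply: ler_sum => u Ju.
have vu : v != u by apply: contraNneq Jv => ->.
have -> : tau v * y v ^+ 2 * (y u ^+ 2 * (sx2 * q ^+ 2) ^+ 2) =
    \sum_i \sum_k (x i ^+ 2 * (tau v * y v ^+ 2 * y u ^+ 2 * q ^+ 4)) * x k ^+ 2.
  by rewrite sum_prod2 -mulr_suml; ring.
rewrite bern_exp_sum; under eq_bigl do rewrite -[I _]andTb.
apply: (@ler_sum_sub _ _ xpredT) => i _ => [Ii|]; last first.
  by nonneg.
rewrite bern_exp_sum; under eq_bigl do rewrite -[_ && _]andTb.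
apply: (@ler_sum_sub _ _ xpredT) => k _; last by nonneg.
move=> /andP[_ ki]; rewrite bern_expZ.
rewrite [leRHS](_ : _ = tau v * (x i ^+ 2 * (y v ^+ 2 * y u ^+ 2 * q ^+ 4) * x k ^+ 2)); last by ring.
rewrite ler_wpM2l//.
apply: le_trans (exp_bits_le (s := [:: (i, v); (i, u); (k, v); (k, u)]) _ _) _.
- by rewrite /= !inE !xpair_eqE !eqxx /= ![i == k]eq_sym (negbTE ki) (negbTE vu).
- by move=> b /=; rewrite andbT.
- by rewrite !big_cons big_nil /=; apply: eq_ler; ring.
Qed.

Lemma exp_pairs_le :
  E (fun b => \sum_(v | ~~ J v) \sum_(u | J u) \sum_(i | I i) (b (i, v) && b (i, u))%:R) <=
  sy ^+ 2 * sx2 * q ^+ 2.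
Proof.
have -> : sy ^+ 2 * sx2 * q ^+ 2 = \sum_v \sum_u \sum_i y v * y u * (x i ^+ 2 * q ^+ 2).
  by rewrite sum_prod3 -mulr_suml; ring.
rewrite bern_exp_sum; under eq_bigl do rewrite -[~~ _]andTb.
apply: (@ler_sum_sub _ _ xpredT) => v _; last first.
  by nonneg.
move=> Jv; rewrite bern_exp_sum; under eq_bigl do rewrite -[J _]andTb.
apply: (@ler_sum_sub _ _ xpredT) => u _; last first.
  by nonneg.
move=> Ju; have vu : v != u by apply: contraNneq Jv => ->.
rewrite bern_exp_sum; under eq_bigl do rewrite -[I _]andTb.
apply: (@ler_sum_sub _ _ xpredT) => i _ => [Ii|]; last by nonneg.
apply: le_trans (exp_bits_le (s := [:: (i, v); (i, u)]) _ _) _.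
- by rewrite /= !inE !xpair_eqE !eqxx /= (negbTE vu).
- by move=> b /=; rewrite andbT.
- by rewrite !big_cons big_nil /=; apply: eq_ler; ring.
Qed.

Lemma exp_closed_le :
  E (fun b => \sum_(v | ~~ J v) \sum_(u | J u) \sum_(w | J w && (w != u))
       closed_reps R (h b) I v u w) <=
  sy ^+ 3 * X3 * q ^+ 3 + 2 * (SY * sy * Y2 * X3 * sx2 * q ^+ 5)
  + SY * Y2 ^+ 2 * sx2 ^+ 3 * q ^+ 6.
Proof.
have X30 : 0 <= X3 by rewrite sumr_ge0// => i _; rewrite exprn_ge0.
have sx20 : 0 <= sx2 by rewrite sumr_ge0// => i _; rewrite exprn_ge0.
have SY0 : 0 <= SY by rewrite sumr_ge0// => i _; rewrite exprn_ge0.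
have Y20 : 0 <= Y2 by rewrite sumr_ge0// => i _; rewrite exprn_ge0.
have sy0 : 0 <= sy by rewrite sumr_ge0.
pose syJ := \sum_(j | J j) y j.
have syJ0 : 0 <= syJ by rewrite sumr_ge0.
have syJsy : syJ <= sy by rewrite /syJ big_mkcond; apply: ler_sum => j _; case: ifP.
apply: (@le_trans _ _ (\sum_v \sum_(u | J u) \sum_(w | J w)
  (y v * y u * (y w * (X3 * q ^+ 3)) + y v ^+ 2 * y u * (y w ^+ 2 * (X3 * sx2 * q ^+ 5))
  + y v ^+ 2 * y u ^+ 2 * (y w * (X3 * sx2 * q ^+ 5))
  + y v ^+ 2 * y u ^+ 2 * (y w ^+ 2 * (sx2 ^+ 3 * q ^+ 6))))).
  have term0 v u w : 0 <= y v * y u * (y w * (X3 * q ^+ 3)) + y v ^+ 2 * y u * (y w ^+ 2 * (X3 * sx2 * q ^+ 5))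
  + y v ^+ 2 * y u ^+ 2 * (y w * (X3 * sx2 * q ^+ 5))
  + y v ^+ 2 * y u ^+ 2 * (y w ^+ 2 * (sx2 ^+ 3 * q ^+ 6)).
    by nonneg.
  rewrite bern_exp_sum; under eq_bigl do rewrite -[~~ _]andTb.
  apply: (@ler_sum_sub _ _ xpredT) => v _; last first.
    by rewrite sumr_ge0// => u _; rewrite sumr_ge0.
  move=> Jv; rewrite bern_exp_sum; apply: ler_sum => u Ju.
  rewrite bern_exp_sum; apply: ler_sum_sub => w Jw // wu.
  by apply: exp_closed_reps_le => //; apply: contraNneq Jv => ->.
under eq_bigr do under eq_bigr do rewrite !big_split /=.
under eq_bigr do rewrite !big_split /=.
rewrite !big_split /= !sum_prod3 -!mulr_suml -/syJ.
rewrite (_ : 2 * _ = SY * sy * (Y2 * (X3 * sx2 * q ^+ 5)) + SY * sy * (Y2 * (X3 * sx2 * q ^+ 5))); last by ring.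
rewrite !addrA; apply: lerD; [apply: lerD; [apply: lerD|]|].
- rewrite [leRHS](_ : _ = sy * (sy * sy) * (X3 * q ^+ 3)); last by ring.
  rewrite [leLHS](_ : _ = sy * (syJ * syJ) * (X3 * q ^+ 3)); last by ring.
  apply: ler_wpM2r; [by nonneg|apply: ler_wpM2l => //].
  by apply: ler_pM.
- by apply: ler_wpM2r; [nonneg|apply: ler_wpM2l].
- rewrite [leRHS](_ : _ = SY * Y2 * (sy * (X3 * sx2 * q ^+ 5))); last by ring.
  by apply: ler_wpM2l; [nonneg|apply: ler_wpM2r; [nonneg|]].
- by apply: eq_ler; ring.
Qed.

Lemma exp_attr_deg_sqr_le i :
  E (fun b => attr_deg R (h b) J i ^+ 2) <=
  \sum_(v | J v) p (i, v) + (\sum_(v | J v) p (i, v)) ^+ 2.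
Proof.
have inj : injective (fun v : 'I_n => (i, v)) by move=> u v [].
have := bern_exp_sqr_lin link_prob01 J (fun=> 1) inj.
rewrite expr1n; under [X in X + _]eq_bigr do rewrite mul1r.
under [X in _ + X ^+ 2]eq_bigr do rewrite mul1r.
apply: le_trans; apply: eq_ler; apply: eq_bern_exp => b; congr (_ ^+ 2).
by apply: eq_bigr => v _; rewrite mul1r.
Qed.

(** The linear part of [open_paths2_ge] with the attribute outermost. Terms for different [i] use
    disjoint links, and so do the two factors of one term, since [v] and [u] lie on opposite sides
    of [J]; this makes the second moment computable. *)
Definition star_sum (tau : 'I_n -> R) (b : cfg) : R :=
  \sum_(i | I i) (\sum_(v | ~~ J v) tau v * (b (i, v))%:R) * attr_deg R (h b) J i.

Definition star_mean (tau : 'I_n -> R) : R :=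
  \sum_(i | I i) (\sum_(v | ~~ J v) tau v * p (i, v)) * (\sum_(u | J u) p (i, u)).

Lemma star_sum_moments (tau : 'I_n -> R) : (forall v, 0 <= tau v) ->
  E (star_sum tau) = star_mean tau /\
  E (fun b => (star_sum tau b - star_mean tau) ^+ 2) <=
  \sum_(i | I i)
    (\sum_(v | ~~ J v) tau v ^+ 2 * p (i, v) + (\sum_(v | ~~ J v) tau v * p (i, v)) ^+ 2)
    * (\sum_(u | J u) p (i, u) + (\sum_(u | J u) p (i, u)) ^+ 2).
Proof.
move=> tau0; set Q := star_sum tau; set EQ := star_mean tau.
pose U i (b : cfg) : R := \sum_(v | ~~ J v) tau v * (b (i, v))%:R.
pose D i (b : cfg) : R := attr_deg R (h b) J i.
have injr i : injective (fun v : 'I_n => (i, v)) by move=> u v [].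
have UE i b : U i b = \sum_(v | ~~ J v) tau v * all_bits R [:: (i, v)] b.
  by apply: eq_bigr => v _; rewrite all_bitsE /= andbT.
have DE i b : D i b = \sum_(v | J v) 1 * all_bits R [:: (i, v)] b.
  by apply: eq_bigr => v _; rewrite all_bitsE /= andbT mul1r.
have U2E i b : U i b ^+ 2 = \sum_(a | ~~ J a.1 && ~~ J a.2)
    (tau a.1 * tau a.2) * all_bits R [:: (i, a.1); (i, a.2)] b.
  rewrite -(pair_big (fun v => ~~ J v) (fun v => ~~ J v) (fun v w =>
    (tau v * tau w) * all_bits R [:: (i, v); (i, w)] b)) /=.
  rewrite expr2 big_distrlr; apply: eq_bigr => v _; apply: eq_bigr => w _.
  by rewrite /all_bits !big_cons big_nil mulr1 mulrACA.
have D2E i b : D i b ^+ 2 = \sum_(a | J a.1 && J a.2)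
    1 * all_bits R [:: (i, a.1); (i, a.2)] b.
  rewrite -(pair_big J J (fun v w => 1 * all_bits R [:: (i, v); (i, w)] b)) /=.
  rewrite expr2 big_distrlr; apply: eq_bigr => v _; apply: eq_bigr => w _.
  by rewrite /all_bits !big_cons big_nil mulr1 mul1r.
have UDE i b : U i b * D i b = \sum_(a | ~~ J a.1 && J a.2)
    tau a.1 * all_bits R [:: (i, a.1); (i, a.2)] b.
  rewrite -(pair_big (fun v => ~~ J v) J (fun v w =>
    tau v * all_bits R [:: (i, v); (i, w)] b)) /=.
  rewrite big_distrlr; apply: eq_bigr => v _; apply: eq_bigr => w _.
  by rewrite /all_bits !big_cons big_nil mulr1 mulrA.
have EUD i : E (fun b => U i b * D i b) = E (U i) * E (D i).
  rewrite (eq_bern_exp _ (fun b => congr2 *%R (UE i b) (DE i b))).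
  rewrite bern_exp_mul_disjoint; first by congr (_ * _); apply: eq_bern_exp => b; rewrite ?UE ?DE.
  move=> v u Jv Ju; rewrite /= !inE orbF xpair_eqE eqxx /=.
  by apply: contraNneq Jv => <-.
have EU2D2 i : E (fun b => (U i b * D i b) ^+ 2) = E (fun b => U i b ^+ 2) * E (fun b => D i b ^+ 2).
  under eq_bern_exp do rewrite exprMn.
  rewrite (eq_bern_exp _ (fun b => congr2 *%R (U2E i b) (D2E i b))).
  rewrite bern_exp_mul_disjoint; first by congr (_ * _); apply: eq_bern_exp => b; rewrite ?U2E ?D2E.
  move=> [v v'] [u u'] /andP[/= Jv Jv'] /andP[/= Ju Ju'].
  rewrite /= !inE orbF !xpair_eqE !eqxx /= !negb_or.
  by do 2 (apply/andP; split) => //; first [apply: contraNneq Jv => <- | apply: contraNneq Jv' => <-].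
have EU i : E (U i) = \sum_(v | ~~ J v) tau v * p (i, v) by rewrite (bern_exp_lin p).
have ED i : E (D i) = \sum_(u | J u) p (i, u).
  by rewrite bern_exp_sum; apply: eq_bigr => u _; rewrite bern_exp_bit.
have EQE : E Q = EQ.
  by rewrite bern_exp_sum; apply: eq_bigr => i _; rewrite EUD EU ED.
split=> //; rewrite -EQE.
have indep i k : I i -> I k -> i != k ->
    E (fun b => (U i b * D i b) * (U k b * D k b)) =
    E (fun b => U i b * D i b) * E (fun b => U k b * D k b).
  move=> _ _ ik.
  rewrite (eq_bern_exp _ (fun b => congr2 *%R (UDE i b) (UDE k b))).
  rewrite bern_exp_mul_disjoint; first by congr (_ * _); apply: eq_bern_exp => b; rewrite ?UDE.
  move=> v u _ _; rewrite /= !inE orbF !xpair_eqE.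
  by rewrite ![k == i]eq_sym (negbTE ik).
apply: le_trans (bern_var_sum (P := I) (F := fun i b => U i b * D i b) indep) _.
apply: ler_sum => i _; rewrite EU2D2; apply: ler_pM.
- by apply: bern_exp_ge0 => [|b]; [exact: link_prob01|exact: sqr_ge0].
- by apply: bern_exp_ge0 => [|b]; [exact: link_prob01|exact: sqr_ge0].
- exact: (bern_exp_sqr_lin link_prob01 (fun v => ~~ J v) tau (@injr _ i)).
- exact: exp_attr_deg_sqr_le.
Qed.

End Expectations.

(** * Lower tails, conditionally on the weights *)

Ltac mono := repeat first
  [ exact: lexx | assumption
  | apply: lerXn2r; [by rewrite nnegrE; nonneg | by rewrite nnegrE; nonneg | ]
  | apply: ler_pM; [by nonneg | by nonneg | | ] ].

(* [q] stands for 1 / sqrt (m n), [C] bounds all the normalized sums and [zeta] is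
   the small parameter that every error term ends up proportional to. *)
Section LowerTails.
Variables (R : realType) (m n : nat) (x : 'I_m -> R) (y : 'I_n -> R).
Variables (q C zeta M : R).
Local Notation cfg := {ffun 'I_m * 'I_n -> bool}.
Local Notation h b := (fun i j => b (i, j)).
Local Notation p := (link_prob x y q).
Local Notation E := (bern_exp p).
Local Notation I := [pred i | x i <= M].
Local Notation J := [pred j | y j <= M].
Local Notation SX := (\sum_i x i ^+ 3).
Local Notation SY := (\sum_j y j ^+ 2).
Local Notation sx2 := (\sum_i x i ^+ 2).
Local Notation sy := (\sum_j y j).
Local Notation Y2 := (\sum_(j | J j) y j ^+ 2).
Local Notation X3 := (\sum_(i | I i) x i ^+ 3).
Local Notation theta := ((\sum_(j | J j) y j) * q).
Local Notation c := ((\sum_(i | I i) x i ^+ 2) * (\sum_(j | J j) y j) * q ^+ 2).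

Hypotheses (x0 : forall i, 0 <= x i) (y0 : forall j, 0 <= y j) (q_gt0 : 0 < q).
Hypotheses (C1 : 1 <= C) (Cz : C ^+ 3 * zeta <= 1) (qz : q <= zeta).
Hypotheses (MC : M <= C) (mq : m%:R * q <= C).
Hypotheses (sxq : sx2 * q <= C) (syq : sy * q <= C) (yz : forall v, y v * q <= zeta).
Hypotheses (SXz : 1 <= zeta * (q * SX)) (SYz : 1 <= zeta * (q * SY)).

Let q0 : 0 <= q. Proof. exact: ltW. Qed.
Let C0 : 0 <= C. Proof. exact: le_trans C1. Qed.
Let z0 : 0 <= zeta. Proof. exact: le_trans qz. Qed.
Let CX k l : (k <= l)%N -> C ^+ k <= C ^+ l.
Proof. by move=> kl; rewrite ler_weXn2l. Qed.
Let C3 : 1 <= C ^+ 3. Proof. by rewrite -(expr0 C) CX. Qed.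
Let z1 : zeta <= 1.
Proof. by apply: le_trans Cz; rewrite ler_peMl. Qed.
Let SX0 : 0 <= SX. Proof. by nonneg. Qed.
Let SY0 : 0 <= SY. Proof. by nonneg. Qed.
Let sx20 : 0 <= sx2. Proof. by nonneg. Qed.
Let sy0 : 0 <= sy. Proof. by nonneg. Qed.
Let Y20 : 0 <= Y2. Proof. by nonneg. Qed.
Let X30 : 0 <= X3. Proof. by nonneg. Qed.

(** How the divergence of SX / n and SY / n enters: [q] is of order 1 / n, so the hypothesis on [S]
    turns any quantity of order n into a small multiple of [S]. *)
Let absorb (S A B : R) : 0 <= A -> 1 <= zeta * (q * S) -> A * q <= B -> A <= B * zeta * S.
Proof.
move=> A0 zS AB; apply: (@le_trans _ _ (A * (zeta * (q * S)))).
  by rewrite -[leLHS]mulr1 ler_wpM2l.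
have S0 : 0 <= S.
  rewrite -(pmulr_rge0 _ q_gt0) -(@pmulr_rge0 _ zeta) ?(lt_le_trans q_gt0)//.
  exact: le_trans zS.
rewrite [leLHS](_ : _ = A * q * zeta * S); last by ring.
by mono.
Qed.

Let sub_sum (T : finType) (P : pred T) (f : T -> R) : (forall i, 0 <= f i) ->
  \sum_(i | P i) f i <= \sum_i f i.
Proof. by move=> f0; rewrite big_mkcond; apply: ler_sum => i _; case: ifP. Qed.

Let Y2q : Y2 * q <= C ^+ 2.
Proof.
apply: (@le_trans _ _ (C * (sy * q))); last by rewrite expr2 ler_wpM2l.
rewrite mulrA ler_wpM2r// mulr_sumr; apply: le_trans (sub_sum J _); last first.
  by move=> j; rewrite mulr_ge0.
apply: ler_sum => j yM; rewrite expr2 ler_wpM2r//; exact: le_trans yM MC.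
Qed.

Let X3q : X3 * q <= C ^+ 2.
Proof.
apply: (@le_trans _ _ (C * (sx2 * q))); last by rewrite expr2 ler_wpM2l.
rewrite mulrA ler_wpM2r// mulr_sumr; apply: le_trans (sub_sum I _); last first.
  by move=> j; rewrite mulr_ge0// exprn_ge0.
apply: ler_sum => j xM; rewrite exprS ler_wpM2r ?exprn_ge0//; exact: le_trans xM MC.
Qed.

(** Third powers of heavy vertex weights occur in the bounds for open 2-paths; they are harmless
    because the largest weight is small compared with [1 / q]. *)
Let y3q : (\sum_v y v ^+ 3) * q <= zeta * SY.
Proof.
rewrite mulr_suml mulr_sumr; apply: ler_sum => v _.
rewrite [leLHS](_ : _ = y v * q * y v ^+ 2); last by ring.
by mono; exact: yz.
Qed.

Let theta0 : 0 <= theta. Proof. by nonneg. Qed.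
Let thetaC : theta <= C.
Proof. by apply: le_trans syq; rewrite ler_wpM2r// sub_sum. Qed.
Let c0 : 0 <= c. Proof. by nonneg. Qed.
Let cC : c <= C ^+ 2.
Proof.
rewrite [leLHS](_ : _ = ((\sum_(i | I i) x i ^+ 2) * q) * theta); last by ring.
rewrite expr2; mono; apply: le_trans sxq; rewrite ler_wpM2r// sub_sum// => i.
exact: exprn_ge0.
Qed.

Let x2q i : x i ^+ 2 * q <= C.
Proof.
apply: le_trans sxq; rewrite ler_wpM2r// (bigD1 i)//= lerDl.
by apply: sumr_ge0 => k _; rewrite exprn_ge0.
Qed.

(** A light vertex meets no truncation even at a heavy attribute: [x i ^ 2 q <= C] gives [(x i * y v
    * q) ^ 2 <= C * C ^ 2 * q <= C ^ 3 zeta <= 1]. *)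
Let pJ i v : J v -> p (i, v) = x i * y v * q.
Proof.
move=> yM; apply/min_idPr => /=.
rewrite -(@ler_pXn2r _ 2)// ?nnegrE ?mulr_ge0//.
rewrite expr1n; apply: le_trans Cz.
rewrite [leLHS](_ : _ = x i ^+ 2 * q * y v ^+ 2 * q); last by ring.
rewrite [C ^+ 3](_ : _ = C * C ^+ 2); last by ring.
by mono; [exact: x2q|exact: le_trans yM MC].
Qed.

(** Here the attribute is light and the vertex may be heavy; [y v * q <= zeta] does the work. *)
Let pI i v : I i -> p (i, v) = x i * y v * q.
Proof.
move=> xM; apply/min_idPr => /=; apply: le_trans Cz.
rewrite -mulrA; apply: ler_pM => //; first by rewrite mulr_ge0.
by apply: le_trans xM _; apply: le_trans MC _; rewrite -[leLHS]expr1 CX.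
Qed.

Let tE i : \sum_(v | J v) p (i, v) = x i * theta.
Proof.
by rewrite mulr_suml mulr_sumr; apply: eq_bigr => v Jv; rewrite pJ// mulrA.
Qed.

(** From [x <= 1 + x ^ 2] each weight is at most [1 + sx2]. This crude bound is what makes the
    triples with two common attributes negligible against SX. *)
Let SXq : SX * q ^+ 2 <= 2 * C ^+ 2.
Proof.
have x1 i : x i <= 1 + sx2.
  have xs : x i ^+ 2 <= sx2.
    by rewrite (bigD1 i)//= lerDl; apply: sumr_ge0 => k _; rewrite exprn_ge0.
  have := sqr_ge0 (x i - 1); have := x0 i; nra.
have : SX <= (1 + sx2) * sx2.
  rewrite mulr_sumr; apply: ler_sum => i _; rewrite exprS ler_wpM2r ?exprn_ge0//.
have : q <= C by apply: le_trans qz _; apply: le_trans z1 C1.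
move=> qC SXs; apply: (@le_trans _ _ ((q + sx2 * q) * (sx2 * q))).
  rewrite [leRHS](_ : _ = (1 + sx2) * sx2 * q ^+ 2); last by ring.
  by mono; exact: sqr_ge0.
rewrite (_ : 2 * C ^+ 2 = (C + C) * C); last by ring.
by mono; apply: lerD.
Qed.

(** The linearization [3 t ^ 2 D - 2 t ^ 3] has mean [t ^ 3], and its variances add up to at most
    [9 \sum t ^ 5]. Since each [x i ^ 2] is at most [sx2], the sum of the [x i ^ 5] is at most
    [sx2 * SX], and [sx2] is at most [C zeta SX]. *)
Lemma triangles_lower_tail (lam : R) : 0 < lam ->
  bern_prob p (fun b => ordered_triangles R (h b) <=
                        theta ^+ 3 * SX - lam * SX - lam * SX)
  <= 11 * C ^+ 8 * zeta * (lam^-1 ^+ 2 + lam^-1).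
Proof.
move=> lam0.
have SX_gt0 : 0 < SX.
  rewrite lt_neqAle SX0 andbT; apply/negP => /eqP S0.
  by move: SXz; rewrite -S0 !mulr0 ler10.
pose t i := x i * theta.
have t0 i : 0 <= t i by rewrite mulr_ge0.
pose D i (b : cfg) : R := attr_deg R (h b) J i.
pose F (b : cfg) := 3 * \sum_i t i ^+ 2 * D i b - 2 * \sum_i t i ^+ 3.
pose O (b : cfg) : R := \sum_(v | J v) \sum_(u | J u) \sum_(w | J w && uniq [:: v; u; w])
      \sum_i \sum_(k | k != i)
        [&& b (i, v), b (i, u), b (i, w), b (k, v), b (k, u) & b (k, w)]%:R.
pose Err (b : cfg) := 3 * \sum_i D i b ^+ 2 + O b.
have D0 i b : 0 <= D i b by rewrite sumr_ge0.
have ED i : E (D i) = t i.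
  rewrite bern_exp_sum -[RHS]tE; apply: eq_bigr => v _; exact: bern_exp_bit.
have St3 : \sum_i t i ^+ 3 = theta ^+ 3 * SX.
  by rewrite mulr_sumr; apply: eq_bigr => i _; rewrite exprMn mulrC.
have St2 : \sum_i t i ^+ 2 = theta ^+ 2 * sx2.
  by rewrite mulr_sumr; apply: eq_bigr => i _; rewrite exprMn mulrC.
have EF : E F = theta ^+ 3 * SX.
  rewrite bern_expD bern_expZ bern_exp_sum bern_exp_cst -St3.
  under eq_bigr do rewrite bern_expZ ED -exprSr.
  by ring.
have sx2b : sx2 <= C * zeta * SX by apply: absorb.
(* Variance term, mean error term and slack for the deviation [lam * SX]. The 11 is 9 + 2: the
   squares of the [D i] contribute 9, the double triples 2. *)
rewrite [leRHS](_ : _ = (9 * C ^+ 6 * zeta * SX ^+ 2) / (lam * SX) ^+ 2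
   + (11 * C ^+ 8 * zeta * SX) / (lam * SX) + (11 * C ^+ 8 - 9 * C ^+ 6) * zeta * lam^-1 ^+ 2); last first.
  by field; rewrite !gt_eqF.
apply: ler_wpDr.
  rewrite !mulr_ge0 ?exprn_ge0 ?invr_ge0 ?(ltW lam0)// subr_ge0.
  by have := CX (isT : 6 <= 8)%N; have := exprn_ge0 6 C0; lra.
apply: (bern_lower_tail (link_prob01 x0 y0 q0) (F := F) (Err := Err)).
- by rewrite mulr_gt0.
- move=> b; apply: le_trans (ordered_triangles_ge R (h b) J).
  rewrite /F /Err opprD addrA lerD// !mulr_sumr -!sumrB; apply: ler_sum => i _.
  rewrite -/(D i b) lerD//.
  (* The linearization error factors: [D ^ 3 - 3 t ^ 2 D + 2 t ^ 3 = (2 t + D) (D - t) ^ 2]. *)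
  have := mulr_ge0 (addr_ge0 (t0 i) (addr_ge0 (t0 i) (D0 i b))) (sqr_ge0 (D i b - t i)).
  rewrite [X in _ <= X -> _](_ : _ = D i b ^+ 3 - (3 * (t i ^+ 2 * D i b) - 2 * t i ^+ 3)); last by ring.
  by rewrite subr_ge0.
- by move=> b; rewrite /Err /O; nonneg.
- by rewrite EF.
- pose cc (e : 'I_m * 'I_n) := 3 * t e.1 ^+ 2.
  have FE b : F b = \sum_(e | J e.2) cc e * (b e)%:R - 2 * \sum_i t i ^+ 3.
    congr (_ - _); transitivity (\sum_i \sum_(v | J v) cc (i, v) * (b (i, v))%:R).
      rewrite mulr_sumr; apply: eq_bigr => i _.
      by rewrite /D /attr_deg !mulr_sumr; apply: eq_bigr => v _; rewrite mulrA.
    rewrite (pair_big xpredT J (fun i v => cc (i, v) * (b (i, v))%:R)) /=.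
    by apply: eq_big => [[i v]|[i v] _].
  have EFl : E F = \sum_(e | J e.2) cc e * p e - 2 * \sum_i t i ^+ 3.
    rewrite (eq_bern_exp _ FE) bern_expD bern_exp_cst.
    by rewrite (bern_exp_lin p (fun e => J e.2) cc id).
  rewrite (eq_bern_exp _ (G := fun b => (\sum_(e | J e.2) cc e * (b (id e))%:R
     - \sum_(e | J e.2) cc e * p (id e)) ^+ 2)); last first.
    by move=> b; congr (_ ^+ 2); rewrite FE EFl; ring.
  apply: le_trans (bern_var_lin (link_prob01 x0 y0 q0) _ cc (@inj_id _)) _.
  have -> : \sum_(e | J e.2) cc e ^+ 2 * p (id e) = 9 * \sum_i t i ^+ 5.
    transitivity (\sum_i \sum_(v | J v) cc (i, v) ^+ 2 * p (i, v)).
      rewrite (pair_big xpredT J (fun i v => cc (i, v) ^+ 2 * p (i, v))) /=.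
      by apply: eq_big => [[i v]|[i v] _].
    rewrite mulr_sumr; apply: eq_bigr => i _.
    by rewrite /cc /= -mulr_sumr tE -/(t i); ring.
  have x5 : \sum_i x i ^+ 5 <= sx2 * SX.
    rewrite mulr_sumr; apply: ler_sum => i _.
    rewrite [leLHS](_ : _ = x i ^+ 2 * x i ^+ 3); last by ring.
    apply: ler_wpM2r; first by rewrite exprn_ge0.
    by rewrite (bigD1 i)//= lerDl; apply: sumr_ge0 => k _; rewrite exprn_ge0.
  have -> : \sum_i t i ^+ 5 = theta ^+ 5 * \sum_i x i ^+ 5.
    by rewrite mulr_sumr; apply: eq_bigr => i _; rewrite exprMn mulrC.
  apply: (@le_trans _ _ (9 * (C ^+ 5 * (C * zeta * SX * SX)))); last by apply: eq_ler; ring.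
  by mono; apply: le_trans x5 _; mono.
- rewrite bern_expD bern_expZ bern_exp_sum.
  apply: (@le_trans _ _ (3 * (3 * C ^+ 3 * zeta * SX) + 2 * C ^+ 8 * zeta * SX)); last first.
    have := ler_wpM2r SX0 (ler_wpM2r z0 (CX (isT : 3 <= 8)%N)); lra.
  apply: lerD.
    rewrite ler_wpM2l//.
    (* The linear term of [t + t ^ 2] is traded for [t ^ 2 + 1]; the ones add up to [m], which is of
       order [1 / q] and can be absorbed. *)
    apply: (@le_trans _ _ (\sum_i (2 * t i ^+ 2 + 1))).
      apply: ler_sum => i _; apply: le_trans (exp_attr_deg_sqr_le x0 y0 q0 M i) _.
      by rewrite tE -/(t i); have := sqr_ge0 (t i - 1); have := t0 i; nra.
    rewrite big_split /= -mulr_sumr St2 sumr_const card_ord.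
    apply: (@le_trans _ _ (2 * (C ^+ 2 * (C * zeta * SX)) + C * zeta * SX)).
      apply: lerD; first by mono.
      by apply: absorb.
    have := ler_wpM2r SX0 (ler_wpM2r z0 (CX (isT : 1 <= 3)%N)); rewrite expr1 => H1.
    rewrite [leLHS](_ : _ = 2 * (C ^+ 3 * zeta * SX) + C * zeta * SX); last by ring.
    lra.
  apply: le_trans (exp_double_triples_le x0 y0 q0 M) _.
  rewrite [leLHS](_ : _ = (SX * q ^+ 2) * (Y2 * q) ^+ 3 * q * SX); last by ring.
  apply: (@le_trans _ _ ((2 * C ^+ 2) * (C ^+ 2) ^+ 3 * zeta * SX)); last by apply: eq_ler; ring.
  by mono.
Qed.

(** The mean number of links pairs from a heavy [v] through a light attribute to a light vertex is
    exactly [c * y v], hence the choice of [tau]: the linearized count [F] has mean [c ^ 2] times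
    the heavy part of SY. The loss [C ^ 6 zeta SY] covers the part of SY carried by light
    vertices. *)
Lemma open_paths_lower_tail (lam : R) : 0 < lam ->
  bern_prob p (fun b => ordered_paths2 R (h b) - ordered_triangles R (h b) <=
                        (c ^+ 2 * SY - C ^+ 6 * zeta * SY) - lam * SY - lam * SY)
  <= 16 * C ^+ 11 * zeta * (lam^-1 ^+ 2 + lam^-1).
Proof.
move=> lam0.
have SY_gt0 : 0 < SY.
  rewrite lt_neqAle SY0 andbT; apply/negP => /eqP S0.
  by move: SYz; rewrite -S0 !mulr0 ler10.
pose tau v := c * y v.
have tau0 v : 0 <= tau v by rewrite mulr_ge0.
pose Q b := star_sum x y M tau b.
pose S' := \sum_(v | ~~ J v) y v ^+ 2.
have tau2 : \sum_(v | ~~ J v) tau v ^+ 2 = c ^+ 2 * S'.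
  by rewrite mulr_sumr; apply: eq_bigr => v _; rewrite exprMn.
pose F b := 2 * Q b - c ^+ 2 * S'.
pose Err (b : cfg) : R :=
  2 * \sum_(v | ~~ J v) \sum_(u | J u) \sum_(i | I i) \sum_(k | I k && (k != i))
      tau v * [&& b (i, v), b (i, u), b (k, v) & b (k, u)]%:R
  + \sum_(v | ~~ J v) \sum_(u | J u) \sum_(i | I i) (b (i, v) && b (i, u))%:R
  + \sum_(v | ~~ J v) \sum_(u | J u) \sum_(w | J w && (w != u)) closed_reps R (h b) I v u w.
have [EQ VQ] := star_sum_moments x0 y0 q0 M tau0.
have mean : star_mean x y q M tau = c ^+ 2 * S'.
  rewrite /star_mean.
  transitivity (\sum_(i | I i) x i ^+ 2 * (\sum_(v | ~~ J v) tau v * y v) * (q * theta)).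
    apply: eq_bigr => i Ii; rewrite tE.
    have -> : \sum_(v | ~~ J v) tau v * p (i, v) = x i * q * \sum_(v | ~~ J v) tau v * y v.
      by rewrite mulr_sumr; apply: eq_bigr => v _; rewrite pI//; ring.
    by ring.
  have -> : \sum_(v | ~~ J v) tau v * y v = c * S'.
    by rewrite mulr_sumr; apply: eq_bigr => v _; rewrite /tau; ring.
  by rewrite -!mulr_suml; ring.
have EF : E F = c ^+ 2 * S'.
  by rewrite bern_expD bern_expZ bern_exp_cst EQ mean; ring.
(* The 16 is 4 * 4, one factor 4 coming from the 2 in front of [Q]. The 7 counts the error terms of
   [Err] with multiplicity, each at most [C ^ 7 zeta SY]. *)
rewrite [leRHS](_ : _ = (16 * C ^+ 11 * zeta * SY ^+ 2) / (lam * SY) ^+ 2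
   + (7 * C ^+ 7 * zeta * SY) / (lam * SY)
   + (16 * C ^+ 11 - 7 * C ^+ 7) * zeta * lam^-1); last first.
  by field; rewrite !gt_eqF.
apply: ler_wpDr.
  rewrite !mulr_ge0 ?exprn_ge0 ?invr_ge0 ?(ltW lam0)// subr_ge0.
  by have := CX (isT : 7 <= 11)%N; have := exprn_ge0 7 C0; lra.
apply: (bern_lower_tail (link_prob01 x0 y0 q0) (F := F) (Err := Err)).
- by rewrite mulr_gt0.
- move=> b; apply: le_trans (open_paths2_ge (h b) I J tau0).
  rewrite tau2 lerD// lerD// ler_wpM2l// /Q /star_sum.
  under eq_bigr => i _ do rewrite /attr_deg big_distrlr.
  rewrite exchange_big; apply: ler_sum => v _; rewrite exchange_big.
  apply: ler_sum => u _; apply: ler_sum => i _.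
  by case: (b (i, v)); case: (b (i, u)); rewrite /= ?mulr0 ?mulr1 ?mul0r.
- move=> b; rewrite /Err /closed_reps.
  by nonneg.
- rewrite EF -[S'](addrK Y2) (_ : S' + Y2 = SY); last first.
    by rewrite [RHS](bigID J) /= addrC.
  rewrite mulrBr lerD2l lerN2.
  have : Y2 <= C ^+ 2 * zeta * SY by apply: absorb.
  move=> Y2b; apply: (@le_trans _ _ ((C ^+ 2) ^+ 2 * (C ^+ 2 * zeta * SY))); first by mono.
  by apply: eq_ler; ring.
- rewrite (eq_bern_exp _ (G := fun b => 4 * (Q b - c ^+ 2 * S') ^+ 2)); last first.
    by move=> b; rewrite EF /F; ring.
  rewrite bern_expZ -mean.
  apply: (@le_trans _ _ (4 * (4 * C ^+ 11 * zeta * SY ^+ 2))); last by apply: eq_ler; ring.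
  rewrite ler_wpM2l//; apply: le_trans VQ _.
  (* Uniform bound for one light attribute: the first factor bounds the second moment of its heavy
     links weighted by [tau], the second that of its light degree. Summed over [m] attributes, the
     square of [q * SY] costs only [m q ^ 2 <= C zeta]. *)
  pose B := (C ^+ 5 * zeta * SY + C ^+ 6 * (q * SY) ^+ 2) * (2 * C ^+ 4).
  apply: (@le_trans _ _ (\sum_(i : 'I_m) B)); last first.
    rewrite sumr_const card_ord -mulr_natl.
    have mz : m%:R <= C * zeta * SY by apply: absorb.
    have mqq : m%:R * q ^+ 2 <= C * zeta.
      by rewrite [leLHS](_ : _ = m%:R * q * q); [mono|ring].
    rewrite /B.
    rewrite [leLHS](_ : _ = 2 * C ^+ 9 * zeta * SY * m%:R + 2 * C ^+ 10 * SY ^+ 2 * (m%:R * q ^+ 2)); last by ring.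
    apply: (@le_trans _ _ (2 * C ^+ 9 * zeta * SY * (C * zeta * SY) + 2 * C ^+ 10 * SY ^+ 2 * (C * zeta))).
      by apply: lerD; mono.
    rewrite [leLHS](_ : _ = 2 * (C ^+ 10 * zeta * zeta * SY ^+ 2) + 2 * (C ^+ 11 * zeta * SY ^+ 2)); last by ring.
    have C1011 : C ^+ 10 <= C ^+ 11 by exact: CX.
    have : C ^+ 10 * zeta * zeta * SY ^+ 2 <= C ^+ 11 * zeta * 1 * SY ^+ 2 by mono.
    rewrite mulr1; lra.
  apply: le_trans (sub_sum I _); last by move=> i; rewrite /B; nonneg.
  apply: ler_sum => i Ii; rewrite tE.
  have xC : x i <= C by apply: le_trans Ii MC.
  have tC : x i * theta <= C ^+ 2 by rewrite expr2; mono.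
  have y2' : S' <= SY by apply: sub_sum => v; rewrite exprn_ge0.
  have S'0 : 0 <= S' by rewrite /S'; nonneg.
  have U1 : \sum_(v | ~~ J v) tau v * p (i, v) <= C ^+ 3 * (q * SY).
    rewrite (_ : \sum_(v | _) _ = c * x i * (q * S')).
      rewrite [C ^+ 3](_ : _ = C ^+ 2 * C); last by ring.
      by mono.
    by rewrite /tau /S'; move: (c) => c'; rewrite !mulr_sumr; apply: eq_bigr => v _; rewrite pI//; ring.
  have U2 : \sum_(v | ~~ J v) tau v ^+ 2 * p (i, v) <= C ^+ 5 * zeta * SY.
    rewrite (_ : \sum_(v | _) _ = c ^+ 2 * x i * ((\sum_(v | ~~ J v) y v ^+ 3) * q)).
      rewrite [leRHS](_ : _ = (C ^+ 2) ^+ 2 * C * (zeta * SY)); last by ring.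
      apply: ler_pM; [by nonneg|by nonneg|by mono|].
      apply: le_trans y3q; rewrite ler_wpM2r// sub_sum// => v.
      by rewrite exprn_ge0.
    by rewrite /tau; move: (c) => c'; rewrite mulr_suml !mulr_sumr; apply: eq_bigr => v _; rewrite pI//; ring.
  have p0 v : 0 <= p (i, v) by exact: link_prob_ge0.
  have U10 : 0 <= \sum_(v | ~~ J v) tau v * p (i, v).
    by apply: sumr_ge0 => v _; rewrite mulr_ge0.
  rewrite /B; apply: ler_pM.
  + by apply: addr_ge0; [apply: sumr_ge0 => v _; rewrite mulr_ge0 ?exprn_ge0|rewrite exprn_ge0].
  + by nonneg.
  + apply: lerD => //; rewrite [leRHS](_ : _ = (C ^+ 3 * (q * SY)) ^+ 2); last by ring.
    by apply: lerXn2r => //; rewrite nnegrE; nonneg.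
  + have t0 : 0 <= x i * theta by nonneg.
    apply: (@le_trans _ _ (C ^+ 2 + (C ^+ 2) ^+ 2)).
      by apply: lerD; mono.
    rewrite -exprM; have := CX (isT : 2 <= 4)%N; lra.
- have sx2b : sx2 <= C * zeta * SY by apply: absorb.
  have X3b : X3 <= C ^+ 2 * zeta * SY by apply: absorb.
  have C57 := ler_wpM2r SY0 (ler_wpM2r z0 (CX (isT : 5 <= 7)%N)).
  have C37 := ler_wpM2r SY0 (ler_wpM2r z0 (CX (isT : 3 <= 7)%N)).
  have C67 := ler_wpM2r SY0 (ler_wpM2r z0 (CX (isT : 6 <= 7)%N)).
  rewrite !bern_expD bern_expZ.
  have O2 : (\sum_v tau v * y v ^+ 2) * Y2 * (sx2 * q ^+ 2) ^+ 2 <= C ^+ 6 * zeta * SY.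
    rewrite (_ : \sum_v _ = c * \sum_v y v ^+ 3); last first.
      by rewrite mulr_sumr; apply: eq_bigr => v _; rewrite /tau; ring.
    rewrite [leLHS](_ : _ = c * (Y2 * q) * (sx2 * q) ^+ 2 * ((\sum_v y v ^+ 3) * q)); last by ring.
    rewrite [leRHS](_ : _ = C ^+ 2 * C ^+ 2 * C ^+ 2 * (zeta * SY)); last by ring.
    by mono.
  have O2' := le_trans (exp_double_pairs_le x0 y0 q0 M tau0) O2.
  have dg : sy ^+ 2 * sx2 * q ^+ 2 <= C ^+ 3 * zeta * SY.
    rewrite [leLHS](_ : _ = (sy * q) ^+ 2 * sx2); last by ring.
    rewrite [leRHS](_ : _ = C ^+ 2 * (C * zeta * SY)); last by ring.
    by mono.
  have dg' := le_trans (exp_pairs_le x0 y0 q0 M) dg.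
  have T1 : sy ^+ 3 * X3 * q ^+ 3 <= C ^+ 5 * zeta * SY.
    rewrite [leLHS](_ : _ = (sy * q) ^+ 3 * X3); last by ring.
    rewrite [leRHS](_ : _ = C ^+ 3 * (C ^+ 2 * zeta * SY)); last by ring.
    by mono.
  have T2 : SY * sy * Y2 * X3 * sx2 * q ^+ 5 <= C ^+ 6 * zeta * SY.
    rewrite [leLHS](_ : _ = (sy * q) * (Y2 * q) * (X3 * q) * (sx2 * q) * q * SY); last by ring.
    rewrite [C ^+ 6](_ : _ = C * C ^+ 2 * C ^+ 2 * C); last by ring.
    by mono.
  have T3 : SY * Y2 ^+ 2 * sx2 ^+ 3 * q ^+ 6 <= C ^+ 7 * zeta * SY.
    rewrite [leLHS](_ : _ = (Y2 * q) ^+ 2 * (sx2 * q) ^+ 3 * q * SY); last by ring.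
    rewrite [C ^+ 7](_ : _ = (C ^+ 2) ^+ 2 * C ^+ 3); last by ring.
    by mono.
  have := exp_closed_le x0 y0 q0 M; lra.
Qed.

End LowerTails.

(** * Concentration of the clustering coefficient for typical weights *)

Lemma ratio_ge (R : realFieldType) (u w A Z a g : R) : 0 < Z -> A <= Z -> 0 <= a -> 0 <= g ->
  0 <= u -> 0 < w -> A - a * Z <= u -> w <= (1 + g) * Z ->
  A / Z - (a + g) <= u / w.
Proof.
move=> Z0 AZ a0 g0 u0 w0 Au wZ; rewrite ler_pdivlMr//.
have [neg|pos] := leP (A / Z - (a + g)) 0.
  by apply: le_trans u0; rewrite mulr_le0_ge0// ltW.
apply: le_trans Au; set al := A / Z in pos *.
have al1 : al <= 1 by rewrite ler_pdivrMr// mul1r.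
have -> : A = al * Z by rewrite /al divfK ?gt_eqF.
apply: le_trans (ler_wpM2l (ltW pos) wZ) _.
rewrite mulrA -mulrBl ler_wpM2r ?(ltW Z0)//.
have : 0 <= g * (1 - al) by rewrite mulr_ge0 ?subr_ge0.
by have := mulr_ge0 g0 a0; have := sqr_ge0 g; nra.
Qed.

(** Only lower bounds on shares are available from [ratio_ge]. The shares of [NT] and [NO] add up to
    1, so a lower bound on the second is an upper bound on the first; [a < 1 / 2] keeps the total
    positive. *)
Lemma ratio_close (R : realFieldType) (NT NO A B a g : R) :
  0 <= A -> 0 <= B -> 0 < A + B -> 0 <= a -> 0 <= g -> a < 2^-1 ->
  0 <= NT -> 0 <= NO ->
  A - a * (A + B) <= NT -> B - a * (A + B) <= NO ->
  NT + NO <= (1 + g) * (A + B) ->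
  `|NT / (NT + NO) - A / (A + B)| <= a + g.
Proof.
move=> A0 B0 Z0 a0 g0 a2 NT0 NO0 ANT BNO NPZ.
have w0 : 0 < NT + NO by apply: (@lt_le_trans _ _ ((1 - 2 * a) * (A + B))); [rewrite mulr_gt0//; lra|nra].
have H1 := ratio_ge Z0 (_ : A <= A + B) a0 g0 NT0 w0 ANT NPZ.
have H2 := ratio_ge Z0 (_ : B <= A + B) a0 g0 NO0 w0 BNO NPZ.
have {}H1 := H1 ltac:(by rewrite lerDl); have {}H2 := H2 ltac:(by rewrite lerDr).
have E1 : A / (A + B) + B / (A + B) = 1 by rewrite -mulrDl divff// gt_eqF.
have E2 : NT / (NT + NO) + NO / (NT + NO) = 1 by rewrite -mulrDl divff// gt_eqF.
by rewrite ler_norml; apply/andP; split; lra.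
Qed.

(** The constant is 4 + 6 + 4 + 1, the binomial coefficients of the fourth power without the leading
    one. *)
Lemma expr_1D_le (R : realFieldType) (r : R) : 0 <= r -> r <= 1 ->
  (1 + r) ^+ 3 <= 1 + 15 * r /\ (1 + r) ^+ 4 <= 1 + 15 * r.
Proof.
move=> r0 r1.
have r2 : r ^+ 2 <= r by rewrite expr2 ler_piMr.
have r3 : r ^+ 3 <= r by rewrite exprS ler_piMr// exprn_ile1.
have r4 : r ^+ 4 <= r by rewrite exprS ler_piMr// exprn_ile1.
rewrite (_ : (1 + r) ^+ 3 = 1 + 3 * r + 3 * r ^+ 2 + r ^+ 3); last by ring.
rewrite (_ : (1 + r) ^+ 4 = 1 + 4 * r + 6 * r ^+ 2 + 4 * r ^+ 3 + r ^+ 4); last by ring.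
by split; lra.
Qed.

(** The order of the quantifiers is that of the later choices: [rho] first, then a cutoff [M] that
    keeps all but a small fraction of the moments and determines [C], and last [zeta], which has to
    beat powers of [C]. *)
Lemma clustering_concentration (R : realType) (f g eps : R) :
  0 < f -> 0 < g -> 0 < eps ->
  exists2 rho : R, 0 < rho < 1 & forall C : R, 1 <= C ->
  exists2 zeta : R, 0 < zeta &
  forall (m n : nat) (x : 'I_m -> R) (y : 'I_n -> R) (q M : R),
    (forall i, 0 <= x i) -> (forall j, 0 <= y j) -> 0 < q -> q <= zeta ->
    M <= C -> m%:R * q <= C ->
    (\sum_i x i ^+ 2) * q <= C -> (\sum_j y j) * q <= C ->
    (forall j, y j * q <= zeta) ->
    1 <= zeta * (q * \sum_i x i ^+ 3) -> 1 <= zeta * (q * \sum_j y j ^+ 2) ->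
    (\sum_i x i ^+ 2) * q <= (1 + rho) * f ->
    (1 - rho) * f <= (\sum_(i | x i <= M) x i ^+ 2) * q ->
    (\sum_j y j) * q <= (1 + rho) * g ->
    (1 - rho) * g <= (\sum_(j | y j <= M) y j) * q ->
    bern_prob (link_prob x y q) (fun b =>
      eps < `|rig_clustering (fun i j => b (i, j)) R
       - (1 + f ^+ 2 / g * (\sum_j y j ^+ 2) / (\sum_i x i ^+ 3))^-1|) <= eps.
Proof.
move=> f0 g0 eps0.
(* The bound by [eps / 100] serves the final sums [7 rho + eps / 2] and [2 rho + eps / 2]. The
   quadratic bound serves the upper tail, where about [31 rho] is divided by a gap of order
   [eps / 2]. *)
pose rho := Num.min (100^-1) (Num.min (eps / 100) (eps ^+ 2 / 200)).
have rho0 : 0 < rho by rewrite !lt_min invr_gt0 ltr0n !divr_gt0 ?exprn_gt0 ?ltr0n.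
have rho1 : rho <= 100^-1 by rewrite ge_min lexx.
have rho2 : rho <= eps / 100 by rewrite !ge_min lexx orbT.
have rho3 : rho <= eps ^+ 2 / 200 by rewrite !ge_min lexx !orbT.
have rho_lt1 : rho < 1 by clearbody rho; lra.
exists rho; first by rewrite rho0.
clearbody rho.
move=> C C1; have C0 : 0 < C by exact: lt_le_trans C1.
pose A0 := g ^+ 3; pose B0 := f ^+ 2 * g ^+ 2.
have A00 : 0 < A0 by rewrite exprn_gt0.
have B00 : 0 < B0 by rewrite mulr_gt0 ?exprn_gt0.
(* Then [lam * SX] is at most [rho * A] and [lam * SY] at most [rho * B]. *)
pose lam := rho * Num.min A0 B0.
have lam0 : 0 < lam by rewrite mulr_gt0// lt_min A00.
have lamA : lam <= rho * A0 by rewrite ler_pM2l// ge_min lexx.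
have lamB : lam <= rho * B0 by rewrite ler_pM2l// ge_min lexx orbT.
have li0 : 0 < lam^-1 by rewrite invr_gt0.
pose L := lam^-1 ^+ 2 + lam^-1 + 1.
have L0 : 0 < L by rewrite !addr_gt0 ?exprn_gt0.
(* Makes both tail bounds at most [rho]. The summand 1 in [L] gives [C ^ 11 zeta <= rho / 16] as
   well, whence [C ^ 3 zeta <= 1]. *)
pose zeta := rho / (16 * C ^+ 11 * L).
have zE : 16 * C ^+ 11 * L * zeta = rho.
  by rewrite /zeta mulrC divfK// gt_eqF// !mulr_gt0 ?exprn_gt0.
have z0 : 0 < zeta by rewrite divr_gt0// !mulr_gt0 ?exprn_gt0.
have CX k : (k <= 11)%N -> C ^+ k * zeta <= C ^+ 11 * zeta.
  by move=> k11; rewrite ler_pM2r// ler_weXn2l.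
have Cz0 k : 0 < C ^+ k * zeta by rewrite mulr_gt0 ?exprn_gt0.
exists zeta => // m n x y q M x0 y0 q0 qz MC mq sxq syq yz SXz SYz fx fx' gy gy'.
set SX := \sum_i x i ^+ 3; set SY := \sum_j y j ^+ 2.
have zCL : C ^+ 11 * zeta * L * 16 = rho by rewrite -zE; ring.
have Cz : C ^+ 3 * zeta <= 1.
  apply: le_trans (CX 3 isT) _.
  have : C ^+ 11 * zeta <= C ^+ 11 * zeta * L.
    by rewrite ler_peMr ?(ltW (Cz0 _))// /L lerDr addr_ge0 ?sqr_ge0 ?ltW.
  lra.
have Czl : C ^+ 6 * zeta <= lam.
  apply: le_trans (CX 6 isT) _; rewrite -[lam]mul1r -ler_pdivrMr//.
  have : C ^+ 11 * zeta * lam^-1 <= C ^+ 11 * zeta * L.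
    by rewrite ler_wpM2l ?(ltW (Cz0 _))// /L; have := sqr_ge0 lam^-1; lra.
  lra.
have SX0 : 0 < SX.
  rewrite lt_neqAle sumr_ge0 ?andbT; last by move=> i _; rewrite exprn_ge0.
  by apply/negP => /eqP S0; move: SXz; rewrite -/SX -S0 !mulr0 ler10.
have SY0 : 0 < SY.
  rewrite lt_neqAle sumr_ge0 ?andbT; last by move=> i _; rewrite exprn_ge0.
  by apply/negP => /eqP S0; move: SYz; rewrite -/SY -S0 !mulr0 ler10.
pose A := A0 * SX; pose B := B0 * SY.
have A_gt0 : 0 < A by rewrite mulr_gt0.
have B_gt0 : 0 < B by rewrite mulr_gt0.
have limE : (1 + f ^+ 2 / g * SY / SX)^-1 = A / (A + B).
  have -> : 1 + f ^+ 2 / g * SY / SX = (A + B) / A.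
    by rewrite /A /B /A0 /B0; field; rewrite !gt_eqF.
  by rewrite invf_div.
rewrite limE.
pose NT (b : {ffun 'I_m * 'I_n -> bool}) := ordered_triangles R (fun i j => b (i, j)).
pose NP (b : {ffun 'I_m * 'I_n -> bool}) := ordered_paths2 R (fun i j => b (i, j)).
have P01 := link_prob01 x0 y0 (ltW q0).
have NT0 b : 0 <= NT b by rewrite /NT /ordered_triangles; nonneg.
have NP0 b : 0 <= NP b by rewrite /NP /ordered_paths2; nonneg.
set th := (\sum_(j | y j <= M) y j) * q in gy'.
set cx := (\sum_(i | x i <= M) x i ^+ 2) * q in fx'.
have pow k (u v : R) : 0 <= v -> (1 - rho) * v <= u -> (1 - rho) ^+ k * v ^+ k <= u ^+ k.
  move=> v0 uv; have w0 : 0 <= (1 - rho) * v by rewrite mulr_ge0//; lra.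
  by rewrite -exprMn; apply: lerXn2r; rewrite ?nnegrE// (le_trans w0).
(* The 7 is set by the open 2-paths below: 4 from [(1 - rho) ^ 4], 1 from the loss [C ^ 6 zeta], 2
   from the two deviations [lam]. *)
have tailA : bern_prob (link_prob x y q) (fun b => NT b <= A - 7 * rho * (A + B)) <= rho.
  apply: le_trans (_ : 11 * C ^+ 8 * zeta * (lam^-1 ^+ 2 + lam^-1) <= _); last first.
    have : 11 * C ^+ 8 * zeta <= 16 * C ^+ 11 * zeta by have := CX 8 isT; have := Cz0 8; lra.
    move=> h1; apply: le_trans (_ : 16 * C ^+ 11 * zeta * L <= _); last lra.
    apply: ler_pM => //; [by have := Cz0 8; lra|by rewrite addr_ge0 ?sqr_ge0// ltW|].
    by rewrite lerDl.
  apply: le_trans _ (triangles_lower_tail x0 y0 q0 C1 Cz qz MC mq sxq syq SXz lam0).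
  apply: bern_prob_le => // b; rewrite -/(NT b) -/SX => NTb; apply: le_trans NTb _.
  rewrite [((_ * q) ^+ 3)%R](_ : _ = th ^+ 3)//.
  have := pow 3 th g (ltW g0) gy'; rewrite -/A0 => p3.
  have := ler_wpM2r (ltW SX0) p3; have := ler_wpM2r (ltW SX0) lamA.
  have : (1 - 3 * rho) * A <= (1 - rho) ^+ 3 * A0 * SX.
    rewrite -mulrA -/A ler_pM2r//.
    have -> : (1 - rho) ^+ 3 = 1 - 3 * rho + rho ^+ 2 * (3 - rho) by ring.
    by rewrite lerDl mulr_ge0 ?sqr_ge0//; lra.
  have : 0 < rho * B by rewrite mulr_gt0.
  have : 0 < rho * A by rewrite mulr_gt0.
  rewrite -[rho * A0 * SX]mulrA -/A; lra.
have tailB : bern_prob (link_prob x y q) (fun b => NP b - NT b <= B - 7 * rho * (A + B)) <= rho.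
  apply: le_trans (_ : 16 * C ^+ 11 * zeta * (lam^-1 ^+ 2 + lam^-1) <= _); last first.
    apply: le_trans (_ : 16 * C ^+ 11 * zeta * L <= _); last lra.
    by rewrite ler_wpM2l ?lerDl//; have := Cz0 11; lra.
  apply: le_trans _ (open_paths_lower_tail x0 y0 q0 C1 Cz qz MC mq sxq syq yz SYz lam0).
  apply: bern_prob_le => // b; rewrite -/(NT b) -/(NP b) -/SY => Nb; apply: le_trans Nb _.
  rewrite [(_ * _ * q ^+ 2) ^+ 2](_ : _ = cx ^+ 2 * th ^+ 2); last by rewrite /cx /th; ring.
  have px := pow 2 cx f (ltW f0) fx'; have pt := pow 2 th g (ltW g0) gy'.
  have pp : ((1 - rho) ^+ 2 * f ^+ 2) * ((1 - rho) ^+ 2 * g ^+ 2) <= cx ^+ 2 * th ^+ 2.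
    by apply: ler_pM => //; rewrite mulr_ge0 ?sqr_ge0.
  have := ler_wpM2r (ltW SY0) pp; have := ler_wpM2r (ltW SY0) lamB.
  have := ler_wpM2r (ltW SY0) Czl.
  have -> : (1 - rho) ^+ 2 * f ^+ 2 * ((1 - rho) ^+ 2 * g ^+ 2) * SY = (1 - rho) ^+ 4 * B.
    by rewrite /B /B0; ring.
  have : (1 - 4 * rho) * B <= (1 - rho) ^+ 4 * B.
    rewrite ler_pM2r//.
    have -> : (1 - rho) ^+ 4 = 1 - 4 * rho + rho ^+ 2 * ((2 - rho) ^+ 2 + 2) by ring.
    by rewrite lerDl mulr_ge0 ?sqr_ge0// addr_ge0 ?sqr_ge0.
  have : 0 < rho * A by rewrite mulr_gt0.
  have : 0 < rho * B by rewrite mulr_gt0.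
  rewrite -[rho * B0 * SY]mulrA -/B; lra.
have meanP : bern_exp (link_prob x y q) NP <= (1 + 15 * rho) * (A + B).
  apply: le_trans (exp_paths2_le x0 y0 (ltW q0)) _; rewrite -/SX -/SY.
  have sy0 : 0 <= (\sum_j y j) * q by rewrite mulr_ge0 ?(ltW q0)// sumr_ge0.
  have sx0 : 0 <= (\sum_i x i ^+ 2) * q.
    by rewrite mulr_ge0 ?(ltW q0)// sumr_ge0// => i _; rewrite exprn_ge0.
  rewrite mulrDr; apply: lerD.
    rewrite [leLHS]mulrC [(1 + _) * A](_ : _ = (1 + 15 * rho) * A0 * SX); last by rewrite /A mulrA.
    rewrite ler_pM2r//.
    apply: le_trans (_ : ((1 + rho) * g) ^+ 3 <= _).
      by apply: lerXn2r; rewrite ?nnegrE// (le_trans sy0).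
    rewrite exprMn -/A0 ler_pM2r//.
    by have [] := expr_1D_le (ltW rho0) (ltW rho_lt1).
  rewrite [_ * _ * q ^+ 2](_ : _ = ((\sum_i x i ^+ 2) * q) * ((\sum_j y j) * q)); last by ring.
  rewrite [leLHS]mulrC [(1 + _) * B](_ : _ = (1 + 15 * rho) * B0 * SY); last by rewrite /B mulrA.
  rewrite ler_pM2r//.
  apply: le_trans (_ : (((1 + rho) * f) * ((1 + rho) * g)) ^+ 2 <= _).
    apply: lerXn2r; rewrite ?nnegrE; [exact: mulr_ge0| |exact: ler_pM].
    by nonneg; exact: ltW.
  rewrite (_ : (1 + rho) * f * _ = (1 + rho) ^+ 2 * (f * g)); last by ring.
  rewrite exprMn [(f * g) ^+ 2]exprMn -/B0 ler_pM2r//.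
  by rewrite -exprM; have [] := expr_1D_le (ltW rho0) (ltW rho_lt1).
pose Z := A + B; have Z0 : 0 < Z by rewrite addr_gt0.
(* The 14 is 7 + 7: the lower bounds for the triangles and for the open 2-paths are added. *)
pose lo := (1 - 14 * rho) * Z; pose hi := (1 + eps / 2) * Z.
have lo0 : 0 <= lo by rewrite mulr_ge0 ?(ltW Z0)//; move: rho1; clear; lra.
have lohi : lo < hi by rewrite ltr_pM2r//; move: rho0 eps0; clear; lra.
have tailLo : bern_prob (link_prob x y q) (fun b => NP b <= lo) <= rho + rho.
  apply: le_trans _ (lerD tailA tailB); apply: le_trans _ (bern_probU P01 _ _).
  apply: bern_prob_le => // b; rewrite /lo /Z => Nb.
  by case: (leP (NT b)) => //= NTb; move: NTb Nb; clear; lra.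
have tailHi : bern_prob (link_prob x y q) (fun b => hi < NP b) <= eps / 2.
  apply: le_trans (bern_upper_tail P01 NP0 lo0 lohi meanP tailLo) _.
  rewrite ler_pdivrMr ?subr_gt0// -/Z.
  have -> : hi - lo = (eps / 2 + 14 * rho) * Z by rewrite /hi /lo; ring.
  have -> : (1 + 15 * rho) * Z - lo + lo * (rho + rho) = (29 * rho + 2 * rho - 28 * rho ^+ 2) * Z.
    by rewrite /lo; ring.
  rewrite [leRHS]mulrA ler_pM2r//.
  have : 0 <= eps / 2 * (14 * rho) by rewrite !mulr_ge0// ltW.
  have := sqr_ge0 rho; have := sqr_ge0 eps; move: rho3; clear; lra.
apply: (@le_trans _ _ (rho + (rho + eps / 2))); last lra.
apply: le_trans _ (lerD tailA (lerD tailB tailHi)).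
apply: le_trans _ (lerD (lexx _) (bern_probU P01 _ _)).
apply: le_trans _ (bern_probU P01 _ _); apply: bern_prob_le => // b.
apply: contraLR; rewrite !negb_or -!ltNge -!leNgt -/Z => /and3P[h1 h2 h3].
rewrite rig_clusteringE -/(NT b) -/(NP b).
have -> : NP b = NT b + (NP b - NT b) by ring.
have NO0 : 0 <= NP b - NT b.
  rewrite subr_ge0; apply: ler_sum => v _; apply: ler_sum => u _; apply: ler_sum => w _.
  case: (boolP (rig_adj _ u w)) => [/rig_adj_neq ->|_] /=; first by rewrite andbT.
  by rewrite !andbF.
have RC : `|NT b / (NT b + (NP b - NT b)) - A / (A + B)| <= 7 * rho + eps / 2.
  apply: ratio_close => //; try exact: ltW; try (move: rho0 rho1 eps0; clear; lra).
  by rewrite addrC subrK.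
by apply: (le_trans RC); move: rho2 eps0; clear; lra.
Qed.

Local Open Scope classical_set_scope.
Local Open Scope ring_scope.

(** * Weak laws of large numbers *)

Lemma measure_sub_fintype d (T : measurableType d) (R : realType)
    (P : probability T R) (K : finType) (D : pred K) (A : set T) (F : K -> set T) :
  measurable A -> (forall k, measurable (F k)) ->
  (forall t, A t -> exists2 k, D k & F k t) ->
  (P A <= \sum_(k | D k) P (F k))%E.
Proof.
move=> mA mF AF.
pose U (s : seq K) := \big[setU/set0]_(k <- s | D k) F k.
have mU s : measurable (U s) by apply: bigsetU_measurable.
have PU s : (P (U s) <= \sum_(k <- s | D k) P (F k))%E.
  rewrite /U; elim: s => [|k s IH]; first by rewrite !big_nil measure0.
  rewrite !big_cons; case: (D k) => //.
  apply: le_trans (measureU2 _ (mF k) (mU s)) _.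
  exact: leeD.
apply: le_trans (PU (index_enum K)).
apply: le_measure; rewrite ?inE// => t /AF[k Dk Fk].
by rewrite /U -bigcup_seq_cond; exists k => //=; rewrite mem_index_enum.
Qed.

Lemma measurable_forall d (T : measurableType d) (K : finType) (F : K -> set T) :
  (forall k, measurable (F k)) -> measurable [set t | forall k, F k t].
Proof.
move=> mF; rewrite (_ : mkset _ = \bigcap_(k in [set: K]) F k).
  by apply: fin_bigcap_measurable => //; exact: finite_finset.
by apply/seteqP; split => t /= H k; [move=> _|]; exact: H.
Qed.

Lemma measurable_set_le d (T : measurableType d) (R : realType) (f g : T -> R) :
  measurable_fun setT f -> measurable_fun setT g -> measurable [set t | f t <= g t].
Proof.
move=> mf mg; rewrite -[X in measurable X]setTI.
rewrite (_ : [set t | _] = (fun t => f t <= g t) @^-1` [set true]) //.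
exact: measurable_fun_ler.
Qed.

Definition iid_sample (R : realType) d (T : measurableType d) (P : probability T R)
    (PX : probability R R) (m : nat) (X : 'I_m -> T -> R) : Prop :=
  (forall i, measurable_fun setT (X i)) /\
  forall A : 'I_m -> set R, (forall i, measurable (A i)) ->
    P [set t | forall i, A i (X i t)] = (\prod_(i < m) fine (PX (A i)))%:E.

Section Counts.
Context (R : realType) d (T : measurableType d) (P : probability T R).
Variables (PX : probability R R) (m : nat) (X : 'I_m -> T -> R).
Hypothesis Xiid : iid_sample P PX X.
Variables (B : set R) (mB : measurable B).
Local Notation p := (fine (PX B)).

Lemma measurable_count_le (c : R) :
  measurable [set t | \sum_i (X i t \in B)%:R <= c].
Proof.
apply: measurable_set_le => //.
apply: measurable_sum => i.
have -> : (fun t => (X i t \in B)%:R : R) = \1_B \o X i by [].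
by apply: measurableT_comp => //; exact: Xiid.1.
Qed.

(** The membership bits form a Bernoulli sample: the iid property gives the probability of each bit
    pattern, with [B] for a bit 1 and its complement for a bit 0, so the finite Chebyshev inequality
    applies. *)
Lemma count_lower_tail (delta : R) : 0 < delta -> (0 < m)%N ->
  (P [set t | (\sum_i (X i t \in B)%:R <= (p - delta) * m%:R)%R]
     <= ((delta ^+ 2 * m%:R)^-1)%:E)%E.
Proof.
move=> delta0 m0.
pose bits t : {ffun 'I_m -> bool} := [ffun i => X i t \in B].
pose Q : pred {ffun 'I_m -> bool} := fun b => \sum_i (b i)%:R <= (p - delta) * m%:R.
have PB1 : (PX B <= 1)%E by exact: probability_le1.
have PBfin : PX B \is a fin_num by exact: fin_num_measure.
have p01 (i : 'I_m) : 0 <= p <= 1.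
  by rewrite fine_ge0//= -lee_fin fineK.
pose C (b : {ffun 'I_m -> bool}) (i : 'I_m) := if b i then B else ~` B.
have mC b i : measurable (C b i) by rewrite /C; case: ifP => // _; exact: measurableC.
have mF b : measurable [set t | forall i, C b i (X i t)].
  apply: measurable_forall => i; rewrite -[X in measurable X]setTI.
  by apply: Xiid.1 => //.
apply: (@le_trans _ _ (\sum_(b | Q b) P [set t | forall i, C b i (X i t)])%E).
  apply: measure_sub_fintype => //; first exact: measurable_count_le.
  move=> t /= tQ; exists (bits t).
    by rewrite /Q (eq_bigr (fun i => (X i t \in B)%:R))// => i _; rewrite ffunE.
  by move=> i /=; rewrite /C ffunE; case: ifPn; rewrite ?inE// notin_setE.
rewrite (eq_bigr (fun b => (bern_weight (fun=> p) b)%:E)); last first.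
  move=> b _; rewrite Xiid.2//; congr (_%:E); apply: eq_bigr => i _.
  rewrite /C; case: (b i) => //; rewrite probability_setC// fineB//.
rewrite sumEFin lee_fin.
have -> : \sum_(b | Q b) bern_weight (fun=> p) b = bern_prob (fun=> p) Q.
  rewrite /bern_prob /bern_exp big_mkcond; apply: eq_bigr => b _.
  by case: ifP; rewrite ?mulr1 ?mulr0.
have m_gt0 : 0 < m%:R :> R by rewrite ltr0n.
have dm0 : 0 < delta * m%:R by rewrite mulr_gt0.
have mean : \sum_(i < m) 1 * p = p * m%:R.
  by rewrite sumr_const card_ord mul1r mulr_natr.
rewrite (_ : (delta ^+ 2 * m%:R)^-1 = m%:R / (delta * m%:R) ^+ 2); last first.
  by field; rewrite !gt_eqF.
apply: (@le_trans _ _ (bern_prob (fun=> p)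
    (fun b => \sum_i 1 * (b i)%:R <= p * m%:R - delta * m%:R))).
  apply: bern_prob_le => // b; rewrite /Q mulrBl.
  by under [in X in _ -> X]eq_bigr do rewrite mul1r.
apply: le_trans (bern_chebyshev p01 _ _ dm0) _.
rewrite ler_pM2r ?invr_gt0 ?exprn_gt0// -mean.
apply: le_trans (bern_var_lin p01 xpredT (fun=> 1) (@inj_id _)) _.
apply: (@le_trans _ _ (\sum_(i < m) 1)); last by rewrite sumr_const card_ord.
by apply: ler_sum => i _; rewrite expr1n mul1r; have /andP[] := p01 i.
Qed.

End Counts.

Section SimpleApprox.
Import HBNNSimple.

(** Reduces the law of large numbers for [f] to frequencies of finitely many sets. The integral is a
    supremum over simple functions below [f], and it may be infinite. *)
Lemma simple_below (R : realType) (PX : probability R R) (f : R -> R) (c : R) :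
  (forall x, 0 <= f x) -> (c%:E < \int[PX]_x (f x)%:E)%E ->
  exists (K : finType) (r : K -> R) (B : K -> set R),
  [/\ (forall k, 0 <= r k), (forall k, measurable (B k)),
      (forall x, \sum_k r k * (x \in B k)%:R <= f x) &
      c < \sum_k r k * fine (PX (B k))].
Proof.
move=> f0; rewrite ge0_integralTE; last by move=> x; rewrite lee_fin.
move=> /ereal_sup_gt[_ /= [h hf <-]] ch.
have fin : finite_set (range h) by exact: fimfunP.
pose K : finType := fset_set (range h).
exists K, (fun k => val k), (fun k => h @^-1` [set (val k)]); split.
- move=> k; have : val k \in fset_set (range h) by exact: valP.
  by rewrite in_fset_set// => /set_mem[x _ <-].
- by move=> k; exact: measurable_sfunP.
- move=> x; rewrite -lee_fin; apply: le_trans (hf x); rewrite lee_fin.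
  rewrite [in leRHS]fimfunE fsbig_finite//= big_seq_fsetE /=.
  by apply: ler_sum => k _; rewrite indicE.
- rewrite -lte_fin; apply: lt_le_trans ch _.
  rewrite sintegralE fsbig_finite//= big_seq_fsetE /= -sumEFin.
  apply: lee_sum => k _; rewrite EFinM fineK//.
  by apply: fin_num_measure.
Qed.

End SimpleApprox.

(** A simple function below [f] already has integral above [c], and the frequencies of its level
    sets are controlled one by one. The threshold [N] precedes the probability space because the
    spaces of the model vary with the size. *)
Lemma lln_lower (R : realType) (PX : probability R R) (f : R -> R) (c eps : R) :
  measurable_fun setT f -> (forall x, 0 <= f x) ->
  (c%:E < \int[PX]_x (f x)%:E)%E -> 0 < eps ->
  exists N, forall m, (N <= m)%N ->
  forall d (T : measurableType d) (P : probability T R) (X : 'I_m -> T -> R),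
  iid_sample P PX X ->
  (P [set t | (\sum_i f (X i t) <= c * m%:R)%R] <= eps%:E)%E.
Proof.
move=> mf f0 /(simple_below f0)[K [r [B [r0 mB Bf cB]]]] eps0.
pose p k := fine (PX (B k)).
pose S := 1 + \sum_k r k.
have S0 : 0 < S by rewrite ltr_pwDl// sumr_ge0.
pose delta := (\sum_k r k * p k - c) / S.
have delta0 : 0 < delta by rewrite divr_gt0// subr_gt0.
have cd : c < \sum_k r k * (p k - delta).
  under eq_bigr do rewrite mulrBr.
  rewrite sumrB -mulr_suml.
  have -> : (\sum_k r k) = S - 1 by rewrite /S addrC addKr.
  rewrite mulrBl mulrC [X in _ - (X - _)]divfK ?gt_eqF//; rewrite mul1r.
  by rewrite -/delta; lra.
clearbody delta.
have [N HN] : exists N : nat, (#|K|%:R / (delta ^+ 2 * eps) < N%:R :> R).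
  exists (Num.bound (#|K|%:R / (delta ^+ 2 * eps))).
  by rewrite archi_boundP// divr_ge0// ltW// mulr_gt0// exprn_gt0.
exists N.+1 => m Nm d T P X Xiid.
have m0 : (0 < m)%N by exact: leq_trans Nm.
have m_gt0 : 0 < m%:R :> R by rewrite ltr0n.
have mS : measurable [set t | \sum_i f (X i t) <= c * m%:R].
  apply: measurable_set_le => //; apply: measurable_sum => i.
  by apply: measurableT_comp => //; exact: Xiid.1.
apply: (@le_trans _ _ (\sum_(k in K) P
  [set t | (\sum_i (X i t \in B k)%:R <= (p k - delta) * m%:R)%R])%E).
  apply: measure_sub_fintype => //.
    by move=> k; apply: measurable_count_le Xiid _ (mB k) _.
  move=> t /= ft; apply: contrapT => nk.
  have cnt k : (p k - delta) * m%:R < \sum_i (X i t \in B k)%:R.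
    by rewrite ltNge; apply/negP => le; apply: nk; exists k.
  move: ft; apply/negP; rewrite -ltNge.
  apply: (@lt_le_trans _ _ (\sum_k r k * ((p k - delta) * m%:R))).
    by under eq_bigr do rewrite mulrA; rewrite -mulr_suml ltr_pM2r.
  apply: (@le_trans _ _ (\sum_k r k * \sum_i (X i t \in B k)%:R)).
    by apply: ler_sum => k _; rewrite ler_wpM2l// ltW.
  under [leLHS]eq_bigr do rewrite mulr_sumr.
  by rewrite exchange_big; apply: ler_sum => i _; exact: Bf.
apply: (@le_trans _ _ (\sum_(k in K) ((delta ^+ 2 * m%:R)^-1)%:E)%E).
  by apply: lee_sum => k _; exact: count_lower_tail.
rewrite sumEFin lee_fin sumr_const -[leLHS]mulr_natl.
rewrite ler_pdivrMr ?mulr_gt0 ?exprn_gt0//.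
have D0 : 0 < delta ^+ 2 * eps by rewrite mulr_gt0 ?exprn_gt0.
move: HN; rewrite (ltr_pdivrMr _ _ D0) => /ltW HN.
apply: le_trans HN _; rewrite (_ : eps * _ = m%:R * (delta ^+ 2 * eps)); last by ring.
apply: ler_wpM2r; first exact: ltW.
by rewrite ler_nat ltnW.
Qed.

Lemma integral_iid (R : realType) (PX : probability R R) (f : R -> R) (m : nat) d
    (T : measurableType d) (P : probability T R) (X : 'I_m -> T -> R) i :
  iid_sample P PX X -> measurable_fun setT f -> (forall x, 0 <= f x) ->
  (\int[P]_t (f (X i t))%:E = \int[PX]_x (f x)%:E)%E.
Proof.
move=> [mX XA] mf f0.
have -> : (\int[P]_t (f (X i t))%:E = \int[pushforward P (X i)]_x (f x)%:E)%E.
  rewrite ge0_integral_pushforward//.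
  - exact/measurable_EFinP.
  - by move=> x _; rewrite lee_fin.
apply: eq_measure_integral => A mA _; rewrite /pushforward /=.
pose AA k : set R := if k == i then A else setT.
have mAA k : measurable (AA k) by rewrite /AA; case: ifP.
have := XA AA mAA; rewrite (bigD1 i)//= big1; last first.
  by move=> k ki; rewrite /AA (negbTE ki) probability_setT.
rewrite mulr1 /AA eqxx fineK ?fin_num_measure// => <-; congr (P _).
by apply/seteqP; split => t /= H; [move=> k; case: eqP => // ->|have := H i; rewrite eqxx].
Qed.

(** As in [bern_upper_tail], a lower tail and the exact mean give an upper tail: integrate [F m + (c
    - F + rho) m 1_B <= S + F m 1_A + rho m], where [A] is the lower tail event and [B] the upper
    one. *)
Lemma lln_upper (R : realType) (PX : probability R R) (f : R -> R) (c eps : R) :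
  measurable_fun setT f -> (forall x, 0 <= f x) ->
  (\int[PX]_x (f x)%:E < c%:E)%E -> 0 < eps ->
  exists N, forall m, (N <= m)%N ->
  forall d (T : measurableType d) (P : probability T R) (X : 'I_m -> T -> R),
  iid_sample P PX X ->
  (P [set t | (c * m%:R < \sum_i f (X i t))%R] <= eps%:E)%E.
Proof.
move=> mf f0 fc eps0.
have Ffin : (\int[PX]_x (f x)%:E)%E \is a fin_num.
  rewrite ge0_fin_numE; first exact: lt_trans fc (ltry _).
  by apply: integral_ge0 => x _; rewrite lee_fin.
pose F := fine (\int[PX]_x (f x)%:E)%E.
have FE : (\int[PX]_x (f x)%:E)%E = F%:E by rewrite fineK.
have F0 : 0 <= F by apply: fine_ge0; apply: integral_ge0 => x _; rewrite lee_fin.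
have Fc : F < c by rewrite -lte_fin -FE.
(* The integrated inequality bounds [(c - F) P(B)] by [F e1 + rho]; with these choices that is at
   most [2 rho = eps (c - F)]. *)
pose rho := eps * (c - F) / 2.
pose e1 := eps * (c - F) / (2 * (F + 1)).
have cF0 : 0 < c - F by rewrite subr_gt0.
have rho0 : 0 < rho by rewrite !mulr_gt0 ?invr_gt0.
have e10 : 0 < e1 by rewrite divr_gt0 ?mulr_gt0// ltr_wpDl.
have lo : ((F - rho)%:E < \int[PX]_x (f x)%:E)%E by rewrite FE lte_fin gtrBl.
have e1E : e1 * (F + 1) = rho by rewrite /e1 /rho; field; rewrite gt_eqF// ltr_wpDl.
have rhoE : rho * 2 = eps * (c - F) by rewrite /rho divfK.
clearbody rho e1.
have [N HN] := lln_lower mf f0 lo e10.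
exists N.+1 => m Nm d T P X Xiid.
have m0 : (0 < m)%N by exact: leq_trans Nm.
have m_gt0 : 0 < m%:R :> R by rewrite ltr0n.
pose S t := \sum_i f (X i t).
have mS : measurable_fun setT S.
  by apply: measurable_sum => i; apply: measurableT_comp => //; exact: Xiid.1.
have S0 t : 0 <= S t by rewrite sumr_ge0.
pose A := [set t | S t <= (F - rho) * m%:R].
pose B := [set t | c * m%:R < S t].
have mA : measurable A by exact: measurable_set_le.
have mB : measurable B.
  rewrite (_ : B = ~` [set t | S t <= c * m%:R]).
    by apply: measurableC; exact: measurable_set_le.
  by apply/seteqP; split => t /=; rewrite /B /= ltNge => /negP.
have PA := HN m (ltnW Nm) d T P X Xiid; rewrite -/(S _) -/A in PA.
rewrite -/B.
have PAf : P A = (fine (P A))%:E by rewrite fineK// fin_num_measure.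
have PBf : P B = (fine (P B))%:E by rewrite fineK// fin_num_measure.
have iS : (\int[P]_t (S t)%:E = (m%:R * F)%:E)%E.
  under eq_integral do rewrite -sumEFin.
  rewrite ge0_integral_sum//=; last 2 first.
  - move=> i; apply/measurable_EFinP; apply: measurableT_comp => //; exact: Xiid.1.
  - by move=> i t _; rewrite lee_fin.
  under eq_bigr do rewrite (integral_iid _ Xiid mf f0) FE.
  by rewrite sumEFin sumr_const card_ord mulr_natl.
have i1 (D : set T) (a : R) : measurable D -> 0 <= a ->
    (\int[P]_t (a * \1_D t)%:E = a%:E * P D)%E.
  move=> mD a0; under eq_integral do rewrite EFinM.
  rewrite ge0_integralZl_EFin//; first by rewrite integral_indic// setIT.
  by apply/measurable_EFinP; exact: measurable_indic.
have ic (a : R) : (\int[P]_t (cst a%:E t) = a%:E)%E.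
  by rewrite integral_cst//= [X in (_ * X)%E]probability_setT mule1.
have mI (D : set T) (a : R) : measurable D -> measurable_fun setT (fun t => (a * \1_D t)%:E).
  move=> mD; apply/measurable_EFinP; apply: measurable_funM => //; exact: measurable_indic.
have key : (\int[P]_t ((F * m%:R)%:E + ((c - F + rho) * m%:R * \1_B t)%:E)
    <= \int[P]_t (((S t)%:E + (F * m%:R * \1_A t)%:E) + (rho * m%:R)%:E))%E.
  apply: ge0_le_integral => //.
  - by move=> t _; rewrite -EFinD lee_fin addr_ge0// !mulr_ge0// addr_ge0 ?ltW.
  - by apply: emeasurable_funD => //; exact: mI.
  - apply: emeasurable_funD => //; apply: emeasurable_funD; last exact: mI.
    exact/measurable_EFinP.
  move=> t _; rewrite -!EFinD lee_fin !indicE.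
  have Ft : 0 <= F * m%:R by rewrite mulr_ge0.
  have -> : (t \in A) = (S t <= (F - rho) * m%:R).
    by apply/idP/idP => [/set_mem|St] //; exact/mem_set.
  have -> : (t \in B) = (c * m%:R < S t).
    by apply/idP/idP => [/set_mem|St] //; exact/mem_set.
  have rm : 0 < rho * m%:R by rewrite mulr_gt0.
  have cFm : 0 < (c - F) * m%:R by rewrite mulr_gt0.
  have := S0 t; case: (leP (S t) ((F - rho) * m%:R)); case: (ltP (c * m%:R) (S t));
    move: rm cFm; clear; rewrite /= ?mulr1 ?mulr0; lra.
move: key; rewrite ge0_integralD//; last 3 first.
- by move=> t _; rewrite lee_fin mulr_ge0.
- by move=> t _; rewrite lee_fin !mulr_ge0// addr_ge0 ?ltW.
- exact: mI.
rewrite ge0_integralD//; last 3 first.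
- by move=> t _; rewrite -!EFinD lee_fin !addr_ge0// !mulr_ge0// ltW.
- by apply: emeasurable_funD; [exact/measurable_EFinP|exact: mI].
- by move=> t _; rewrite lee_fin mulr_ge0// ltW.
rewrite ge0_integralD//; last 4 first.
- by move=> t _; rewrite lee_fin.
- exact/measurable_EFinP.
- by move=> t _; rewrite lee_fin !mulr_ge0.
- exact: mI.
have Fm0 : 0 <= F * m%:R by rewrite mulr_ge0.
have cm0 : 0 <= (c - F + rho) * m%:R by rewrite mulr_ge0// addr_ge0 ?ltW.
rewrite !ic iS !i1//.
rewrite PAf PBf -!EFinM -!EFinD !lee_fin.
have {}PA : fine (P A) <= e1 by rewrite -lee_fin -PAf.
have b0 : 0 <= fine (P B) by exact: fine_ge0.
move: (fine (P A)) (fine (P B)) PA b0 => a b ae b0 key.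
have : F * m%:R * a <= F * m%:R * e1 by rewrite ler_wpM2l// mulr_ge0.
move=> Fa.
have : (c - F + rho) * b <= F * e1 + rho.
  by rewrite -(ler_pM2r m_gt0); move: key Fa; clear; lra.
move=> cb; rewrite -(ler_pM2l cF0).
have rb : 0 <= rho * b by rewrite mulr_ge0// ltW.
by move: cb rb e1E rhoE e10; clear; lra.
Qed.

(** * Conditioning on the weights *)

Section Conditioning.
Context (R : realType) d (T : measurableType d) (P : probability T R).
Variables (m n : nat) (PX PY : probability R R).
Variables (X : 'I_m -> T -> R) (Y : 'I_n -> T -> R) (H : 'I_m -> 'I_n -> T -> bool).
Hypothesis model : rig_model PX PY P X Y H.
Local Notation cfg := {ffun 'I_m * 'I_n -> bool}.

Definition weight_rects : set (set T) :=
  [set E | exists (A : 'I_m -> set R) (B : 'I_n -> set R),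
    [/\ (forall i, measurable (A i)), (forall j, measurable (B j)) &
        E = [set t | (forall i, A i (X i t)) /\ (forall j, B j (Y j t))]]].

Let mX i : measurable_fun setT (X i). Proof. by case: model. Qed.
Let mY j : measurable_fun setT (Y j). Proof. by case: model. Qed.

Lemma measurable_weight_rect E : weight_rects E -> measurable E.
Proof.
move=> [A [B [mA mB ->]]].
apply: (measurableI [set t | forall i, A i (X i t)] [set t | forall j, B j (Y j t)]).
  apply: measurable_forall => i; rewrite -[X in measurable X]setTI.
  exact: mX.
apply: measurable_forall => j; rewrite -[X in measurable X]setTI.
exact: mY.
Qed.

Lemma measurable_sigma_weights E : <<s weight_rects >> E -> measurable E.
Proof.
apply: smallest_sub; first exact: sigma_algebra_measurable.
by move=> A; exact: measurable_weight_rect.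
Qed.

Lemma weight_rectsI : setI_closed weight_rects.
Proof.
move=> E F [A [B [mA mB ->]]] [A' [B' [mA' mB' ->]]].
exists (fun i => A i `&` A' i), (fun j => B j `&` B' j); split.
- by move=> i; exact: measurableI.
- by move=> j; exact: measurableI.
apply/seteqP; split=> t /=; first by move=> [[a b] [a' b']]; split=> k; split.
by move=> [a b]; split; split=> k; [case: (a k)|case: (b k)|case: (a k)|case: (b k)].
Qed.

Lemma weight_rectsT : weight_rects setT.
Proof.
exists (fun=> setT), (fun=> setT); split=> //.
by apply/seteqP; split.
Qed.

(** Weights are nonnegative only almost surely; off this event the [link_prob] may be negative and
    the weight of a configuration need not be a probability. *)
Definition nonneg_weights : set T :=
  [set t | (forall i, 0 <= X i t) /\ (forall j, 0 <= Y j t)].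

Lemma nonneg_weights_rect : weight_rects nonneg_weights.
Proof.
exists (fun=> [set x | 0 <= x]), (fun=> [set x | 0 <= x]); split=> //.
- by move=> i; exact: measurable_set_le.
- by move=> i; exact: measurable_set_le.
Qed.

Definition config t : cfg := [ffun e => H e.1 e.2 t].

Lemma measurable_config b : measurable [set t | config t = b].
Proof.
rewrite (_ : mkset _ = [set t | forall e : 'I_m * 'I_n, H e.1 e.2 t = b e]); last first.
  apply/seteqP; split => t /=; first by move=> <- e; rewrite ffunE.
  by move=> Hb; apply/ffunP => e; rewrite ffunE.
apply: (@measurable_forall _ _ _ (fun e => [set t | H e.1 e.2 t = b e])) => e.
have mH : measurable [set t | H e.1 e.2 t] by case: model.
case: (b e); first exact: mH.
rewrite (_ : [set t | _] = ~` [set t | H e.1 e.2 t]); first exact: measurableC.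
by apply/seteqP; split => t /= ; [move=> -> | move/negP/negbTE].
Qed.

Let mconfig := measurable_config.

Definition rig_link_prob t : 'I_m * 'I_n -> R :=
  link_prob (X ^~ t) (Y ^~ t) (Num.sqrt (m%:R * n%:R))^-1.

Let w b t := bern_weight (rig_link_prob t) b.

Let wE b t : w b t = \prod_(i < m) \prod_(j < n)
  (if b (i, j) then rig_prob (X ^~ t) (Y ^~ t) i j
   else 1 - rig_prob (X ^~ t) (Y ^~ t) i j).
Proof. by rewrite pair_bigA; apply: eq_bigr => -[i j] _. Qed.

Let w0 b t : nonneg_weights t -> 0 <= w b t.
Proof.
move=> [X0 Y0]; apply: bern_weight_ge0 => e; exact: link_prob01.
Qed.

Let mw b : measurable_fun setT (fun t => (w b t)%:E).
Proof.
apply/measurable_EFinP; apply: measurable_prod => e _.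
have mp : measurable_fun setT (fun t => rig_link_prob t e).
  apply: measurable_minr => //; apply: measurable_funM => //.
  exact: measurable_funM.
by case: (b e) => //; exact: measurable_funB.
Qed.

Let mN : measurable nonneg_weights.
Proof. exact: measurable_weight_rect nonneg_weights_rect. Qed.

(* The model prescribes the law of the links on rectangles of weights only. *)
Lemma config_law b E : <<s weight_rects >> E ->
  P (E `&` nonneg_weights `&` [set t | config t = b]) =
  (\int[P]_(t in E `&` nonneg_weights) (w b t)%:E)%E.
Proof.
pose C : set (set T) := fun E => P (E `&` nonneg_weights `&` [set t | config t = b]) =
  (\int[P]_(t in E `&` nonneg_weights) (w b t)%:E)%E.
have Crect : weight_rects `<=` C.
  move=> F rF; have := weight_rectsI rF nonneg_weights_rect.
  rewrite /C => -[A [B [mA mB FE]]]; rewrite FE.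
  have [_ _ _ _ /(_ A B mA mB (fun i j => b (i, j)))] := model.
  under eq_integral do rewrite -wE.
  move=> <-; congr (P _); apply/seteqP; split => t /=.
    move=> [[At Bt] Ht]; split=> //; split=> // i j.
    by rewrite -Ht ffunE.
  move=> [At [Bt Ht]]; split=> //; apply/ffunP => -[i j]; rewrite ffunE.
  exact: Ht.
have CC (S : set T) : measurable S -> C S -> C (~` S).
  move=> mS CS; rewrite /C.
  have CT := Crect _ weight_rectsT; rewrite /C !setTI in CT.
  have mSN : measurable (S `&` nonneg_weights) by exact: measurableI.
  have mSCN : measurable (~` S `&` nonneg_weights) by exact: (measurableI _ _ (measurableC mS) mN).
  have NE : nonneg_weights = (S `&` nonneg_weights) `|` (~` S `&` nonneg_weights).
    by rewrite -setIUl setUv setTI.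
  have dis : (S `&` nonneg_weights) `&` (~` S `&` nonneg_weights) = set0.
    by rewrite setIACA setICr set0I.
  have := CT; rewrite [in LHS]NE setIUl measureU; last 3 first.
  + exact: measurableI.
  + exact: measurableI.
  + by rewrite setIACA dis set0I.
  rewrite [in RHS]NE ge0_integral_setU//; last 3 first.
  + apply: measurable_funS (mw b) => //.
  + by rewrite -NE => t Nt; rewrite lee_fin w0.
  + by apply/disj_setPS; rewrite dis.
  rewrite -CS; set p := P (S `&` _ `&` _) => eqp.
  have pfin : p \is a fin_num by apply: fin_num_measure; exact: measurableI.
  by rewrite -[LHS](addeK _ pfin) [X in (X - _)%E]addeC eqp [X in (X - _)%E]addeC addeK.
have CU (F : (set T)^nat) : (forall k, measurable (F k)) -> trivIset setT F ->
    (forall k, C (F k)) -> C (\bigcup_k F k).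
  move=> mF tF CF; rewrite /C !setI_bigcupl.
  rewrite measure_semi_bigcup; last 3 first.
  + by move=> k; apply: measurableI => //; exact: measurableI.
  + by do 2 apply: trivIset_setIr.
  + by apply: bigcupT_measurable => k; apply: measurableI => //; exact: measurableI.
  rewrite ge0_integral_bigcup//; last 4 first.
  + by move=> k; exact: measurableI.
  + exact: measurable_funS (mw b).
  + by move=> t [k _ [_ Nt]]; rewrite lee_fin w0.
  + exact: trivIset_setIr.
  by apply: eq_eseriesr => k _; exact: CF.
apply: (@dynkin_induction _ (g_sigma_algebraType weight_rects) weight_rects C) => //.
- exact: weight_rectsI.
- exact: Crect weight_rectsT.
- by move=> S /measurable_sigma_weights mS; exact: CC.
- by move=> F mF; apply: CU => k; exact: measurable_sigma_weights (mF k).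
Qed.

(** The bad event involves links and weights together. For each fixed configuration [b] it becomes
    an event [bad b] of the weights, to which [config_law] applies; summing over [b] under the
    integral gives the conditional probability, at most [eta] on [G]. *)
Lemma conditional_bound (G S : set T) (bad : cfg -> set T) (eta : R) :
  0 <= eta -> <<s weight_rects >> G -> (forall b, <<s weight_rects >> (bad b)) ->
  G `<=` nonneg_weights ->
  (forall t, G t -> bern_prob (rig_link_prob t) (fun b => `[< bad b t >]) <= eta) ->
  measurable S -> (forall t, S t -> bad (config t) t) ->
  (P (S `&` G) <= eta%:E)%E.
Proof.
move=> eta0 sG sbad GN Gbad mS Sbad.
have mG := measurable_sigma_weights sG.
have mbad b := measurable_sigma_weights (sbad b).
have sI b : <<s weight_rects >> (bad b `&` G).
  exact: (@measurableI _ (g_sigma_algebraType weight_rects) _ _ (sbad b) sG).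
apply: (@le_trans _ _ (\sum_b P (bad b `&` G `&` nonneg_weights `&` [set t | config t = b]))%E).
  apply: (@measure_sub_fintype _ _ _ _ _ xpredT) => //.
  - exact: measurableI.
  - move=> b; apply: measurableI => //; apply: measurableI => //; exact: measurableI.
  - move=> t [St Gt]; exists (config t) => //.
    by split; [split; [split; [exact: Sbad|]|exact: GN]|].
have step b : P (bad b `&` G `&` nonneg_weights `&` [set t | config t = b]) =
    (\int[P]_(t in G) ((fun t => (w b t)%:E) \_ (bad b)) t)%E.
  rewrite config_law// -integral_mkcondr; congr (integral _ _ _).
  apply/seteqP; split => t /=; first by move=> [[bt Gt] _].
  by move=> [Gt bt]; split; [split|exact: GN].
under eq_bigr do rewrite step.
rewrite -ge0_integral_sum//; last 2 first.
- move=> b; apply: measurable_funTS; apply/(measurable_restrictT _ _).1 => //.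
  exact: measurable_funTS.
- by move=> b t Gt; rewrite patchE; case: ifP => // _; rewrite lee_fin w0//; exact: GN.
apply: (@le_trans _ _ (\int[P]_(t in G) (cst eta%:E t))%E); last first.
  rewrite integral_cst//; apply: (@le_trans _ _ (eta%:E * 1)%E); last by rewrite mule1.
  by apply: lee_wpmul2l; rewrite ?lee_fin ?probability_le1.
apply: ge0_le_integral => //.
- move=> t Gt; apply: sume_ge0 => b _; rewrite patchE; case: ifP => // _.
  by rewrite lee_fin w0//; exact: GN.
- apply: emeasurable_sum => b; apply: measurable_funTS.
  apply/(measurable_restrictT _ _).1 => //; exact: measurable_funTS.
- move=> t Gt; apply: le_trans (_ : ((bern_prob (rig_link_prob t) (fun b => `[< bad b t >]))%:E <= _)%E); last first.
    by rewrite lee_fin; exact: Gbad.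
  rewrite /bern_prob /bern_exp -sumEFin; apply: lee_sum => b _.
  rewrite patchE; case: ifPn => [/set_mem bt|_].
    by rewrite (asboolT bt) mulr1.
  by rewrite lee_fin mulr_ge0// w0//; exact: GN.
Qed.

End Conditioning.

(** * Typical weights *)

(** Obtained from the measurable power functions on the nonnegative half line and extended by
    oddness; at 0 both conventions give 0. *)
Lemma measurable_fun_inv (R : realType) : measurable_fun setT (@GRing.inv R).
Proof.
rewrite (_ : GRing.inv = fun x : R =>
  if 0 <= x then x `^ (-1) else - ((- x) `^ (-1))); last first.
  apply/funext => x; case: leP => x0; first by rewrite powR_inv1.
  by rewrite powR_inv1 ?oppr_ge0 ?ltW// invrN opprK.
apply: measurable_fun_ifT => //=.
- exact: measurable_fun_ler.
- apply: measurable_funN.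
  by apply: (measurableT_comp (measurable_powR _)); exact: measurable_funN.
Qed.

(** * Truncated moments of the weight distributions *)

Section PositivePart.
Variables (R : realType) (PX : probability R R).
Hypothesis PX0 : PX [set x | x < 0] = 0%E.

(** The laws of large numbers ask for functions that are nonnegative everywhere; composing with the
    positive part provides this and leaves the integrals unchanged. *)
Definition pos_part (x : R) : R := Num.max x 0.

Lemma pos_part_ge0 x : 0 <= pos_part x.
Proof. by rewrite le_max lexx orbT. Qed.

Lemma pos_part_id x : 0 <= x -> pos_part x = x.
Proof. exact: max_idPl. Qed.

Lemma measurable_pos_part : measurable_fun setT pos_part.
Proof. exact: measurable_maxr. Qed.

Lemma integral_pos_part (f : R -> R) : measurable_fun setT f ->
  (\int[PX]_x (f x)%:E = \int[PX]_x (f (pos_part x))%:E)%E.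
Proof.
move=> mf; apply: ae_eq_integral => //.
- exact/measurable_EFinP.
- by apply/measurable_EFinP; apply: measurableT_comp => //; exact: measurable_pos_part.
exists [set x | x < 0]; split=> //.
  rewrite (_ : [set x | _] = ~` [set x : R | 0 <= x]).
    by apply: measurableC; exact: measurable_set_le.
  by apply/seteqP; split => x /=; rewrite ltNge => /negP.
move=> x /= nx; rewrite ltNge; apply/negP => x0; apply: nx => _.
by rewrite pos_part_id.
Qed.

Definition below (M : R) (f : R -> R) (x : R) : R := if x <= M then f x else 0.
Definition above (M : R) (f : R -> R) (x : R) : R := if x <= M then 0 else f x.

Lemma measurable_below M f : measurable_fun setT f -> measurable_fun setT (below M f).
Proof. by move=> mf; apply: measurable_fun_ifT => //; exact: measurable_fun_ler. Qed.

Lemma measurable_above M f : measurable_fun setT f -> measurable_fun setT (above M f).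
Proof. by move=> mf; apply: measurable_fun_ifT => //; exact: measurable_fun_ler. Qed.

Lemma below_ge0 M (f : R -> R) x : (forall x, 0 <= f x) -> 0 <= below M f x.
Proof. by rewrite /below; case: ifP. Qed.

Lemma above_ge0 M (f : R -> R) x : (forall x, 0 <= f x) -> 0 <= above M f x.
Proof. by rewrite /above; case: ifP. Qed.

(** Monotone convergence along integer cutoffs. The conclusion covers all larger cutoffs so that a
    common one can be taken for X and Y. *)
Lemma truncation_gt (f : R -> R) (c : R) : measurable_fun setT f -> (forall x, 0 <= f x) ->
  (c%:E < \int[PX]_x (f x)%:E)%E ->
  exists M0 : R, 0 < M0 /\ forall M, M0 <= M -> (c%:E < \int[PX]_x (below M f x)%:E)%E.
Proof.
move=> mf f0 cf.
pose g k x := (below k%:R f x)%:E.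
have mg k : measurable_fun setT (g k) by apply/measurable_EFinP; exact: measurable_below.
have g0 k x : setT x -> (0 <= g k x)%E by move=> _; rewrite lee_fin below_ge0.
have below_le a b x : a <= b -> below a f x <= below b f x.
  move=> ab; rewrite /below; case: ifP => xa; last by case: ifP.
  by rewrite (le_trans xa ab).
have nd x : setT x -> {homo g^~ x : a b / (a <= b)%N >-> (a <= b)%E}.
  by move=> _ a b ab; rewrite lee_fin below_le// ler_nat.
have := cvg_monotone_convergence measurableT mg g0 nd.
have -> : (fun x => limn (g^~ x)) = (fun x => (f x)%:E).
  apply/funext => x; apply/cvg_lim => //.
  apply: cvg_near_cst; exists (Num.bound `|x|) => // k /= xk.
  rewrite /g /below; case: leP => // kx.
  have : `|x| < k%:R.
    by apply: lt_le_trans (archi_boundP (normr_ge0 x)) _; rewrite ler_nat.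
  by move=> /(le_lt_trans (ler_norm x)) /(lt_trans kx); rewrite ltxx.
move=> cv.
have [k _ Hk] := cv PX _ (open_ereal_gt' cf).
exists (k.+1)%:R; split=> // M kM.
apply: lt_le_trans (Hk k (leqnn k)) _; apply: ge0_le_integral => //.
- by move=> x _; rewrite lee_fin below_ge0.
- by apply/measurable_EFinP; exact: measurable_below.
- move=> x _; rewrite lee_fin below_le//; apply: le_trans kM.
  by rewrite ler_nat.
Qed.

Lemma tail_lt (f : R -> R) (eta : R) : measurable_fun setT f -> (forall x, 0 <= f x) ->
  (\int[PX]_x (f x)%:E < +oo)%E -> 0 < eta ->
  exists M : R, 0 < M /\ (\int[PX]_x (above M f x)%:E < eta%:E)%E.
Proof.
move=> mf f0 foo eta0.
have ffin : (\int[PX]_x (f x)%:E)%E \is a fin_num.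
  by rewrite ge0_fin_numE//; apply: integral_ge0 => x _; rewrite lee_fin.
have : ((fine (\int[PX]_x (f x)%:E) - eta)%:E < \int[PX]_x (f x)%:E)%E.
  by rewrite -[ltRHS]fineK// lte_fin gtrBl.
move=> /(truncation_gt mf f0)[M [M0 /(_ _ (lexx M)) HM]].
exists M; split=> //.
have E : (\int[PX]_x (f x)%:E = \int[PX]_x (below M f x)%:E + \int[PX]_x (above M f x)%:E)%E.
  rewrite -ge0_integralD//.
  - by apply: eq_integral => x _; rewrite -EFinD /below /above; case: ifP; rewrite ?addr0 ?add0r.
  - by move=> x _; rewrite lee_fin below_ge0.
  - by apply/measurable_EFinP; exact: measurable_below.
  - by move=> x _; rewrite lee_fin above_ge0.
  - by apply/measurable_EFinP; exact: measurable_above.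
have b0 : (0 <= \int[PX]_x (below M f x)%:E)%E by apply: integral_ge0 => x _; rewrite lee_fin below_ge0.
have a0 : (0 <= \int[PX]_x (above M f x)%:E)%E by apply: integral_ge0 => x _; rewrite lee_fin above_ge0.
move: E HM b0 a0 ffin.
set a := (\int[PX]_x (above M f x)%:E)%E; set b := (\int[PX]_x (below M f x)%:E)%E.
move=> ->; case: a => [a| |]; case: b => [b| |] //=; rewrite ?lte_fin => + _ _ _; lra.
Qed.

(** Below a cutoff M the higher power is at most M times the lower one. Were the lower moment 0,
    every truncated higher moment would vanish, against its divergence. *)
Lemma integral_pow_gt0 (p : nat) :
  (\int[PX]_x (x ^+ p.+1)%:E < +oo)%E -> (\int[PX]_x (x ^+ p.+2)%:E = +oo)%E ->
  0 < fine (\int[PX]_x (x ^+ p.+1)%:E)%E.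
Proof.
move=> fino infty.
have mX k : measurable_fun setT (fun x : R => x ^+ k) by exact: measurable_funX.
have mXp k : measurable_fun setT (fun x : R => pos_part x ^+ k).
  by apply: measurable_funX; exact: measurable_pos_part.
rewrite (integral_pos_part (mX _)) in fino *.
rewrite (integral_pos_part (mX _)) in infty.
have p0 k x : 0 <= pos_part x ^+ k by rewrite exprn_ge0// pos_part_ge0.
have : (1%:E < \int[PX]_x (pos_part x ^+ p.+2)%:E)%E by rewrite infty ltry.
move=> /(truncation_gt (mXp _) (p0 _))[M [M0 /(_ _ (lexx M)) HM]].
have i0 : (0 <= \int[PX]_x (pos_part x ^+ p.+1)%:E)%E.
  by apply: integral_ge0 => x _; rewrite lee_fin.
apply: fine_gt0; rewrite fino andbT lt_neqAle i0 andbT; apply/eqP => E0.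
move: HM; apply/negP; rewrite -leNgt.
apply: (@le_trans _ _ (\int[PX]_x (M%:E * (pos_part x ^+ p.+1)%:E))%E).
  apply: ge0_le_integral => //.
  - by move=> x _; rewrite lee_fin below_ge0.
  - by apply/measurable_EFinP; exact: measurable_below.
  - by apply/measurable_EFinP; exact: measurable_funM.
  - move=> x _; rewrite -EFinM lee_fin /below.
    case: (leP x M) => xM; last by rewrite mulr_ge0// ltW.
    by rewrite exprS ler_wpM2r// ge_max xM ltW.
rewrite ge0_integralZl_EFin//; last 3 first.
- by move=> x _; rewrite lee_fin.
- by apply/measurable_EFinP.
- exact: ltW.
by rewrite -E0 mule0 lee_fin.
Qed.

End PositivePart.

Record bounds (R : realType) := Bounds {
  sqX_up : R; sqX_low : R; Y_up : R; Y_low : R;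
  cubeX_low : R; sqY_low : R; cutoff : R; tail_cutoff : R; tailY_up : R }.

Section Typical.
Variables (R : realType) (B : bounds R).

(** Each of the seven clauses is the complement of an exceptional event of a law of large numbers.
    The last one is there to bound the largest vertex weight. *)
Definition typical_weights m n (x : 'I_m -> R) (y : 'I_n -> R) : Prop :=
  ([/\ \sum_i pos_part (x i) ^+ 2 <= sqX_up B * m%:R,
       sqX_low B * m%:R < \sum_i below (cutoff B) (fun u => pos_part u ^+ 2) (x i) &
       cubeX_low B * m%:R < \sum_i pos_part (x i) ^+ 3] /\
   [/\ \sum_j pos_part (y j) <= Y_up B * n%:R,
       Y_low B * n%:R < \sum_j below (cutoff B) (@pos_part R) (y j),
       sqY_low B * n%:R < \sum_j pos_part (y j) ^+ 2 &
       \sum_j above (tail_cutoff B) (@pos_part R) (y j) <= tailY_up B * n%:R]).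

Lemma measurable_sum_le d (T : measurableType d) k (Z : 'I_k -> T -> R) (f : R -> R) c :
  (forall i, measurable_fun setT (Z i)) -> measurable_fun setT f ->
  measurable [set t | \sum_i f (Z i t) <= c].
Proof.
move=> mZ mf; apply: measurable_set_le => //.
by apply: measurable_sum => i; exact: measurableT_comp.
Qed.

Lemma measurable_sum_gt d (T : measurableType d) k (Z : 'I_k -> T -> R) (f : R -> R) c :
  (forall i, measurable_fun setT (Z i)) -> measurable_fun setT f ->
  measurable [set t | c < \sum_i f (Z i t)].
Proof.
move=> mZ mf; rewrite (_ : mkset _ = ~` [set t | \sum_i f (Z i t) <= c]).
  by apply: measurableC; exact: measurable_sum_le.
by apply/seteqP; split => t /=; rewrite ltNge => /negP.
Qed.

Lemma measurable_pos_partX k : measurable_fun setT (fun u : R => pos_part u ^+ k).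
Proof. by apply: measurable_funX; exact: measurable_pos_part. Qed.

Lemma measurable_typical d (T : measurableType d) m n
    (X : 'I_m -> T -> R) (Y : 'I_n -> T -> R) :
  (forall i, measurable_fun setT (X i)) -> (forall j, measurable_fun setT (Y j)) ->
  measurable [set t | typical_weights (X ^~ t) (Y ^~ t)].
Proof.
move=> mX mY.
have mp := @measurable_pos_part R; have mpX := measurable_pos_partX.
apply: (measurableI [set t | [/\ _, _ & _]] [set t | [/\ _, _, _ & _]]).
- rewrite (_ : mkset _ =
    [set t | \sum_i pos_part (X i t) ^+ 2 <= sqX_up B * m%:R] `&`
    [set t | sqX_low B * m%:R < \sum_i below (cutoff B) (fun u => pos_part u ^+ 2) (X i t)] `&`
    [set t | cubeX_low B * m%:R < \sum_i pos_part (X i t) ^+ 3]); last first.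
    by apply/seteqP; split => t /= [] => [? ? ?|[? ?] ?]; split.
  apply: measurableI; first apply: measurableI.
  + exact: (measurable_sum_le _ mX (mpX 2)).
  + exact: (measurable_sum_gt _ mX (measurable_below _ (mpX 2))).
  + exact: (measurable_sum_gt _ mX (mpX 3)).
- rewrite (_ : mkset _ =
    [set t | \sum_j pos_part (Y j t) <= Y_up B * n%:R] `&`
    [set t | Y_low B * n%:R < \sum_j below (cutoff B) (@pos_part R) (Y j t)] `&`
    [set t | sqY_low B * n%:R < \sum_j pos_part (Y j t) ^+ 2] `&`
    [set t | \sum_j above (tail_cutoff B) (@pos_part R) (Y j t) <= tailY_up B * n%:R]); last first.
    by apply/seteqP; split => t /= [] => [? ? ? ?|[[? ?] ?] ?]; split.
  apply: measurableI; first apply: measurableI; first apply: measurableI.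
  + exact: (measurable_sum_le _ mY mp).
  + exact: (measurable_sum_gt _ mY (measurable_below _ mp)).
  + exact: (measurable_sum_gt _ mY (mpX 2)).
  + exact: (measurable_sum_le _ mY (measurable_above _ mp)).
Qed.

Definition limit_ratio m n (kappa : R) (x : 'I_m -> R) (y : 'I_n -> R) : R :=
  (1 + kappa * (\sum_j y j ^+ 2) / (\sum_i x i ^+ 3))^-1.

Lemma measurable_dev d (T : measurableType d) m n
    (X : 'I_m -> T -> R) (Y : 'I_n -> T -> R) (kappa eps v : R) :
  (forall i, measurable_fun setT (X i)) -> (forall j, measurable_fun setT (Y j)) ->
  measurable [set t | eps < `|v - limit_ratio kappa (X ^~ t) (Y ^~ t)|].
Proof.
move=> mX mY.
rewrite (_ : mkset _ = ~` [set t | `|v - limit_ratio kappa (X ^~ t) (Y ^~ t)| <= eps]); last first.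
  by apply/seteqP; split => t /=; rewrite ltNge => /negP.
apply: measurableC; apply: measurable_set_le => //.
apply: measurableT_comp => //; apply: measurable_funB => //.
have minv := @measurable_fun_inv R.
apply: (measurableT_comp minv); apply: measurable_funD => //.
apply: measurable_funM.
  apply: measurable_funM => //; apply: measurable_sum => j.
  exact: measurable_funX.
apply: (measurableT_comp minv); apply: measurable_sum => i.
exact: measurable_funX.
Qed.

End Typical.

(** * Union bound over atypical weights *)

Section Model.
Context (R : realType) d (T : measurableType d) (P : probability T R).
Variables (m n : nat) (PX PY : probability R R).
Variables (X : 'I_m -> T -> R) (Y : 'I_n -> T -> R) (H : 'I_m -> 'I_n -> T -> bool).
Hypothesis model : rig_model PX PY P X Y H.
Hypotheses (PX0 : PX [set x | x < 0] = 0%E) (PY0 : PY [set x | x < 0] = 0%E).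

Lemma model_iidX : iid_sample P PX X.
Proof.
have [mX _ _ rect _] := model; split=> // A mA.
have := rect A (fun=> setT) mA (fun=> measurableT).
rewrite [X in (_ * X)%R]big1 ?mulr1; last by move=> j _; rewrite probability_setT.
by move=> <-; congr (P _); apply/seteqP; split => t /=; [split|case].
Qed.

Lemma model_iidY : iid_sample P PY Y.
Proof.
have [_ mY _ rect _] := model; split=> // A mA.
have := rect (fun=> setT) A (fun=> measurableT) mA.
rewrite big1 ?mul1r; last by move=> j _; rewrite probability_setT.
by move=> <-; congr (P _); apply/seteqP; split => t /=; [split|case].
Qed.

Lemma prob_nonneg_half (Q : probability R R) :
  Q [set x | x < 0] = 0%E -> fine (Q [set x | 0 <= x]) = 1.
Proof.
move=> Q0.
have m0 : measurable [set x : R | 0 <= x] by exact: measurable_set_le.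
have := probability_setC Q m0.
rewrite (_ : ~` _ = [set x : R | x < 0]).
  rewrite Q0; have : Q [set x | 0 <= x] \is a fin_num by exact: fin_num_measure.
  by case: (Q _) => //= r _ [] /eqP; rewrite eq_sym subr_eq0 => /eqP <-.
by apply/seteqP; split => x /=; rewrite ltNge => /negP.
Qed.

Lemma prob_nonneg_weights : P (~` nonneg_weights X Y) = 0%E.
Proof.
have [mX mY _ rect _] := model.
have mN : measurable (nonneg_weights X Y).
  exact: (measurable_weight_rect model (nonneg_weights_rect X Y)).
rewrite probability_setC// (rect (fun=> [set x | 0 <= x]) (fun=> [set x | 0 <= x]))//.
- rewrite !big1 ?mulr1 ?subee// => *; exact: prob_nonneg_half.
- by move=> i; exact: measurable_set_le.
- by move=> i; exact: measurable_set_le.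
Qed.

Local Notation G := (g_sigma_algebraType (weight_rects X Y)).

(** Measurability holds already for the sigma-algebra generated by the weights. The measurability
    lemmas, generic in the space, then place typical and bad events in the domain of
    [config_law]. *)
Lemma measurable_weightX i : measurable_fun setT (X i : G -> R).
Proof.
move=> _ A mA; rewrite setTI; apply: sub_sigma_algebra.
exists (fun k => if k == i then A else setT), (fun=> setT); split=> //.
  by move=> k; case: ifP.
apply/seteqP; split=> t /= => [Xt|[/(_ i)]]; last by rewrite eqxx.
by split=> // k; case: eqP => // ->.
Qed.

Lemma measurable_weightY j : measurable_fun setT (Y j : G -> R).
Proof.
move=> _ A mA; rewrite setTI; apply: sub_sigma_algebra.
exists (fun=> setT), (fun k => if k == j then A else setT); split=> //.
  by move=> k; case: ifP.
apply/seteqP; split=> t /= => [Yt|[_ /(_ j)]]; last by rewrite eqxx.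
by split=> // k; case: eqP => // ->.
Qed.

Variables (B : bounds R) (kappa eps eta e1 : R).
Hypotheses (eta0 : 0 <= eta).
Local Notation q := (Num.sqrt (m%:R * n%:R : R))^-1.
Local Notation pp := (@pos_part R).
Local Notation pp2 := (fun u => pos_part u ^+ 2).
Local Notation pp3 := (fun u => pos_part u ^+ 3).

Hypothesis deterministic : forall (x : 'I_m -> R) (y : 'I_n -> R),
  (forall i, 0 <= x i) -> (forall j, 0 <= y j) -> typical_weights B x y ->
  bern_prob (link_prob x y q) (fun b =>
    eps < `|rig_clustering (fun i j => b (i, j)) R - limit_ratio kappa x y|) <= eta.

Hypotheses
  (h1 : (P [set t | (sqX_up B * m%:R < \sum_i pp2 (X i t))%R] <= e1%:E)%E)
  (h2 : (P [set t | (\sum_i below (cutoff B) pp2 (X i t) <= sqX_low B * m%:R)%R] <= e1%:E)%E)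
  (h3 : (P [set t | (\sum_i pp3 (X i t) <= cubeX_low B * m%:R)%R] <= e1%:E)%E)
  (h4 : (P [set t | (Y_up B * n%:R < \sum_j pp (Y j t))%R] <= e1%:E)%E)
  (h5 : (P [set t | (\sum_j below (cutoff B) pp (Y j t) <= Y_low B * n%:R)%R] <= e1%:E)%E)
  (h6 : (P [set t | (\sum_j pp2 (Y j t) <= sqY_low B * n%:R)%R] <= e1%:E)%E)
  (h7 : (P [set t | (tailY_up B * n%:R < \sum_j above (tail_cutoff B) pp (Y j t))%R] <= e1%:E)%E).

Let bad t := eps < `| rig_clustering (fun i j => H i j t) R
                      - limit_ratio kappa (X ^~ t) (Y ^~ t) |.
Let badcfg (b : {ffun 'I_m * 'I_n -> bool}) : set T :=
  [set t | eps < `| rig_clustering (fun i j => b (i, j)) R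
                    - limit_ratio kappa (X ^~ t) (Y ^~ t) |].

Let configE t : (fun i j => config H t (i, j)) = (fun i j => H i j t).
Proof. by apply/funext => i; apply/funext => j; rewrite ffunE. Qed.

Lemma measurable_bad : measurable [set t | bad t].
Proof.
have [mX mY _ _ _] := model.
rewrite (_ : mkset _ = \bigcup_(b in [set: {ffun 'I_m * 'I_n -> bool}])
    ([set t | config H t = b] `&` badcfg b)); last first.
  apply/seteqP; split => t /=.
    by move=> bt; exists (config H t) => //; split=> //; rewrite /badcfg /= configE.
  by move=> [b _ [<-]]; rewrite /badcfg /= configE.
apply: fin_bigcup_measurable; first exact: finite_finset.
move=> b _; apply: measurableI; first exact: (measurable_config model).
exact: measurable_dev.
Qed.

Lemma prob_bad_le : (P [set t | bad t] <= (eta + 7 * e1)%:E)%E.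
Proof.
have [mX mY _ _ _] := model.
have mp := @measurable_pos_part R; have mpX := @measurable_pos_partX R.
have mbad := measurable_bad.
pose N := nonneg_weights X Y; pose K := [set t | typical_weights B (X ^~ t) (Y ^~ t)].
have sN : <<s weight_rects X Y >> N.
  by apply: sub_sigma_algebra; exact: nonneg_weights_rect.
have sK : <<s weight_rects X Y >> K.
  exact: (@measurable_typical _ B _ G _ _ _ _ measurable_weightX measurable_weightY).
have sNK : <<s weight_rects X Y >> (N `&` K).
  exact: (@measurableI _ G _ _ sN sK).
have mN : measurable N := measurable_sigma_weights model sN.
have mK : measurable K := measurable_sigma_weights model sK.
have PNK : (P ([set t | bad t] `&` (N `&` K)) <= eta%:E)%E.
  apply: (conditional_bound model (bad := badcfg)) => //.
  - move=> b; exact: (@measurable_dev _ _ G _ _ _ _ _ _ _ measurable_weightX measurable_weightY).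
  - move=> t [[X0 Y0] Kt].
    rewrite (_ : bern_prob _ _ = bern_prob (link_prob (X ^~ t) (Y ^~ t) q) (fun b =>
      eps < `|rig_clustering (fun i j => b (i, j)) R - limit_ratio kappa (X ^~ t) (Y ^~ t)|)).
      exact: deterministic.
    by apply: eq_bern_exp => b; rewrite /badcfg /= asboolb.
  - by move=> t bt; rewrite /badcfg /= configE.
pose F (k : 'I_9) : set T := nth set0 [:: [set t | bad t] `&` (N `&` K); ~` N;
  [set t | sqX_up B * m%:R < \sum_i pp2 (X i t)];
  [set t | \sum_i below (cutoff B) pp2 (X i t) <= sqX_low B * m%:R];
  [set t | \sum_i pp3 (X i t) <= cubeX_low B * m%:R];
  [set t | Y_up B * n%:R < \sum_j pp (Y j t)];
  [set t | \sum_j below (cutoff B) pp (Y j t) <= Y_low B * n%:R];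
  [set t | \sum_j pp2 (Y j t) <= sqY_low B * n%:R];
  [set t | tailY_up B * n%:R < \sum_j above (tail_cutoff B) pp (Y j t)]] k.
have mF k : measurable (F k).
  case: k => -[|[|[|[|[|[|[|[|[|//]]]]]]]]] k9; rewrite /F /=.
  - by apply: measurableI => //; exact: measurableI.
  - exact: measurableC.
  - exact: (measurable_sum_gt _ mX (mpX 2)).
  - exact: (measurable_sum_le _ mX (measurable_below _ (mpX 2))).
  - exact: (measurable_sum_le _ mX (mpX 3)).
  - exact: (measurable_sum_gt _ mY mp).
  - exact: (measurable_sum_le _ mY (measurable_below _ mp)).
  - exact: (measurable_sum_le _ mY (mpX 2)).
  - exact: (measurable_sum_gt _ mY (measurable_above _ mp)).
apply: (@le_trans _ _ (\sum_k P (F k))%E).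
  apply: (@measure_sub_fintype _ _ _ _ _ xpredT) => // t bt.
  apply: contrapT => nF.
  have nFk k (k9 : (k < 9)%N) : ~ F (Ordinal k9) t by move=> Fk; apply: nF; exists (Ordinal k9).
  have Nt : N t by apply: contrapT => ?; exact: (nFk 1%N isT).
  apply: (nFk 0%N isT); split=> //; split=> //; split; split.
  - by rewrite leNgt; apply/negP => ?; exact: (nFk 2%N isT).
  - by rewrite ltNge; apply/negP => ?; exact: (nFk 3%N isT).
  - by rewrite ltNge; apply/negP => ?; exact: (nFk 4%N isT).
  - by rewrite leNgt; apply/negP => ?; exact: (nFk 5%N isT).
  - by rewrite ltNge; apply/negP => ?; exact: (nFk 6%N isT).
  - by rewrite ltNge; apply/negP => ?; exact: (nFk 7%N isT).
  - by rewrite leNgt; apply/negP => ?; exact: (nFk 8%N isT).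
rewrite !big_ord_recl big_ord0 /F /= prob_nonneg_weights adde0 add0e.
rewrite (_ : eta + 7 * e1 = eta + (e1 + (e1 + (e1 + (e1 + (e1 + (e1 + e1))))))); last by ring.
by rewrite !EFinD; do 6 apply: leeD => //; exact: leeD.
Qed.

End Model.

(* [sb] stands for sqrt beta. *)
Definition rig_bounds (R : realType) (a2 b1 sb r zeta M M' : R) : bounds R :=
  Bounds ((1 + r) * a2) ((1 - r) * a2) ((1 + r) * b1) ((1 - r) * b1)
    (2 / (zeta * sb)) (2 * sb / zeta) M M' (zeta * sb / 2).

(** Passes from sums normalized by [m] or [n] to sums multiplied by [q]. Two factors within [1 - r]
    and [1 + r] are involved, and their product stays within [1 - 3 r] and [1 + 3 r]. *)
Lemma typical_deviation (R : realType) (a2 b1 sb eps r C zeta M M' kappa : R) (m n : nat) :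
  let f := a2 * sb in let g := b1 / sb in
  let q := (Num.sqrt (m%:R * n%:R))^-1 in
  0 < a2 -> 0 < b1 -> 0 < sb -> 0 < r -> r <= 3^-1 -> 0 < zeta ->
  (forall (m n : nat) (x : 'I_m -> R) (y : 'I_n -> R) (q M : R),
    (forall i, 0 <= x i) -> (forall j, 0 <= y j) -> 0 < q -> q <= zeta ->
    M <= C -> m%:R * q <= C ->
    (\sum_i x i ^+ 2) * q <= C -> (\sum_j y j) * q <= C ->
    (forall j, y j * q <= zeta) ->
    1 <= zeta * (q * \sum_i x i ^+ 3) -> 1 <= zeta * (q * \sum_j y j ^+ 2) ->
    (\sum_i x i ^+ 2) * q <= (1 + 3 * r) * f ->
    (1 - 3 * r) * f <= (\sum_(i | x i <= M) x i ^+ 2) * q ->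
    (\sum_j y j) * q <= (1 + 3 * r) * g ->
    (1 - 3 * r) * g <= (\sum_(j | y j <= M) y j) * q ->
    bern_prob (link_prob x y q) (fun b =>
      eps < `|rig_clustering (fun i j => b (i, j)) R
       - (1 + f ^+ 2 / g * (\sum_j y j ^+ 2) / (\sum_i x i ^+ 3))^-1|) <= eps) ->
  kappa = f ^+ 2 / g ->
  M <= C -> 2 * sb <= C -> 2 * f <= C -> 2 * g <= C ->
  0 < q -> q <= zeta -> M' <= zeta * sb / 2 * n%:R ->
  (1 - r) * sb <= m%:R * q <= (1 + r) * sb ->
  (1 - r) / sb <= n%:R * q <= (1 + r) / sb ->
  forall (x : 'I_m -> R) (y : 'I_n -> R),
  (forall i, 0 <= x i) -> (forall j, 0 <= y j) ->
  typical_weights (rig_bounds a2 b1 sb r zeta M M') x y ->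
  bern_prob (link_prob x y q) (fun b =>
    eps < `|rig_clustering (fun i j => b (i, j)) R - limit_ratio kappa x y|) <= eps.
Proof.
move=> f g q a20 b10 sb0 r0 r3 z0 conc -> MC sbC fC gC q0 qz M'n.
move=> /andP[mq1 mq2] /andP[nq1 nq2] x y x0 y0.
have f0 : 0 < f by rewrite mulr_gt0.
have g0 : 0 < g by rewrite divr_gt0.
move=> [[/= X1 X2 X3] [Y1 Y2 Y3 Y4]].
have ppx k : \sum_i pos_part (x i) ^+ k = \sum_i x i ^+ k.
  by apply: eq_bigr => i _; rewrite pos_part_id.
have ppy : \sum_j pos_part (y j) = \sum_j y j.
  by apply: eq_bigr => i _; rewrite pos_part_id.
have ppy2 : \sum_j pos_part (y j) ^+ 2 = \sum_j y j ^+ 2.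
  by apply: eq_bigr => i _; rewrite pos_part_id.
have pbx : \sum_i below M (fun u => pos_part u ^+ 2) (x i) = \sum_(i | x i <= M) x i ^+ 2.
  by rewrite [RHS]big_mkcond; apply: eq_bigr => i _; rewrite /below pos_part_id.
have pby : \sum_j below M (@pos_part R) (y j) = \sum_(j | y j <= M) y j.
  by rewrite [RHS]big_mkcond; apply: eq_bigr => i _; rewrite /below pos_part_id.
rewrite !ppx in X1 X3; rewrite pbx in X2; rewrite ppy in Y1; rewrite pby in Y2; rewrite ppy2 in Y3.
have q0' := ltW q0.
have r_lt1 : r < 1 by move: r3; clear; lra.
have r1 : 0 <= 1 - r by rewrite subr_ge0 ltW.
have r1' : 0 <= 1 + r by rewrite addr_ge0 ?ltW.
have up : (1 + r) * (1 + r) <= 1 + 3 * r.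
  have : r * r <= r * 3^-1 by rewrite ler_pM2l.
  by move: r0; clear; lra.
have dn : 1 - 3 * r <= (1 - r) * (1 - r).
  by have := sqr_ge0 r; move: r0; clear; lra.
have up2 : 1 + 3 * r <= 2 by move: r3; clear; lra.
have rr : 1 <= 2 * (1 - r) by move: r3; clear; lra.
have sx : (\sum_i x i ^+ 2) * q <= (1 + 3 * r) * f.
  apply: le_trans (ler_wpM2r q0' X1) _.
  rewrite -[leLHS]mulrA; apply: le_trans (ler_wpM2l (mulr_ge0 r1' (ltW a20)) mq2) _.
  rewrite [leLHS](_ : _ = (1 + r) * (1 + r) * f); last by rewrite /f; ring.
  by rewrite ler_pM2r.
have sx' : (1 - 3 * r) * f <= (\sum_(i | x i <= M) x i ^+ 2) * q.
  apply: le_trans _ (ler_wpM2r q0' (ltW X2)).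
  rewrite -[leRHS]mulrA; apply: le_trans _ (ler_wpM2l (mulr_ge0 r1 (ltW a20)) mq1).
  rewrite [leRHS](_ : _ = (1 - r) * (1 - r) * f); last by rewrite /f; ring.
  by rewrite ler_pM2r.
have sy : (\sum_j y j) * q <= (1 + 3 * r) * g.
  apply: le_trans (ler_wpM2r q0' Y1) _.
  rewrite -[leLHS]mulrA; apply: le_trans (ler_wpM2l (mulr_ge0 r1' (ltW b10)) nq2) _.
  rewrite [leLHS](_ : _ = (1 + r) * (1 + r) * g); last by rewrite /g; ring.
  by rewrite ler_pM2r.
have sy' : (1 - 3 * r) * g <= (\sum_(j | y j <= M) y j) * q.
  apply: le_trans _ (ler_wpM2r q0' (ltW Y2)).
  rewrite -[leRHS]mulrA; apply: le_trans _ (ler_wpM2l (mulr_ge0 r1 (ltW b10)) nq1).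
  rewrite [leRHS](_ : _ = (1 - r) * (1 - r) * g); last by rewrite /g; ring.
  by rewrite ler_pM2r.
apply: (conc m n x y q M) => //.
- apply: le_trans mq2 _; apply: le_trans _ sbC; rewrite ler_pM2r//.
  by move: r3; clear; lra.
- by apply: le_trans sx _; apply: le_trans _ fC; rewrite ler_pM2r.
- by apply: le_trans sy _; apply: le_trans _ gC; rewrite ler_pM2r.
- move=> j.
  (* A weight above [M'] is one of the terms of the tail sum, so it is at most the whole sum; a
     weight below [M'] is small because [n] is large. *)
  have yn : y j <= zeta * sb / 2 * n%:R.
    have [yM|My] := leP (y j) M'; first exact: le_trans yM M'n.
    have aj : above M' (@pos_part R) (y j) = y j by rewrite /above leNgt My pos_part_id.
    apply: le_trans _ Y4; rewrite (bigD1 j)//= aj lerDl; apply: sumr_ge0 => k _; apply: above_ge0 => u.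
    exact: pos_part_ge0.
  apply: le_trans (ler_wpM2r q0' yn) _; rewrite -[leLHS]mulrA.
  have zs0 : 0 <= zeta * sb / 2 by rewrite divr_ge0// mulr_ge0// ltW.
  apply: le_trans (ler_wpM2l zs0 nq2) _.
  rewrite [leLHS](_ : _ = zeta * ((1 + r) / 2)); last by field; rewrite gt_eqF.
  rewrite -[leRHS]mulr1 ler_pM2l//; by move: r_lt1; clear; lra.
(* The threshold [cubeX_low] is made for this: [zeta] cancels and [2 (1 - r)] remains, at least 1 as
   [r <= 1 / 3]. The same happens for [sqY_low] below. *)
- apply: (@le_trans _ _ (zeta * (q * (2 / (zeta * sb) * m%:R)))); last first.
    by rewrite ler_pM2l// ler_pM2l// ltW.
  rewrite [leRHS](_ : _ = 2 / sb * (m%:R * q)); last by field; rewrite !gt_eqF.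
  have s20 : 0 <= 2 / sb by rewrite divr_ge0// ltW.
  apply: le_trans _ (ler_wpM2l s20 mq1).
  by rewrite [leRHS](_ : _ = 2 * (1 - r)); last by field; rewrite gt_eqF.
- apply: (@le_trans _ _ (zeta * (q * (2 * sb / zeta * n%:R)))); last first.
    by rewrite ler_pM2l// ler_pM2l// ltW.
  rewrite [leRHS](_ : _ = 2 * sb * (n%:R * q)); last by field; rewrite !gt_eqF.
  have s20 : 0 <= 2 * sb by rewrite mulr_ge0// ltW.
  apply: le_trans _ (ler_wpM2l s20 nq1).
  by rewrite [leRHS](_ : _ = 2 * (1 - r)); last by field; rewrite gt_eqF.
Qed.

(** With [q] the inverse of sqrt (m n), [m q] is sqrt (m / n) and [n q] is its inverse, so both
    converge by continuity. *)
Lemma size_ratio (R : realType) (beta r : R) (m n : nat -> nat) :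
  0 < beta -> 0 < r ->
  (fun k : nat => ((m k)%:R / (n k)%:R : R)) @ \oo --> beta ->
  (forall N : nat, \forall k \near \oo, (N <= m k)%N) ->
  (forall N : nat, \forall k \near \oo, (N <= n k)%N) ->
  let sb := Num.sqrt beta in
  \forall k \near \oo, let q := (Num.sqrt ((m k)%:R * (n k)%:R))^-1 in
    [/\ 0 < q, (1 - r) * sb <= (m k)%:R * q <= (1 + r) * sb &
        (1 - r) / sb <= (n k)%:R * q <= (1 + r) / sb].
Proof.
move=> beta0 r0 mn mo no sb.
have sb0 : 0 < sb by rewrite sqrtr_gt0.
have c1 : (fun k => Num.sqrt ((m k)%:R / (n k)%:R : R)) @ \oo --> sb.
  by apply: continuous_cvg => //; exact: sqrt_continuous.
have c2 : (fun k => (Num.sqrt ((m k)%:R / (n k)%:R : R))^-1) @ \oo --> sb^-1.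
  by apply: cvgV => //; rewrite gt_eqF.
have e1 : \forall k \near \oo, `|sb - Num.sqrt ((m k)%:R / (n k)%:R)| <= r * sb.
  by move/cvgrPdist_le : c1; apply; rewrite mulr_gt0.
have e2 : \forall k \near \oo, `|sb^-1 - (Num.sqrt ((m k)%:R / (n k)%:R))^-1| <= r / sb.
  by move/cvgrPdist_le : c2; apply; rewrite divr_gt0.
have e3 := filterI (mo 1%N) (no 1%N).
case: e1 e2 e3 => [N1 _ e1] [N2 _ e2] [N3 _ e3].
exists (maxn N1 (maxn N2 N3)) => // k /=; rewrite !geq_max => /and3P[k1 k2 k3].
have := e1 k k1; have := e2 k k2; have [m0 n0] := e3 k k3.
rewrite !ler_norml => /andP[d3 d4] /andP[d1 d2].
have m_gt0 : 0 < (m k)%:R :> R by rewrite ltr0n.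
have n_gt0 : 0 < (n k)%:R :> R by rewrite ltr0n.
have sm0 : 0 < Num.sqrt (m k)%:R :> R by rewrite sqrtr_gt0.
have sn0 : 0 < Num.sqrt (n k)%:R :> R by rewrite sqrtr_gt0.
have smE : (m k)%:R = Num.sqrt (m k)%:R ^+ 2 :> R by rewrite sqr_sqrtr// ltW.
have snE : (n k)%:R = Num.sqrt (n k)%:R ^+ 2 :> R by rewrite sqr_sqrtr// ltW.
have qE : (Num.sqrt ((m k)%:R * (n k)%:R))^-1 = (Num.sqrt (m k)%:R * Num.sqrt (n k)%:R)^-1 :> R.
  by rewrite sqrtrM// ltW.
have rE : Num.sqrt ((m k)%:R / (n k)%:R) = Num.sqrt (m k)%:R / Num.sqrt (n k)%:R :> R.
  by rewrite sqrtrM ?sqrtrV// ltW.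
rewrite /= qE.
rewrite (_ : (m k)%:R * _ = Num.sqrt ((m k)%:R / (n k)%:R)); last first.
  by rewrite rE {1}smE; field; rewrite !gt_eqF.
rewrite (_ : (n k)%:R * _ = (Num.sqrt ((m k)%:R / (n k)%:R))^-1); last first.
  by rewrite rE {1}snE; field; rewrite !gt_eqF.
split.
- by rewrite invr_gt0 mulr_gt0.
- by apply/andP; move: d1 d2; clear; split; lra.
- by apply/andP; move: d3 d4; clear; split; lra.
Qed.

Theorem theorem3 (R : realType) (beta : R) (PX PY : probability R R)
  (m n : nat -> nat)
  (d : measure_display) (T : nat -> measurableType d)
  (P : forall k, probability (T k) R)
  (X : forall k, 'I_(m k) -> T k -> R) (Y : forall k, 'I_(n k) -> T k -> R)
  (H : forall k, 'I_(m k) -> 'I_(n k) -> T k -> bool) :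
  0 < beta ->
  PX [set x | x < 0] = 0%E ->
  PY [set y | y < 0] = 0%E ->
  (\int[PX]_x (x ^+ 2)%:E < +oo)%E ->
  (\int[PX]_x (x ^+ 3)%:E = +oo)%E ->
  (\int[PY]_y y%:E < +oo)%E ->
  (\int[PY]_y (y ^+ 2)%:E = +oo)%E ->
  (forall N : nat, \forall k \near \oo, (N <= m k)%N) ->
  (forall N : nat, \forall k \near \oo, (N <= n k)%N) ->
  (fun k : nat => ((m k)%:R / (n k)%:R : R)) @ \oo --> beta ->
  (forall k, rig_model PX PY (P k) (X k) (Y k) (H k)) ->
  let a2 := fine (\int[PX]_x (x ^+ 2)%:E) in
  let b1 := fine (\int[PY]_y y%:E) in
  let kappa := beta `^ (3 / 2) * a2 ^+ 2 / b1 in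
  forall eps : R, 0 < eps ->
  (fun k => P k [set t |
     eps < `| rig_clustering (fun i j => H k i j t) R
              - (1 + kappa * (\sum_(j < n k) Y k j t ^+ 2)
                             / (\sum_(i < m k) X k i t ^+ 3))^-1 |])
    @ \oo --> 0%E.
Proof.
move=> beta0 PX0 PY0 X2oo X3oo Y1oo Y2oo mo no mn model a2 b1 kappa eps eps0.
have a20 : 0 < a2 by exact: (@integral_pow_gt0 _ PX PX0 1).
have b10 : 0 < b1.
  have := @integral_pow_gt0 _ PY PY0 0; under eq_integral do rewrite expr1.
  exact.
pose sb := Num.sqrt beta; have sb0 : 0 < sb by rewrite sqrtr_gt0.
pose f := a2 * sb; pose g := b1 / sb.
have f0 : 0 < f by rewrite mulr_gt0.
have g0 : 0 < g by rewrite divr_gt0.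
(* Both sides equal [sb ^ 3 * a2 ^ 2 / b1], and [sb ^ 3] is beta to the power 3 / 2. *)
have kappaE : kappa = f ^+ 2 / g.
  rewrite /kappa /f /g (_ : beta `^ (3 / 2) = beta * sb); last first.
    rewrite (_ : 3 / 2 = 1 + 2^-1 :> R); last by field.
    rewrite powRD ?powRr1 ?powR12_sqrt// ?ltW//.
    by rewrite gt_eqF ?implybT.
  rewrite -{1}(sqr_sqrtr (ltW beta0)) -/sb.
  by field; rewrite !gt_eqF.
have mp := @measurable_pos_part R; have mpX := @measurable_pos_partX R.
have p0 := @pos_part_ge0 R; have p20 (u : R) : 0 <= pos_part u ^+ 2 by rewrite exprn_ge0.
have p30 (u : R) : 0 <= pos_part u ^+ 3 by rewrite exprn_ge0.
have mXn k : measurable_fun setT (fun u : R => u ^+ k) by exact: measurable_funX.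
have iX2 : (\int[PX]_x (pos_part x ^+ 2)%:E = a2%:E)%E.
  rewrite -(integral_pos_part PX0 (mXn 2)) /a2 fineK// ge0_fin_numE//.
  by apply: integral_ge0 => x _; rewrite lee_fin sqr_ge0.
have iX3 : (\int[PX]_x (pos_part x ^+ 3)%:E = +oo)%E.
  by rewrite -(integral_pos_part PX0 (mXn 3)).
have iY1' : (\int[PY]_y (pos_part y)%:E = \int[PY]_y y%:E)%E.
  by rewrite -(integral_pos_part PY0 (f := id)).
have iY1 : (\int[PY]_y (pos_part y)%:E = b1%:E)%E.
  rewrite /b1 -iY1' fineK// ge0_fin_numE ?iY1'//.
  by rewrite -iY1'; apply: integral_ge0 => x _; rewrite lee_fin.
have iY2 : (\int[PY]_y (pos_part y ^+ 2)%:E = +oo)%E.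
  by rewrite -(integral_pos_part PY0 (mXn 2)).
pose S k := [set t | eps < `| rig_clustering (fun i j => H k i j t) R
                              - limit_ratio kappa (X k ^~ t) (Y k ^~ t) |].
have mS k : measurable (S k) by exact: (measurable_bad (model k)).
have Sfin k : P k (S k) \is a fin_num by exact: (fin_num_measure (P k) _ (mS k)).
suff main : forall e : R, 0 < e -> \forall k \near \oo, (P k (S k) <= e%:E)%E.
  pose u k : R := fine (P k (S k)).
  rewrite (_ : (fun k => _) = EFin \o u); last first.
    by apply/funext => k; rewrite /u /= (fineK (Sfin k)).
  apply: cvg_EFin; first exact: nearW.
  apply/cvgrPdist_le => e e0; have := main e e0; apply: filterS => k Pk.
  have uk0 : 0 <= u k by exact: (fine_ge0 (measure_ge0 (P k) (S k))).
  rewrite sub0r normrN ger0_norm//.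
  by rewrite -lee_fin /u (fineK (Sfin k)).
move=> e e0.
(* In [clustering_concentration] one parameter is both the deviation and the probability bound, so
   it must lie below [eps] and below half of [e]. *)
pose eps1 := Num.min eps (e / 2).
have eps10 : 0 < eps1 by rewrite lt_min eps0 divr_gt0.
have [rho /andP[rho0 rho1] conc] := clustering_concentration f0 g0 eps10.
pose r := rho / 3.
have r0 : 0 < r by rewrite divr_gt0.
have r3 : r <= 3^-1 by rewrite /r ler_pdivrMr// mulVf ?ltW// pnatr_eq0.
have rhoE : rho = 3 * r by rewrite /r mulrC divfK.
have r_lt1 : 0 < 1 - r by rewrite subr_gt0; move: r3; clear; lra.
have trX : (((1 - r) * a2)%:E < \int[PX]_x (pos_part x ^+ 2)%:E)%E.
  by rewrite iX2 lte_fin gtr_pMl// gtrBl.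
have trY : (((1 - r) * b1)%:E < \int[PY]_x (pos_part x)%:E)%E.
  by rewrite iY1 lte_fin gtr_pMl// gtrBl.
have [M1 [M10 HM1]] := truncation_gt (mpX 2) p20 trX.
have [M2 [M20 HM2]] := truncation_gt mp p0 trY.
pose M := Num.max M1 M2.
have {}HM1 := HM1 M (_ : M1 <= M); have {}HM1 := HM1 ltac:(by rewrite le_max lexx).
have {}HM2 := HM2 M (_ : M2 <= M); have {}HM2 := HM2 ltac:(by rewrite le_max lexx orbT).
have M0 : 0 < M by rewrite lt_max M10.
pose C := 1 + M + 2 * sb + 2 * f + 2 * g.
have [C1 MC sbC fC gC] : [/\ 1 <= C, M <= C, 2 * sb <= C, 2 * f <= C & 2 * g <= C].
  by rewrite /C; move: M0 sb0 f0 g0; clear; split; lra.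
clearbody C.
have [zeta zeta0 {}conc] := conc C C1.
pose tl := zeta * sb / 2.
have tl0 : 0 < tl by rewrite divr_gt0// mulr_gt0.
have Y1lt : (\int[PY]_x (pos_part x)%:E < +oo)%E by rewrite iY1 ltry.
have [M' [M'0 HM']] := tail_lt mp p0 Y1lt tl0.
(* The seven laws of large numbers share the other half of [e]. *)
pose e1 := e / 14; have e10 : 0 < e1 by rewrite divr_gt0.
pose B := rig_bounds a2 b1 sb r zeta M M'.
have up_lt c : 0 < c -> c < (1 + r) * c by move=> c0; rewrite mulrDl mul1r ltrDl mulr_gt0.
have upX : (\int[PX]_x (pos_part x ^+ 2)%:E < (sqX_up B)%:E)%E by rewrite iX2 lte_fin up_lt.
have upY : (\int[PY]_x (pos_part x)%:E < (Y_up B)%:E)%E by rewrite iY1 lte_fin up_lt.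
have loX3 : ((cubeX_low B)%:E < \int[PX]_x (pos_part x ^+ 3)%:E)%E by rewrite iX3 ltry.
have loY2 : ((sqY_low B)%:E < \int[PY]_x (pos_part x ^+ 2)%:E)%E by rewrite iY2 ltry.
have bp2 u : 0 <= below M (fun u : R => pos_part u ^+ 2) u by exact: below_ge0.
have bp1 u : 0 <= below M (@pos_part R) u by exact: below_ge0.
have ap1 u : 0 <= above M' (@pos_part R) u by exact: above_ge0.
have [N1 HN1] := lln_upper (mpX 2) p20 upX e10.
have [N2 HN2] := lln_lower (measurable_below M (mpX 2)) bp2 HM1 e10.
have [N3 HN3] := lln_lower (mpX 3) p30 loX3 e10.
have [N4 HN4] := lln_upper mp p0 upY e10.
have [N5 HN5] := lln_lower (measurable_below M mp) bp1 HM2 e10.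
have [N6 HN6] := lln_lower (mpX 2) p20 loY2 e10.
have [N7 HN7] := lln_upper (measurable_above M' mp) ap1 HM' e10.
(* [N8] makes the tail cutoff [M'] at most [tl * n], and [N9] makes [q] at most [zeta]. *)
pose N8 := Num.bound (M' / tl); pose N9 := Num.bound (2 / sb / zeta).
have [K0 _ HK0] := size_ratio beta0 r0 mn mo no.
have [K1 _ HK1] := mo (maxn N1 (maxn N2 N3)).
have [K2 _ HK2] := no (maxn N4 (maxn N5 (maxn N6 (maxn N7 (maxn N8 (maxn N9 1)))))).
exists (maxn K0 (maxn K1 K2)) => // k /=; rewrite !geq_max => /and3P[k0 k1 k2].
have := HK1 k k1; rewrite /= !geq_max => /and3P[n1 n2 n3].
have := HK2 k k2; rewrite /= !geq_max => /and5P[n4 n5 n6 n7 /and3P[n8 n9 n_gt0]].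
have [q0 mq nq] := HK0 k k0.
have nk0 : 0 < (n k)%:R :> R by rewrite ltr0n.
have M'n : M' <= tl * (n k)%:R.
  rewrite mulrC -ler_pdivrMr//; apply: le_trans (_ : N8%:R <= _); last by rewrite ler_nat.
  by apply/ltW/archi_boundP; rewrite divr_ge0// ltW.
have qz : (Num.sqrt ((m k)%:R * (n k)%:R))^-1 <= zeta.
  rewrite -(ler_pM2l nk0); case/andP: nq => _ nq; apply: le_trans nq _.
  apply: (@le_trans _ _ (2 / sb)).
    by rewrite ler_pM2r ?invr_gt0//; move: r3; clear; lra.
  rewrite -ler_pdivrMr//; apply: le_trans (_ : N9%:R <= _); last by rewrite ler_nat.
  by apply/ltW/archi_boundP; rewrite !divr_ge0// ltW.
rewrite rhoE in conc.
have det := typical_deviation a20 b10 sb0 r0 r3 zeta0 conc kappaE MC sbC fC gC q0 qz M'n mq nq.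
have iX := model_iidX (model k); have iY := model_iidY (model k).
have le1 : (P k (S k) <= (eps1 + 7 * e1)%:E)%E.
  have := prob_bad_le (model k) PX0 PY0 (ltW eps10) det
    (HN1 _ n1 _ _ _ _ iX) (HN2 _ n2 _ _ _ _ iX) (HN3 _ n3 _ _ _ _ iX)
    (HN4 _ n4 _ _ _ _ iY) (HN5 _ n5 _ _ _ _ iY) (HN6 _ n6 _ _ _ _ iY)
    (HN7 _ n7 _ _ _ _ iY).
  apply: le_trans; apply: le_measure; rewrite ?inE.
  - exact: mS.
  - exact: (measurable_bad (model k)).
  - by move=> t /=; apply: le_lt_trans; rewrite ge_min lexx.
apply: le_trans le1 _; rewrite lee_fin.
have : eps1 <= e / 2 by rewrite ge_min lexx orbT.
by rewrite /e1; move: e0; clear; lra.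
Qed.
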